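(* Let $V=V(\sigma,L,R)$ be a Lévy process (notation of the context) such that $$\frac{x^2\left(\int_{-\infty}^{-x}dL(y)+\int_{x}^{+\infty}dR(y)\right)}{\int_{-x}^{0}y^2dL(y)+\int_{0}^{x}y^2dR(y)}\to0\quad\text{as } x\to\infty .$$ Let $\sigma_W\ge 0$ and let $s_n,a_n$ be sequences of positive real numbers with $s_n\to\infty$, $a_n\to\infty$ as $n\to\infty$, such that $s_nL(a_ny)\to0$ for all $y<0$, $s_nR(a_ny)\to0$ for all $y>0$ as $n\to\infty$, and $$\lim_{\varepsilon\to0}\limsup_{n\to\infty}\left\{\int_{-\varepsilon}^{0}u^2\,d\big(s_nL(a_nu)\big)+\frac{\sigma^2}{a_n^2}s_n+\int_0^{\varepsilon}u^2\,d\big(s_nR(a_nu)\big)\right\}$$ $$=\lim_{\varepsilon\to0}\liminf_{n\to\infty}\left\{\int_{-\varepsilon}^{0}u^2\,d\big(s_nL(a_nu)\big)+\frac{\sigma^2}{a_n^2}s_n+\int_0^{\varepsilon}u^2\,d\big(s_nR(a_nu)\big)\right\}=\sigma_W^2 .$$ Put $$b_n=\int_{-\infty}^{0}\frac{z^3(a_n^2-1)}{(1+z^2)(1+a_n^2z^2)}\,d\big(s_nL(a_nz)\big)+\int_0^{+\infty}\frac{z^3(a_n^2-1)}{(1+z^2)(1+a_n^2z^2)}\,d\big(s_nR(a_nz)\big)$$ and $$X_n(t)=\frac{V(s_nt)}{a_n}-tb_n,\qquad t\in[0,1],\ n\in\mathbb{N}.$$ Then $X_n\xrightarrow{d}\sigma_WW$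 as $n\to\infty$ in $D[0,1]$, where $W$ is the standard Wiener process.
   Context: A Lévy process $V(t)$, $t\ge 0$, is a homogeneous, stochastically continuous random process with independent increments, $V(0)=0$, and trajectories in the Skorohod space (right-continuous with left limits). $D[0,1]$ is the Skorohod space with its usual (Skorohod) metric; processes are identified with the corresponding random elements of $D[0,1]$; $\xrightarrow{d}$ denotes convergence in distribution. $V(\sigma,L,R)$ denotes a Lévy process with characteristic function $$\mathbb{E}\, e^{ixV(t)}=\exp\Big[-\frac{\sigma^2x^2t}{2}+t\Big\{\int_{-\infty}^0\Big(e^{ixy}-1-\frac{ixy}{1+y^2}\Big)dL(y)+\int_0^{\infty}\Big(e^{ixy}-1-\frac{ixy}{1+y^2}\Big)dR(y)\Big\}\Big],\quad x\in\mathbb{R},$$ where $L$ is left-continuous and non-decreasing on $(-\infty,0)$ with $L(-\infty)=0$, $R$ is right-continuous and non-decreasing on $(0,\infty)$ with $R(\infty)=0$, and $\int_{-\varepsilon}^0y^2dL(y)+\int_0^{\varepsilon}y^2dR(y)<+\infty$ for all $\varepsilon>0$. (The linear drift parameter $\gamma$ in the Lévy representation is taken to be $0$ throughout.) The integrals $d(s_nL(a_nz))$, $d(s_nR(a_nz))$ are Lebesgue–Stieltjes integrals in $z$. *)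

(* Defs.v *)
From HB Require Import structures.
From mathcomp Require Import all_boot all_order all_algebra complex.
From mathcomp Require Import all_classical all_reals all_analysis.
From mathcomp Require Import measurable_realfun ring.

Set Implicit Arguments.
Unset Strict Implicit.
Unset Printing Implicit Defensive.

Import Order.TTheory GRing.Theory Num.Theory.
Import numFieldNormedType.Exports.

Local Open Scope classical_set_scope.
Local Open Scope ring_scope.

Section SkorohodSpace.
Variable K : realType.
Implicit Types (x y z l : K -> K) (t e : K).

Definition cadlag01 x :=
  (forall t, 0 <= t < 1 -> x u @[u --> t^'+] --> x t) /\
  (forall t, 0 < t <= 1 -> cvg (x u @[u --> t^'-])).

(* D[0,1]: a path is stored as a total function that vanishes off [0,1], so   *)
(* that Leibniz equality is equality of the paths on [0,1].                   *)
Record skorohod := Skorohod {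
  path :> K -> K ;
  path_cadlag : cadlag01 path ;
  path_off : forall t, ~~ (0 <= t <= 1) -> path t = 0 }.

Lemma skorohod_ext (x y : skorohod) :
  (forall t, 0 <= t <= 1 -> x t = y t) -> x = y.
Proof.
case: x y => [x cx ox] [y cy oy] /= xy.
have E : x = y.
  apply/funext => t; have [/xy//|n] := boolP (0 <= t <= 1).
  by rewrite ox// oy.
by subst y; congr Skorohod; exact: Prop_irrelevance.
Qed.

HB.instance Definition _ := gen_eqMixin skorohod.
HB.instance Definition _ := gen_choiceMixin skorohod.

Definition time_change l :=
  [/\ {within `[0, 1], continuous l},
      {in `[0, 1]%R &, {homo l : s t / s < t}}, l 0 = 0 & l 1 = 1].

(* The Skorohod distance is the infimum of the e > 0 for which some time      *)
(* change l has sup |l t - t| <= e and sup |x t - y (l t)| <= e.              *)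
Definition skorohod_close x y e := 0 < e /\
  exists2 l, time_change l & forall t, 0 <= t <= 1 ->
    `|l t - t| <= e /\ `|x t - y (l t)| <= e.

Definition skorohod_dist x y : K := inf [set e | skorohod_close x y e].

Lemma time_change_mono l : time_change l ->
  {in `[0, 1]%R &, {mono l : s t / s <= t}}.
Proof. by case=> _ l_lt _ _; exact: le_mono_in. Qed.

Lemma time_change01 l t : time_change l -> 0 <= t <= 1 -> 0 <= l t <= 1.
Proof.
move=> tl t01; have m := time_change_mono tl; case: tl => _ _ <- <-.
rewrite !m ?in_itv//= ?lexx ?ler01//.
Qed.

Lemma time_change_surj l u : time_change l -> 0 <= u <= 1 ->
  exists2 t, 0 <= t <= 1 & l t = u.
Proof.
case=> cl _ l0 l1 u01; have := @IVT K l 0 1 u ler01 cl.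
rewrite l0 l1 (min_idPl ler01) (max_idPr ler01) => /(_ u01)[t].
by rewrite in_itv/=; exists t.
Qed.

Lemma time_changeI l : {in `[0, 1]%R &, {homo l : s t / s < t}} ->
  l 0 = 0 -> l 1 = 1 ->
  (forall u, 0 <= u <= 1 -> exists2 t, 0 <= t <= 1 & l t = u) -> time_change l.
Proof.
move=> l_lt l0 l1 ls; split=> //; apply: segment_inc_surj_continuous.
  exact: le_mono_in.
rewrite l0 l1 => u /=; rewrite in_itv/= => /ls[t t01 <-].
by exists t => //=; rewrite in_itv.
Qed.

Lemma time_change_id : time_change id.
Proof.
by apply: time_changeI => // u u01; exists u.
Qed.

Lemma time_change_comp l m : time_change l -> time_change m ->
  time_change (m \o l).
Proof.
move=> tl tm; have [_ ll l0 l1] := tl; have [_ ml m0 m1] := tm.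
apply: time_changeI => [s t s01 t01 st| | |u] /=; rewrite ?l0 ?l1 ?m0 ?m1//.
  apply: ml; rewrite ?in_itv/=; first exact: time_change01.
    exact: time_change01.
  exact: ll.
move=> /(time_change_surj tm)[v /(time_change_surj tl)[t t01 <-] <-].
by exists t.
Qed.

Lemma time_change_inv l : time_change l -> exists2 m, time_change m &
  (forall t, 0 <= t <= 1 -> l (m t) = t).
Proof.
move=> tl; pose m u := xget 0 [set t | 0 <= t <= 1 /\ l t = u].
have mP u : 0 <= u <= 1 -> 0 <= m u <= 1 /\ l (m u) = u.
  move=> /(time_change_surj tl)[t t01 ltu].
  exact: (@xgetPex _ 0 [set t | 0 <= t <= 1 /\ l t = u]) (ex_intro _ t _).
have mono := time_change_mono tl; have [_ _ l0 l1] := tl.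
have lm t : 0 <= t <= 1 -> m (l t) = t.
  move=> t01; have [a b] := mP _ (time_change01 tl t01).
  by apply: (inc_inj_in mono); rewrite ?in_itv.
exists m; last by move=> t /mP[].
apply: time_changeI.
- move=> s t; rewrite !in_itv/= => /mP[s01 ls] /mP[t01 lt].
  by rewrite -[in X in X -> _]ls -[in X in X -> _]lt (leW_mono_in mono)// in_itv.
- by rewrite -[in m 0]l0 lm// lexx ler01.
- by rewrite -[in m 1]l1 lm// lexx ler01.
- by move=> u u01; exists (l u); [exact: time_change01|exact: lm].
Qed.

Lemma cadlag01_bounded x : cadlag01 x ->
  exists M, forall t, 0 <= t <= 1 -> `|x t| <= M.
Proof.
move=> [xr xl].
have bnd (l a : K) : `|l - a| <= 1 -> `|a| <= `|l| + 1.
  by move=> h; rewrite -lerBlDl (le_trans (lerB_dist _ _))// distrC.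
have loc t : 0 <= t <= 1 ->
    exists M, \forall u \near t, 0 <= u <= 1 -> `|x u| <= M.
  move=> /andP[t0 t1].
  have [Mr Hr] : exists M, \forall u \near t, t < u -> 0 <= u <= 1 -> `|x u| <= M.
    have [t1'|t1'] := ltP t 1; last first.
      exists 0; near=> u => tu /andP[_ u1].
      by have := lt_le_trans tu u1; rewrite ltNge t1'.
    have /xr/cvgrPdist_le/(_ 1 ltr01) : 0 <= t < 1 by rewrite t0.
    rewrite /at_right near_withinE => H; exists (`|x t| + 1).
    by apply: filterS H => u h tu _; exact/bnd/h.
  have [Ml Hl] : exists M, \forall u \near t, u < t -> 0 <= u <= 1 -> `|x u| <= M.
    have [t0'|t0'] := ltP 0 t; last first.
      exists 0; near=> u => ut /andP[u0 _].
      by have := le_lt_trans u0 ut; rewrite ltNge t0'.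
    have /xl/cvg_ex[l /cvgrPdist_le/(_ 1 ltr01)] : 0 < t <= 1 by rewrite t0'.
    rewrite /at_left near_withinE => H; exists (`|l| + 1).
    by apply: filterS H => u h ut _; exact/bnd/h.
  exists (Num.max `|x t| (Num.max Mr Ml)).
  near=> u => u01; rewrite !le_max; have [ut|tu|->] := ltgtP u t.
  - by rewrite [X in _ || (_ || X)](near Hl u) ?orbT.
  - by rewrite [X in _ || (X || _)](near Hr u) ?orbT.
  - by rewrite lexx.
have /compact_near_coveringP c := @segment_compact K 0 1.
have [M [_ H]] : \forall M \near +oo,
    `[0, 1] `<=` (fun t => 0 <= t <= 1 -> `|x t| <= M).
  apply: c => t; rewrite /= in_itv/= => /loc[M HM].
  exists ([set u | 0 <= u <= 1 -> `|x u| <= M], [set N | M < N]) => /=.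
    by split=> //; exists M; split=> //; exact: num_real.
  move=> [u N] /= [h MN] u01; exact: le_trans (h u01) (ltW MN).
by exists (M + 1) => t t01; apply: (H (M + 1)) => //=; rewrite ltrDl.
Unshelve. all: end_near. Qed.

Lemma skorohod_dist_lt (x y : skorohod) e :
  skorohod_dist x y < e <-> exists2 e', e' < e & skorohod_close x y e'.
Proof.
have lb : has_lbound [set e | skorohod_close x y e].
  by exists 0 => e' [/ltW].
split=> [h|[e' lt c]]; last first.
  by rewrite (le_lt_trans _ lt)//; apply: ge_inf.
have [M xM] := cadlag01_bounded (path_cadlag x).
have [N yN] := cadlag01_bounded (path_cadlag y).
have M0 : 0 <= M by rewrite (le_trans _ (xM 0 _))// lexx ler01.
have N0 : 0 <= N by rewrite (le_trans _ (yN 0 _))// lexx ler01.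
have hi : has_inf [set e | skorohod_close x y e].
  split=> //; exists (M + N + 1); split; first by rewrite ltr_wpDl ?addr_ge0.
  exists id; first exact: time_change_id.
  move=> t t01; rewrite subrr normr0 !addr_ge0//; split=> //.
  by rewrite (le_trans (ler_normB _ _))// -[leLHS]addr0 lerD// lerD ?xM ?yN.
have d0 : 0 < e - skorohod_dist x y by rewrite subr_gt0.
have [e' c lt] := inf_adherent d0 hi.
by exists e' => //; rewrite (lt_le_trans lt)// addrC subrK.
Qed.

Lemma skorohod_dist_ge0 (x y : skorohod) : 0 <= skorohod_dist x y.
Proof.
rewrite leNgt; apply/negP => /skorohod_dist_lt[e lt [/lt_trans/(_ lt)]].
by rewrite ltxx.
Qed.

Lemma skorohod_distxx (x : skorohod) : skorohod_dist x x = 0.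
Proof.
apply/eqP; rewrite eq_le skorohod_dist_ge0 andbT leNgt; apply/negP => d0.
have [e e0 ed] : exists2 e, 0 < e & e < skorohod_dist x x.
  by exists (skorohod_dist x x / 2); rewrite ?divr_gt0// ltr_pdivrMr// ltr_pMr// ltr1n.
suff : skorohod_dist x x < skorohod_dist x x by rewrite ltxx.
apply/skorohod_dist_lt; exists e => //; split=> //.
by exists id; [exact: time_change_id|move=> t _; rewrite !subrr normr0 (ltW e0)].
Qed.

Lemma skorohod_close_sym (x y : K -> K) e :
  skorohod_close x y e -> skorohod_close y x e.
Proof.
move=> [e0 [l tl h]]; split=> //; have [m tm lm] := time_change_inv tl.
exists m => // t t01; have := h (m t) (time_change01 tm t01).
by rewrite lm// distrC (distrC (x _)) => -[].
Qed.

Lemma skorohod_dist_sym (x y : skorohod) : skorohod_dist x y = skorohod_dist y x.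
Proof.
by congr inf; apply/seteqP; split=> e; exact: skorohod_close_sym.
Qed.

Lemma skorohod_dist_triangle (y x z : skorohod) :
  skorohod_dist x z <= skorohod_dist x y + skorohod_dist y z.
Proof.
apply/ler_addgt0Pl => e e0.
have e20 : 0 < e / 2 by rewrite divr_gt0.
have /skorohod_dist_lt[a alt [a0 [l tl hl]]] :
  skorohod_dist x y < skorohod_dist x y + e / 2 by rewrite ltrDl.
have /skorohod_dist_lt[b blt [b0 [m tm hm]]] :
  skorohod_dist y z < skorohod_dist y z + e / 2 by rewrite ltrDl.
have -> : e + (skorohod_dist x y + skorohod_dist y z) =
  (skorohod_dist x y + e / 2) + (skorohod_dist y z + e / 2).
  by rewrite [in LHS](splitr e) addrC addrACA.
apply/ltW/skorohod_dist_lt; exists (a + b); first exact: ltrD.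
split; first exact: addr_gt0.
exists (m \o l); first exact: time_change_comp.
move=> t t01; have [h1 h2] := hl t t01.
have [h3 h4] := hm _ (time_change01 tl t01).
split => /=.
  by rewrite -(subrKA (l t)) (addrC a) (le_trans (ler_normD _ _))// lerD.
by rewrite -(subrKA (y (l t))) (le_trans (ler_normD _ _))// lerD.
Qed.

Lemma skorohod_dist0 (x y : skorohod) : skorohod_dist x y = 0 -> x = y.
Proof.
move=> d0; apply: skorohod_ext => t /andP[t0 t1].
have close e : 0 < e -> exists2 l, time_change l & forall t, 0 <= t <= 1 ->
    `|l t - t| <= e /\ `|x t - y (l t)| <= e.
  move=> e_gt0; have : skorohod_dist x y < e by rewrite d0.
  move=> /skorohod_dist_lt[a ae [a0 [l tl h]]]; exists l => // u u01.
  by have [h1 h2] := h u u01; split; [exact: le_trans h1 (ltW ae)|exact: le_trans h2 (ltW ae)].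
apply/eqP; rewrite -subr_eq0 -normr_le0; apply/ler_addgt0Pl => e e0.
rewrite addr0.
have [t1'|t1'] := ltP t 1; last first.
  have {t1 t1'}-> : t = 1 by apply/eqP; rewrite eq_le t1.
  have [l [_ _ _ l1] /(_ 1)] := close e e0.
  by rewrite l1 lexx ler01 => /(_ isT)[].
have e30 : 0 < e / 3 by rewrite divr_gt0.
have [xr _] := path_cadlag x; have [yr _] := path_cadlag y.
have t01 : 0 <= t < 1 by rewrite t0.
have /cvgrPdist_le/(_ _ e30) Hx := xr _ t01.
have /cvgrPdist_le/(_ _ e30) Hy := yr _ t01.
move: Hx Hy; rewrite /at_right !near_withinE => Hx Hy.
have [r /= r0 H] := (iffLR (nbhs_ballP _ _)) (filterI Hx Hy).
pose q := Num.min r (1 - t); have q0 : 0 < q by rewrite lt_min r0 subr_gt0.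
have q20 : 0 < q / 2 by rewrite divr_gt0.
pose u := t + q / 2.
have qr v : `|v - u| < q / 2 -> t < v /\ ball t r v.
  rewrite ltr_distl /u => /andP[]; rewrite addrK => tv vt; split=> //.
  rewrite /ball/= distrC gtr0_norm ?subr_gt0// ltrBlDl (lt_le_trans vt)//.
  by rewrite -addrA -splitr lerD2l ge_min lexx.
have u01 : 0 <= u <= 1.
  rewrite /u addr_ge0 ?(ltW q20)//= -lerBrDl.
  by rewrite (@le_trans _ _ q)// ?ge_min ?lexx ?orbT// ler_pdivrMr// ler_pMr// ler1n.
pose e' := Num.min (e / 3) (q / 4).
have e'0 : 0 < e' by rewrite lt_min e30 divr_gt0.
have [l tl h] := close e' e'0; have [h1 h2] := h _ u01.
have lu : `|l u - u| < q / 2.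
  rewrite (le_lt_trans h1)// gt_min; apply/orP; right.
  by rewrite ltr_pM2l// ltf_pV2 ?posrE// ltr_nat.
have [tl1 bl] := qr _ lu.
have [tu1 bu] : t < u /\ ball t r u by apply: qr; rewrite subrr normr0.
have [/(_ tu1) hx _] := H _ bu; have [_ /(_ tl1) hy] := H _ bl.
rewrite -(subrKA (x u)) (le_trans (ler_normD _ _))//.
rewrite -(subrKA (y (l u)) (x u)).
have -> : e = e / 3 + (e / 3 + e / 3) by field.
rewrite lerD// (le_trans (ler_normD _ _))// lerD//.
  by rewrite (le_trans h2)// ge_min lexx.
by rewrite distrC.
Qed.

HB.instance Definition _ := @isMetric.Build K skorohod
  (fun x y : skorohod => skorohod_dist x y) skorohod_distxx skorohod_dist0
  skorohod_dist_sym skorohod_dist_triangle.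

Lemma cadlag01_scale c x : cadlag01 x -> cadlag01 (fun t => c * x t).
Proof.
move=> [xr xl]; split=> t t01; first by apply: cvgMl_tmp; exact: xr.
by apply: is_cvgMl_tmp; exact: xl.
Qed.

Lemma scale_off c (x : skorohod) t : ~~ (0 <= t <= 1) -> c * x t = 0.
Proof. by move=> /path_off->; rewrite mulr0. Qed.

Definition skorohod_scale c (x : skorohod) : skorohod :=
  Skorohod (cadlag01_scale c (path_cadlag x)) (@scale_off c x).

End SkorohodSpace.

Section StieltjesHalfLine.
Variable K : realType.
Implicit Types (F : K -> K).

Definition cumul_pos F := {in `]0, +oo[%R &, {homo F : x y / x <= y}} /\
  (forall x, 0 < x -> F y @[y --> x^'+] --> F x).

Definition cumul_neg F := {in `]-oo, 0[%R &, {homo F : x y / x <= y}} /\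
  (forall x, x < 0 -> F y @[y --> x^'-] --> F x).

Lemma cumul_exp_nd F : cumul_pos F -> nondecreasing (F \o expR).
Proof.
by move=> [F_nd _] x y xy /=; apply: F_nd; rewrite ?in_itv/= ?andbT ?expR_gt0// ler_expR.
Qed.

Lemma cumul_exp_rc F : cumul_pos F -> right_continuous (F \o expR).
Proof.
move=> [_ F_rc] x; apply: cvg_comp (F_rc _ (expR_gt0 x)).
move=> A; rewrite /at_right !nbhs_simpl/= /within/= => HA.
have := @continuous_expR K x _ HA; rewrite !nbhs_simpl/=.
by apply: filterS => y h xy; apply: h; rewrite ltr_expR.
Qed.

Definition cumul_exp F of cumul_pos F := F \o expR.

HB.instance Definition _ F (H : cumul_pos F) :=
  isCumulative.Build K _ K (cumul_exp H) (cumul_exp_nd H) (cumul_exp_rc H).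

(* dF for F non-decreasing and right-continuous on ]0, +oo[, possibly         *)
(* unbounded near 0: expR maps the line onto ]0, +oo[, so dF is the image     *)
(* under expR of the Lebesgue-Stieltjes measure of F \o expR.                 *)
Definition stieltjes_exp F (H : cumul_pos F) : set K -> \bar K :=
  pushforward (lebesgue_stieltjes_measure (cumul_exp H))
    (expR : measurableTypeR K -> K).

Section stieltjes_exp_measure.
Variables (F : K -> K) (H : cumul_pos F).

Let mexp : measurable_fun [set: measurableTypeR K]
  (expR : measurableTypeR K -> K).
Proof. exact: measurable_expR. Qed.

Let stieltjes_exp0 : stieltjes_exp H set0 = 0%E.
Proof. exact: measure0. Qed.

Let stieltjes_exp_ge0 A : (0 <= stieltjes_exp H A)%E.
Proof. exact: measure_ge0. Qed.

Let stieltjes_exp_sigma_additive : semi_sigma_additive (stieltjes_exp H).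
Proof. exact: measure_semi_sigma_additive. Qed.

HB.instance Definition _ := isMeasure.Build _ _ _ (stieltjes_exp H)
  stieltjes_exp0 stieltjes_exp_ge0 stieltjes_exp_sigma_additive.

End stieltjes_exp_measure.

Definition stieltjes_pos F : {measure set K -> \bar K} :=
  if pselect (cumul_pos F) is left H then stieltjes_exp H else mzero.

Lemma stieltjes_pos_itv F (a b : K) : cumul_pos F -> 0 < a -> a <= b ->
  stieltjes_pos F `]a, b]%classic = (F b - F a)%:E.
Proof.
move=> H a0 ab; rewrite /stieltjes_pos; case: pselect => // {}H.
have b0 := lt_le_trans a0 ab.
rewrite /= /stieltjes_exp /pushforward.
have -> : expR @^-1` `]a, b]%classic = `]ln a, ln b]%classic :> set K.
  apply/seteqP; split=> x; rewrite /= !in_itv/= => /andP[];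
  by rewrite -[in ln a < x]ltr_expR -[in x <= ln b]ler_expR !lnK ?posrE// => -> ->.
rewrite /lebesgue_stieltjes_measure /measure_extension/=.
rewrite measurable_mu_extE/=; last exact: is_ocitv.
by rewrite wlength_itv_bnd ?ler_ln ?posrE// /cumul_exp/= !lnK ?posrE.
Qed.

Lemma stieltjes_pos_off F : stieltjes_pos F `]-oo, 0]%classic = 0%E.
Proof.
rewrite /stieltjes_pos; case: pselect => //= H.
rewrite /stieltjes_exp /pushforward (_ : _ @^-1` _ = set0) ?measure0//.
by apply/seteqP; split=> x //=; rewrite in_itv/= leNgt expR_gt0.
Qed.

Lemma cumul_neg_pos F : cumul_neg F -> cumul_pos (fun y => - F (- y)).
Proof.
move=> [F_nd F_lc]; split=> [x y|x x0].
  rewrite !in_itv/= !andbT => x0 y0 xy; rewrite lerN2.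
  by apply: F_nd; rewrite ?in_itv/= ?oppr_lt0// lerN2.
have /F_lc/cvg_at_leftNP : - x < 0 by rewrite oppr_lt0.
by rewrite opprK => h; exact: cvgN h.
Qed.

(* dF for F non-decreasing and left-continuous on ]-oo, 0[: the image under   *)
(* the reflection y |-> - y of dG, where G y = - F (- y).                     *)
Definition stieltjes_neg F : set K -> \bar K :=
  pushforward (stieltjes_pos (fun y => - F (- y))) (-%R : K -> K).

Section stieltjes_neg_measure.
Variable F : K -> K.

Let mopp : measurable_fun [set: K] (-%R : K -> K).
Proof. by apply: continuous_measurable_fun; exact: opp_continuous. Qed.

Let stieltjes_neg0 : stieltjes_neg F set0 = 0%E.
Proof. exact: measure0. Qed.

Let stieltjes_neg_ge0 A : (0 <= stieltjes_neg F A)%E.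
Proof. exact: measure_ge0. Qed.

Let stieltjes_neg_sigma_additive : semi_sigma_additive (stieltjes_neg F).
Proof. exact: measure_semi_sigma_additive. Qed.

HB.instance Definition _ := isMeasure.Build _ _ _ (stieltjes_neg F)
  stieltjes_neg0 stieltjes_neg_ge0 stieltjes_neg_sigma_additive.

End stieltjes_neg_measure.

Lemma stieltjes_neg_itv F (a b : K) : cumul_neg F -> a <= b -> b < 0 ->
  stieltjes_neg F `[a, b[%classic = (F b - F a)%:E.
Proof.
move=> H ab b0; rewrite /stieltjes_neg /pushforward.
rewrite opp_preimage_itvbndbnd/= stieltjes_pos_itv ?oppr_gt0 ?lerN2//.
  by rewrite !opprK addrC.
exact: cumul_neg_pos.
Qed.

Lemma stieltjes_neg_off F : stieltjes_neg F `[0, +oo[%classic = 0%E.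
Proof.
by rewrite /stieltjes_neg /pushforward opp_preimage_itvbndy oppr0 stieltjes_pos_off.
Qed.

End StieltjesHalfLine.

Section ComplexIntegral.
Local Open Scope complex_scope.
Variable K : realType.

Definition cexp (z : K[i]) : K[i] :=
  (expR (complex.Re z))%:C * (cos (complex.Im z) +i* sin (complex.Im z)).

Definition cintegral d (T : measurableType d) (mu : {measure set T -> \bar K})
    (D : set T) (f : T -> K[i]) : K[i] :=
  (\int[mu]_(y in D) complex.Re (f y)) +i* (\int[mu]_(y in D) complex.Im (f y)).

Definition levy_integrand (x y : K) : K[i] :=
  cexp ('i%C * (x * y)%:C) - 1 - 'i%C * (x * y / (1 + y ^+ 2))%:C.

Definition levy_exponent (sigma : K) (L R : K -> K) (x t : K) : K[i] :=
  - (sigma ^+ 2 * x ^+ 2 * t / 2)%:C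
  + t%:C * (cintegral (stieltjes_neg L) `]-oo, 0[ (levy_integrand x)
            + cintegral (stieltjes_pos R) `]0, +oo[ (levy_integrand x)).

End ComplexIntegral.

Section Processes.
Variables (K : realType) (d : measure_display) (T : measurableType d)
  (P : probability T K).
Local Open Scope ereal_scope.

(* Taking B i = setT recovers the product rule for every subfamily.           *)
Definition mutually_independent n (Y : 'I_n -> T -> K) :=
  forall B : 'I_n -> set K, (forall i, measurable (B i)) ->
    P [set w | forall i, B i (Y i w)] =
    \big[*%E/1]_(i < n) P [set w | B i (Y i w)].

(* The value t i is only relevant for i <= n.                                 *)
Definition independent_increments (D : set K) (Y : K -> T -> K) :=
  forall n (t : nat -> K), (forall i, (i <= n)%N -> D (t i)) ->
    (forall i, (i < n)%N -> (t i <= t i.+1)%R) ->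
    mutually_independent
      (fun (i : 'I_n) (w : T) => (Y (t i.+1) w - Y (t i) w)%R).

Record levy_process (V : K -> T -> K) : Prop := LevyProcess {
  levy_measurable : forall t : K, (0 <= t)%R -> measurable_fun [set: T] (V t) ;
  levy_start : forall w, V 0%R w = 0%R ;
  levy_right_continuous : forall w (t : K), (0 <= t)%R ->
    V u w @[u --> t^'+] --> V t w ;
  levy_left_limits : forall w (t : K), (0 < t)%R -> cvg (V u w @[u --> t^'-]) ;
  levy_independent : independent_increments [set t | 0 <= t]%R V ;
  levy_homogeneous : forall (s h : K) (B : set K), (0 <= s)%R -> (0 <= h)%R -> measurable B ->
    P [set w | B (V (s + h) w - V s w)%R] = P [set w | B (V h w)] ;
  levy_stochastic_continuity : forall t e : K, (0 <= t)%R -> (0 < e)%R ->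
    P [set w | e <= `|V u w - V t w|]%R
      @[u --> within [set u | 0 <= u]%R (nbhs t)] --> 0 }.

(* Since L is left- and R right-continuous, integrals between a and b are     *)
(* over [a, b[ for dL and over ]a, b] for dR.                                 *)
Record levy_measures (L R : K -> K) : Prop := LevyMeasures {
  levy_cumul_neg : cumul_neg L ;
  levy_lim_neg : L y @[y --> -oo%R] --> 0%R ;
  levy_cumul_pos : cumul_pos R ;
  levy_lim_pos : R y @[y --> +oo%R] --> 0%R ;
  levy_integrable : forall e : K, (0 < e)%R ->
    \int[stieltjes_neg L]_(y in `[(- e)%R, 0%R[) (y ^+ 2)%:E
    + \int[stieltjes_pos R]_(y in `]0%R, e]) (y ^+ 2)%:E < +oo }.

(* V = V(sigma, L, R): the linear drift in the exponent is zero.              *)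
Definition levy_process_with (sigma : K) (L R : K -> K) (V : K -> T -> K) :=
  [/\ levy_measures L R, levy_process V &
      forall x t : K, (0 <= t)%R ->
        cintegral P setT (fun w => cexp ('i%C * (x * V t w)%:C%C)%R) =
        cexp (levy_exponent sigma L R x t)].

Record standard_wiener (W : T -> skorohod K) : Prop := StandardWiener {
  wiener_measurable : forall t : K, (0 <= t <= 1)%R ->
    measurable_fun [set: T] (fun w => W w t) ;
  wiener_start : forall w, W w 0%R = 0%R ;
  wiener_continuous : forall w, {within `[0%R, 1%R], continuous (W w)} ;
  wiener_independent :
    independent_increments `[0%R, 1%R] (fun t w => W w t) ;
  wiener_normal : forall (s t : K) (B : set K), (0 <= s)%R -> (s < t)%R -> (t <= 1)%R ->
    measurable B ->
    P [set w | B (W w t - W w s)%R] = normal_prob 0 (Num.sqrt (t - s)) B }.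

End Processes.

(* Weak convergence of the laws: E f(X_n) --> E f(Y) for all bounded          *)
(* continuous f.  In D[0,1] the Borel sets are generated by the coordinates,  *)
(* so processes with measurable coordinates are random elements.              *)
Definition cvg_in_distribution (K : realType) (S : metricType K)
    d (T : measurableType d) (P : probability T K) (X : nat -> T -> S)
    d' (T' : measurableType d') (P' : probability T' K) (Y : T' -> S) :=
  forall f : S -> K, continuous f -> (exists M : K, forall x, `|f x| <= M) ->
    ('E_P[f \o X n] @[n --> \oo] --> 'E_P'[f \o Y])%E.

(* Main.v *)
Require Import Defs.
From mathcomp Require Import all_boot all_order all_algebra complex.
From mathcomp Require Import all_classical all_reals all_analysis.
From mathcomp Require Import measurable_realfun ring lra.

Import Order.TTheory GRing.Theory Num.Theory.
Import numFieldNormedType.Exports.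

Local Open Scope classical_set_scope.
Local Open Scope ring_scope.

(** The limit has continuous paths and every process involved has stationary
    independent increments, so that convergence on the path space can be reduced to
    the one-dimensional laws by hand, without tightness or compactness in the
    Skorohod topology.

    Lipschitz test functions decide convergence in distribution
    ([lipschitz_cvg_in_distribution]).  Let [f] be bounded by [M] and
    [k]-Lipschitz, and cut [0, 1] into [m] blocks.  If no block sees an
    oscillation above [2 e] and the increments over the blocks are rounded down to a
    grid of mesh [eta], then the path is within [2 e + m eta] of a step path, in
    the uniform distance and a fortiori in the Skorohod distance
    ([step_path_close]).  Ottaviani's inequality bounds the probability of an
    oscillation over a block by [2 P(|X(1/m)| > e)] ([block_oscillation]).  Hence the mean of
    [f] differs from a finite sum over grid cells by at most
    [k (2 e + m eta) + 2 M m (2 P(X(1/m) is off ]-e, e]) + P(X(1/m) is off the grid))], and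
    both the sum and the error only involve the probabilities of finitely many
    intervals under the law at time [1/m] ([mean_quantized],
    [mean_quantized_close]).  For fixed [m] these probabilities converge as [n]
    grows; for the Wiener process the error vanishes as [m] grows, because
    [m P(|sigmaW W(1/m)| >= e)] tends to [0].  This is [cvg_in_distribution_stationary].

    The probabilities of intervals are recovered from characteristic functions
    through trapezoids, which lie between indicators of intervals and are mixtures of
    cosines, by the identity [|y| A = \int_0^oo (1 - cos (u y)) / u^2 du]
    ([abs_kernel_integral], [cvg_prob_itv], [tail_le_half]).

    The characteristic function of the rescaled process is obtained by carrying the
    Levy measures to the half-line and rescaling them: [b n] is exactly what turns
    the rescaled compensator into the standard one ([sin_part_drift]), so that the
    exponent of [X n] is that of the triple
    [(sigma^2 s n / a n^2, s n L(a n .), s n R(a n .))].  These measures lose all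
    their mass outside every neighbourhood of [0] while their second moment,
    together with the Gaussian part, tends to [sigmaW^2].  Near [0] the
    integrands are [- u^2 z^2 / 2 + O(z^3)] and [O(z^3)], hence the exponent tends
    to [- sigmaW^2 u^2 / 2] ([exponent_re_cvg], [exponent_im_cvg]). *)

(** * Means of bounded functions, measurable or not *)

Section monotone_integral.
Context {K : realType} {d : measure_display} {T : measurableType d}.
Local Open Scope ereal_scope.
Variable mu : {measure set T -> \bar K}.
Import HBNNSimple.

(** The integral of a non-negative function is a supremum over the simple functions
    below it, so it is monotone on all functions.  Functionals of the paths of [X n]
    are only ever compared, hence their measurability does not have to be settled. *)
Lemma ge0_le_integral_any (f g : T -> \bar K) : (forall x, 0 <= f x) ->
  (forall x, f x <= g x) -> \int[mu]_x f x <= \int[mu]_x g x.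
Proof.
move=> f0 fg; have g0 x : 0 <= g x by exact: le_trans (f0 x) (fg x).
rewrite !ge0_integralTE//; apply: ereal_sup_le => _ [h hf <-].
by exists h => // x; exact: le_trans (hf x) (fg x).
Qed.

Lemma le_integral_any (f g : T -> \bar K) :
  (forall x, f x <= g x) -> \int[mu]_x f x <= \int[mu]_x g x.
Proof.
move=> fg; rewrite integralE [leRHS]integralE leeB//.
  apply: ge0_le_integral_any => x; first exact: funepos_ge0.
  by apply: (@funepos_le _ _ setT) => //; rewrite inE.
apply: ge0_le_integral_any => x; first exact: funeneg_ge0.
by apply: (@funeneg_le _ _ setT) => //; rewrite inE.
Qed.

End monotone_integral.

Section bounded_mean.
Context {K : realType} {d : measure_display} {T : measurableType d}.
Variable P : probability T K.
Implicit Types (f g : T -> K) (M c : K).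

Lemma integral_prob_cst c : (\int[P]_w c%:E)%E = c%:E.
Proof. by rewrite integral_cst//= probability_setT mule1. Qed.

Lemma bounded_integral_fin f M : (forall w, `|f w| <= M) ->
  (\int[P]_w (f w)%:E)%E \is a fin_num.
Proof.
move=> fM; rewrite fin_numElt; apply/andP; split.
  rewrite (@lt_le_trans _ _ (- M)%:E) ?ltNyr// -(integral_prob_cst (- M)).
  by apply: le_integral_any => w; rewrite lee_fin; have := fM w; rewrite ler_norml => /andP[].
rewrite (@le_lt_trans _ _ M%:E) ?ltry// -(integral_prob_cst M).
by apply: le_integral_any => w; rewrite lee_fin; have := fM w; rewrite ler_norml => /andP[].
Qed.

Lemma le_mean_bounded f g M N : (forall w, `|f w| <= M) -> (forall w, `|g w| <= N) ->
  (forall w, f w <= g w) -> \int[P]_w f w <= \int[P]_w g w.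
Proof.
move=> fM gN fg; rewrite /Rintegral fine_le//.
- exact: bounded_integral_fin fM.
- exact: bounded_integral_fin gN.
- by apply: le_integral_any => w; rewrite lee_fin.
Qed.

Lemma bounded_integrable f M : measurable_fun setT f -> (forall w, `|f w| <= M) ->
  P.-integrable setT (EFin \o f).
Proof.
move=> mf fM; apply: measurable_bounded_integrable => //.
  by rewrite (le_lt_trans (probability_le1 P measurableT))// ltry.
exists M; split; first exact: num_real.
by move=> x Mx w _ /=; rewrite (le_trans (fM w))// ltW.
Qed.

Lemma mean_cst c : \int[P]_w c = c.
Proof. by rewrite /Rintegral integral_prob_cst. Qed.

Lemma mean_indic (A : set T) : measurable A -> \int[P]_w \1_A w = fine (P A).
Proof. by move=> mA; rewrite /Rintegral integral_indic// setIT. Qed.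

Lemma integrable_indic_prob (A : set T) : measurable A ->
  P.-integrable setT (EFin \o (\1_A : T -> K)).
Proof.
move=> mA; apply: (@bounded_integrable _ 1); first exact: measurable_indic.
by move=> w; rewrite indicE; case: (_ \in _); rewrite ?normr1 ?normr0// ler01.
Qed.

Lemma indic_le1 (A : set T) w : `|\1_A w : K| <= 1.
Proof. by rewrite indicE; case: (_ \in _); rewrite ?normr1 ?normr0// ler01. Qed.

(** An arbitrary functional [f] of the paths is compared here with a measurable
    function [g] of finitely many increments, away from an exceptional event [B]. *)
Lemma mean_close f g M N (B : set T) c D : measurable_fun setT g -> measurable B ->
  (forall w, `|f w| <= M) -> (forall w, `|g w| <= N) -> 0 <= c -> 0 <= D ->
  (forall w, `|f w - g w| <= c + D * \1_B w) ->
  `|\int[P]_w f w - \int[P]_w g w| <= c + D * fine (P B).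
Proof.
move=> mg mB fM gN c0 D0 h.
have i1 : P.-integrable setT (EFin \o g) by exact: bounded_integrable gN.
have iB : P.-integrable setT (EFin \o (\1_B : T -> K)) by exact: integrable_indic_prob.
pose e w := c + D * \1_B w.
have eb w : `|e w| <= c + D.
  rewrite /e ger0_norm ?addr_ge0 ?mulr_ge0 ?lerD2l//.
  by rewrite ler_piMr// (le_trans (ler_norm _))// indic_le1.
have ie : P.-integrable setT (EFin \o e).
  apply: bounded_integrable eb; apply: measurable_funD; first exact: measurable_cst.
  by apply: measurable_funM; [exact: measurable_cst|exact: measurable_indic].
have Ie : \int[P]_w e w = c + D * fine (P B).
  rewrite RintegralD//; last 2 first.
  - by apply: (@bounded_integrable _ `|c|) => //; exact: measurable_cst.
  - apply: (@bounded_integrable _ D).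
      by apply: measurable_funM; [exact: measurable_cst|exact: measurable_indic].
    by move=> w; rewrite normrM (ger0_norm D0) ler_piMr// indic_le1.
  by rewrite mean_cst RintegralZl// mean_indic.
rewrite ler_distl -Ie; apply/andP; split.
  rewrite -RintegralB//; apply: (@le_mean_bounded _ _ (N + (c + D)) M) => // w.
    by rewrite (le_trans (ler_normB _ _))// lerD.
  by have := h w; rewrite ler_distl => /andP[].
rewrite -RintegralD//; apply: (@le_mean_bounded _ _ M (N + (c + D))) => // w.
  by rewrite (le_trans (ler_normD _ _))// lerD.
by have := h w; rewrite ler_distl => /andP[].
Qed.

End bounded_mean.

Section dominated.
Context {K : realType} {d : measure_display} {T : measurableType d}.

Lemma Rintegral_dominated_cvg (mu : {measure set T -> \bar K}) (D : set T)
    (f_ : nat -> T -> K) (f g : T -> K) : measurable D ->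
  (forall n, measurable_fun D (f_ n)) -> measurable_fun D f ->
  mu.-integrable D (EFin \o g) ->
  (forall x, D x -> f_ n x @[n --> \oo] --> f x) ->
  (forall n x, D x -> `|f_ n x| <= g x) ->
  \int[mu]_(x in D) f_ n x @[n --> \oo] --> \int[mu]_(x in D) f x.
Proof.
move=> mD mf_ mf ig cf fg.
have [|||||i _ c] := @dominated_convergence _ T K mu D mD (fun n x => (f_ n x)%:E)
  (EFin \o f) (EFin \o g).
- by move=> n; exact/measurable_EFinP.
- exact/measurable_EFinP.
- by apply: aeW => x Dx; apply: cvg_EFin; [exact: nearW|exact: cf].
- exact: ig.
- by apply: aeW => x n Dx; rewrite /= lee_fin fg.
apply: fine_cvg; rewrite fineK//.
exact: integrable_fin_num.
Qed.

End dominated.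

(** * Lipschitz test functions decide convergence in distribution *)

Section lipschitz_reduction.
Context {K : realType} {S : metricType K}.
Context {d : measure_display} {T : measurableType d} (P : probability T K).
Context {d' : measure_display} {T' : measurableType d'} (P' : probability T' K).
Variables (X : nat -> T -> S) (Y : T' -> S).

Definition lipschitz_for (f : S -> K) (k : K) := forall x y, `|f x - f y| <= k * mdist x y.

(** The Moreau-Yosida envelope: the largest [k]-Lipschitz function below [f]. *)
Definition inf_conv (f : S -> K) (k : K) (x : S) : K :=
  inf [set f y + k * mdist x y | y in [set: S]].

Lemma inf_conv_lb (f : S -> K) M k x : (forall x, `|f x| <= M) -> 0 <= k ->
  has_inf [set f y + k * mdist x y | y in [set: S]].
Proof.
move=> fM k0; split; first by exists (f x + k * mdist x x); exists x.
exists (- M) => _ [y _ <-]; rewrite -[leLHS]addr0 lerD ?mulr_ge0 ?mdist_ge0//.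
by have := fM y; rewrite ler_norml => /andP[].
Qed.

Lemma inf_conv_le (f : S -> K) M k x : (forall x, `|f x| <= M) -> 0 <= k ->
  inf_conv f k x <= f x.
Proof.
move=> fM k0; apply: ge_inf; first by have [] := inf_conv_lb f M k x fM k0.
by exists x => //; rewrite mdistxx mulr0 addr0.
Qed.

Lemma inf_conv_ge (f : S -> K) M k x : (forall x, `|f x| <= M) -> 0 <= k ->
  - M <= inf_conv f k x.
Proof.
move=> fM k0; apply: lb_le_inf; first by have [] := inf_conv_lb f M k x fM k0.
move=> _ [y _ <-]; rewrite -[leLHS]addr0 lerD ?mulr_ge0 ?mdist_ge0//.
by have := fM y; rewrite ler_norml => /andP[].
Qed.

Lemma inf_conv_bounded (f : S -> K) M k x : (forall x, `|f x| <= M) -> 0 <= k ->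
  `|inf_conv f k x| <= M.
Proof.
move=> fM k0; rewrite ler_norml (inf_conv_ge _ _ _ _ fM)//=.
rewrite (le_trans (inf_conv_le _ _ _ _ fM _))//.
by have := fM x; rewrite ler_norml => /andP[].
Qed.

Lemma inf_conv_lipschitz (f : S -> K) M k : (forall x, `|f x| <= M) -> 0 <= k ->
  lipschitz_for (inf_conv f k) k.
Proof.
move=> fM k0.
have h x y : inf_conv f k x - inf_conv f k y <= k * mdist x y.
  rewrite lerBlDr addrC -lerBlDr; apply: lb_le_inf; first by have [] := inf_conv_lb f M k y fM k0.
  move=> _ [z _ <-]; rewrite lerBlDr.
  apply: (@le_trans _ _ (f z + k * mdist x z)).
    by apply: ge_inf; [have [] := inf_conv_lb f M k x fM k0|exists z].
  by rewrite -addrA lerD2l -mulrDr ler_wpM2l// addrC metric_triangle.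
move=> x y; rewrite ler_norml h andbT lerNl opprB.
by rewrite metric_sym h.
Qed.

(** Moving from [x] to a point at distance at least [r] costs [k r], which exceeds
    the oscillation [2 M] of [f] for large [k]; nearer points are dealt with by the
    continuity of [f] at [x]. *)
Lemma inf_conv_cvg (f : S -> K) M x : (forall x, `|f x| <= M) -> continuous f ->
  inf_conv f n%:R x @[n --> \oo] --> f x.
Proof.
move=> fM cf; apply/cvgrPdist_le => e e0.
have /cvgrPdist_le/(_ _ e0)/nbhs_ballP[r /= r0 H] := cf x.
have M0 : 0 <= M by exact: le_trans (fM x).
near=> n.
have n0 : 0 <= n%:R :> K by exact: ler0n.
rewrite ger0_norm ?subr_ge0 ?(inf_conv_le _ _ _ _ fM)// lerBlDr addrC -lerBlDr.
apply: lb_le_inf; first by have [] := inf_conv_lb f M n%:R x fM n0.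
move=> _ [y _ <-].
have [xy|xy] := ltP (mdist x y) r.
  have : `|f x - f y| <= e by apply: H; rewrite ballEmdist.
  rewrite ler_distl lerBlDr => /andP[_ h].
  rewrite lerBlDr (le_trans h)// addrAC lerDl mulr_ge0// mdist_ge0//.
have /andP[fx _] : - M <= f y <= M by rewrite -ler_norml.
have /andP[_ fx'] : - M <= f x <= M by rewrite -ler_norml.
rewrite (@le_trans _ _ (- M + n%:R * r))//; last first.
  by rewrite lerD// ler_wpM2l.
rewrite (@le_trans _ _ M)//.
  by rewrite lerBlDr (le_trans fx')// lerDl ltW.
rewrite -lerBlDl opprK -ler_pdivrMr//; near: n.
by apply: nbhs_infty_ger; exact: num_real.
Unshelve. all: end_near. Qed.

Hypothesis measurable_target : forall (f : S -> K) M k, 0 <= k -> (forall x, `|f x| <= M) ->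
  lipschitz_for f k -> measurable_fun setT (f \o Y).

Hypothesis lipschitz_cvg : forall (f : S -> K) M k, 0 <= k -> (forall x, `|f x| <= M) ->
  lipschitz_for f k -> \int[P]_w f (X n w) @[n --> \oo] --> \int[P']_w f (Y w).

(** The envelopes increase to [f], so the mean of one of them under the limit is
    almost that of [f]; its means converge, and it stays below [f]. *)
Let liminf_mean (f : S -> K) M e : continuous f -> (forall x, `|f x| <= M) -> 0 < e ->
  \forall n \near \oo, \int[P']_w f (Y w) - e <= \int[P]_w f (X n w).
Proof.
move=> cf fM e0; have e20 : 0 < e / 2 by rewrite divr_gt0.
have mk k : measurable_fun setT (inf_conv f k%:R \o Y).
  by apply: (measurable_target _ M k%:R) => // [x|]; [exact: inf_conv_bounded|exact: inf_conv_lipschitz fM _].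
have ck w : inf_conv f k%:R (Y w) @[k --> \oo] --> f (Y w) by exact: inf_conv_cvg fM cf.
have : \int[P']_w inf_conv f k%:R (Y w) @[k --> \oo] --> \int[P']_w f (Y w).
  apply: (@Rintegral_dominated_cvg _ _ _ _ _ _ _ (cst M)) => //.
  - apply: (measurable_fun_cvg mk) => w _; exact: ck.
  - by apply: (@bounded_integrable _ _ _ _ _ `|M|) => //; exact: measurable_cst.
  - by move=> n w _; exact: inf_conv_bounded.
move/cvgrPdist_le/(_ _ e20) => [k _ /(_ k (leqnn k)) /= hk].
have /cvgrPdist_le/(_ _ e20) := lipschitz_cvg (inf_conv f k%:R) M k%:R (ler0n _ _)
  (fun x => inf_conv_bounded _ _ _ _ fM (ler0n _ _)) (inf_conv_lipschitz _ _ _ fM (ler0n _ _)).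
apply: filterS => n hn.
have : \int[P]_w inf_conv f k%:R (X n w) <= \int[P]_w f (X n w).
  apply: (@le_mean_bounded _ _ _ _ _ _ M M) => // w; first exact: inf_conv_bounded.
  exact: inf_conv_le fM _.
apply: le_trans.
move: hn hk; rewrite !ler_distl => /andP[_ h1] /andP[_ h2].
lra.
Qed.

(** The lower bound is applied to [f] and to [- f]. *)
Lemma lipschitz_cvg_in_distribution : cvg_in_distribution P X P' Y.
Proof.
move=> f cf [M fM].
have E1 n : ('E_P[f \o X n] = (\int[P]_w f (X n w))%:E)%E.
  by rewrite unlock fineK//; exact: bounded_integral_fin (fun w => fM _).
have E2 : ('E_P'[f \o Y] = (\int[P']_w f (Y w))%:E)%E.
  by rewrite unlock fineK//; exact: bounded_integral_fin (fun w => fM _).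
rewrite E2; under eq_fun do rewrite E1.
apply: cvg_EFin; first exact: nearW.
apply/cvgrPdist_le => e e0.
have cN : continuous (fun x => - f x) by move=> x; apply: cvgN; exact: cf.
have NM x : `|- f x| <= M by rewrite normrN.
have /= := liminf_mean _ _ _ cN NM e0; have := liminf_mean _ _ _ cf fM e0.
(* a bounded function may fail to be measurable here, and linearity of the
   integral then has to come from its positive and negative parts *)
have RN d1 (T1 : measurableType d1) (P1 : probability T1 K) (g : T1 -> K) :
    (forall w, `|g w| <= M) -> \int[P1]_w (- g w) = - \int[P1]_w g w.
  move=> gM; rewrite /Rintegral -fineN.
  under eq_integral do rewrite EFinN.
  rewrite integralN ?fineN// fin_num_adde_defr//.
  have g_le w : (0 <= ((EFin \o g)^\+)%E w <= M%:E)%E.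
    rewrite funepos_ge0/= funeposE/= -EFin_max lee_fin ge_max.
    by rewrite (le_trans (ler_norm _) (gM w)) (le_trans _ (gM w)).
  rewrite ge0_fin_numE; last by apply: integral_ge0 => w _; case/andP: (g_le w).
  rewrite (@le_lt_trans _ _ M%:E) ?ltry// -(integral_prob_cst P1 M).
  by apply: ge0_le_integral_any => w; case/andP: (g_le w).
apply: filterS2 => n h1; rewrite !RN// => h2.
rewrite ler_distl; apply/andP; split; lra.
Qed.

End lipschitz_reduction.

(** * Elementary trigonometric bounds *)

Section trigonometric_bounds.
Context {K : realType}.
Implicit Types x y : K.

(** Applied in turn to [sin], [1 - cos], [x - sin x] and [cos x - 1 + x^2 / 2], each
    bound feeding the next. *)
Lemma MVT_bound (F f : K -> K) x B : (forall y, is_derive y (1 : K) F (f y)) ->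
  F 0 = 0 -> (forall y, `|y| <= `|x| -> `|f y| <= B) -> `|F x| <= B * `|x|.
Proof.
move=> dF F0 fB.
have cF : continuous F.
  move=> y; apply: differentiable_continuous; apply/derivable1_diffP.
  by have [] := dF y.
have [x0|x0|->] := ltgtP x 0; last by rewrite F0 !normr0 mulr0.
- have [|c] := @MVT K F f x 0 x0 (fun y _ => dF y); first exact: continuous_subspaceT.
  rewrite in_itv/= => /andP[xc c0]; rewrite F0 !sub0r => E.
  rewrite -normrN E normrM normrN ler_wpM2r// fB//.
  by rewrite (ltr0_norm c0) (ltr0_norm x0) lerN2 ltW.
- have [|c] := @MVT K F f 0 x x0 (fun y _ => dF y); first exact: continuous_subspaceT.
  rewrite in_itv/= => /andP[c0 cx]; rewrite F0 !subr0 => ->.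
  rewrite normrM ler_wpM2r// fB//.
  by rewrite !ger0_norm ?ltW.
Qed.

Lemma norm_sin_le x : `|sin x| <= `|x|.
Proof.
rewrite -[leRHS]mul1r; apply: (@MVT_bound sin cos); rewrite ?sin0// => y _.
exact: cos_max.
Qed.

Lemma measurable_cos : measurable_fun setT (@cos K).
Proof. by apply: continuous_measurable_fun; exact: continuous_cos. Qed.

Lemma measurable_sin : measurable_fun setT (@sin K).
Proof. by apply: continuous_measurable_fun; exact: continuous_sin. Qed.

Lemma is_derive_1Bcos y : is_derive y (1 : K) (fun u => 1 - cos u) (sin y).
Proof.
rewrite (_ : (fun u => _) = cst 1 - (@cos K)); last by apply/funext.
by apply: is_derive_eq; rewrite sub0r opprK.
Qed.

Lemma norm_1Bcos_le x : `|1 - cos x| <= `|x|.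
Proof.
rewrite -[leRHS]mul1r; apply: (@MVT_bound (fun u => 1 - cos u) sin).
- exact: is_derive_1Bcos.
- by rewrite cos0 subrr.
- by move=> y _; exact: sin_max.
Qed.

Lemma norm_1Bcos_le2 x : `|1 - cos x| <= x ^+ 2.
Proof.
rewrite -normr_id -real_normK ?num_real// expr2 normr_id.
apply: (@MVT_bound (fun u => 1 - cos u) sin).
- exact: is_derive_1Bcos.
- by rewrite cos0 subrr.
- by move=> y yx; exact: le_trans (norm_sin_le y) yx.
Qed.

Lemma norm_sinB_le x : `|x - sin x| <= `|x| ^+ 3.
Proof.
rewrite exprSr; apply: (@MVT_bound (fun u => u - sin u) (fun u => 1 - cos u)).
- by rewrite sin0 subr0.
- by move=> y yx; rewrite (le_trans (norm_1Bcos_le2 y))// -[leLHS]real_normK ?num_real// lerXn2r ?nnegrE.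
Qed.

Lemma norm_cos_taylor_le x : `|cos x - 1 + x ^+ 2 / 2| <= x ^+ 4.
Proof.
rewrite (_ : x ^+ 4 = `|x| ^+ 4); last by rewrite -normrX ger0_norm// exprn_even_ge0.
rewrite [leRHS]exprSr; apply: (@MVT_bound (fun u => cos u - 1 + u ^+ 2 / 2) (fun u => u - sin u)).
- move=> y; rewrite (_ : (fun u => cos u - 1 + u ^+ 2 / 2) =
      (@cos K) - cst 1 + 2^-1 \*: (fun u : K => u ^+ 2)); last first.
    by apply/funext => u; rewrite !fctE /GRing.scale/= mulrC.
  by apply: is_derive_eq; rewrite subr0 /GRing.scale/= mulr1; field.
- by rewrite cos0 subrr expr0n/= mul0r addr0.
- by move=> y yx; rewrite (le_trans (norm_sinB_le y))// lerXn2r ?nnegrE.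
Qed.

End trigonometric_bounds.

(** * Images of measures *)

Section scaled_image.
Context {K : realType} {d1 d2 : measure_display} {X : measurableType d1} {Y : measurableType d2}.
Variables (mu : {measure set X -> \bar K}) (phi : X -> Y) (k : {nonneg K}).

(** The Levy measure of the rescaled process is [s] times the image of the original
    one under [y |-> y / a]; with [k = 1] this is the law of a random variable. *)
Definition scaled_image (mphi : measurable_fun [set: X] phi) : {measure set Y -> \bar K}.
Proof. unshelve refine (mscale k (pushforward mu phi) : {measure set Y -> \bar K}). exact: mphi. Defined.

Hypothesis mphi : measurable_fun [set: X] phi.

Lemma scaled_imageE A : scaled_image mphi A = (k%:num%:E * mu (phi @^-1` A))%E.
Proof. by []. Qed.

Lemma ge0_integral_scaled_image (D : set Y) (f : Y -> \bar K) : measurable D ->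
  measurable_fun D f -> (forall y, D y -> (0 <= f y)%E) ->
  (\int[scaled_image mphi]_(y in D) f y =
   k%:num%:E * \int[mu]_(x in phi @^-1` D) f (phi x))%E.
Proof.
move=> mD mf f0.
rewrite -(@ge0_integral_pushforward _ _ _ _ K phi mphi mu D f) //; last first.
  by move=> y /[1!inE]; exact: f0.
by rewrite /scaled_image ge0_integral_mscale.
Qed.

Lemma Rintegral_scaled_image (D : set Y) (f : Y -> K) : measurable D ->
  measurable_fun D f -> mu.-integrable (phi @^-1` D) (EFin \o f \o phi) ->
  \int[scaled_image mphi]_(y in D) f y =
    k%:num * \int[mu]_(x in phi @^-1` D) f (phi x).
Proof.
move=> mD mf intf; have mE : measurable_fun D (EFin \o f) by exact/measurable_EFinP.
have mpD : measurable (phi @^-1` D) by rewrite -[X in measurable X]setTI; exact: mphi.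
rewrite /Rintegral integralE !ge0_integral_scaled_image//; last 2 first.
- exact: measurable_funeneg.
- exact: measurable_funepos.
rewrite -muleBr//; last first.
  rewrite fin_num_adde_defl// fin_numN.
  rewrite (eq_integral ((EFin \o f \o phi)^\-)%E); last by move=> x _; rewrite !funenegE.
  exact: integrable_neg_fin_num.
have E : (\int[mu]_(x in phi @^-1` D) (EFin \o f)^\+ (phi x) -
    \int[mu]_(x in phi @^-1` D) (EFin \o f)^\- (phi x) =
    \int[mu]_(x in phi @^-1` D) (f (phi x))%:E)%E.
  rewrite [RHS]integralE; congr (_ - _)%E;
  by apply: eq_integral => x _; rewrite ?funeposE ?funenegE.
by rewrite E fineM//; exact: (integrable_fin_num mpD intf).
Qed.

Lemma integrable_scaled_image (D : set Y) (f : Y -> K) : measurable D ->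
  measurable_fun D f -> mu.-integrable (phi @^-1` D) (EFin \o f \o phi) ->
  (scaled_image mphi).-integrable D (EFin \o f).
Proof.
move=> mD mf /integrableP[_ intf]; apply/integrableP; split; first exact/measurable_EFinP.
rewrite ge0_integral_scaled_image//; last exact/measurable_EFinP/measurableT_comp.
by rewrite lte_mul_pinfty.
Qed.

End scaled_image.

Section dilation.
Context {K : realType}.
Notation mu := (@lebesgue_measure K).
Notation D := (`]0, +oo[%classic : set K).

Let mmul (x : K) : measurable_fun [set: measurableTypeR K] (( *%R^~ x) : measurableTypeR K -> measurableTypeR K).
Proof. exact: mulrr_measurable. Qed.

Lemma lebesgue_measure_dilation (x : K) (x0 : 0 < x) (A : set K) : measurable A ->
  mu A = scaled_image mu _ (NngNum (ltW x0)) (mmul x) A.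
Proof.
move=> mA; apply: lebesgue_measure_unique => //= _ [[a b]] _ <-.
rewrite scaled_imageE/=.
rewrite (_ : _ @^-1` _ = `]a / x, b / x]%classic); last first.
  by apply/seteqP; split=> u /=; rewrite !in_itv/= ltr_pdivrMr// ler_pdivlMr.
rewrite !lebesgue_measure_itv/= !lte_fin ltr_pM2r ?invr_gt0//; case: ifPn => _.
  by rewrite -!EFinD -EFinM; congr EFin; field; rewrite gt_eqF.
by rewrite mule0.
Qed.

Lemma Rintegral_dilation (G : K -> K) (x : K) : 0 < x -> measurable_fun D G ->
  mu.-integrable D (EFin \o (fun u => G (u * x))) ->
  \int[mu]_(v in D) G v = x * \int[mu]_(u in D) G (u * x).
Proof.
move=> x0 mG iG.
have E : ( *%R^~ x) @^-1` D = D.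
  by apply/seteqP; split=> u /=; rewrite !in_itv/= !andbT pmulr_lgt0.
rewrite {1}/Rintegral (eq_measure_integral (scaled_image mu _ (NngNum (ltW x0)) (mmul x))).
  rewrite -/(Rintegral _ _ _) Rintegral_scaled_image/= ?E//.
by move=> A mA _; exact: lebesgue_measure_dilation.
Qed.

End dilation.

(** * The absolute value as a mixture of cosines *)

Section absolute_value_fourier.
Context {K : realType}.
Notation mu := (@lebesgue_measure K).
Notation D := (`]0, +oo[%classic : set K).

Let mD : measurable (D : set (measurableTypeR K)). Proof. exact: measurable_itv. Qed.

Lemma oneDsq_gt0 (u : K) : 0 < 1 + u ^+ 2.
Proof. by rewrite ltr_pwDl// sqr_ge0. Qed.

Lemma integrable_oneDsqV : mu.-integrable D (EFin \o (fun u => (1 + u ^+ 2)^-1)).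
Proof.
have h : mu.-integrable `[0, +oo[%classic (EFin \o (fun u : K => (1 + u ^+ 2)^-1)).
  apply/integrableP; split.
    apply/measurable_EFinP; apply: measurable_funTS; apply: continuous_measurable_fun.
    exact: continuous_oneDsqrV.
  under eq_integral do rewrite /= ger0_norm ?invr_ge0 ?(ltW (oneDsq_gt0 _))//.
  by rewrite integral0y_oneDsqr ltry.
apply: integrableS h => // u /=; rewrite !in_itv/= !andbT; exact: ltW.
Qed.

Lemma integrable_kernel (f : K -> K) (C : K) : measurable_fun D f ->
  (forall u : K, 0 < u -> `|f u| <= C / (1 + u ^+ 2)) -> mu.-integrable D (EFin \o f).
Proof.
move=> mf fC; apply: (@le_integrable _ _ _ mu D mD _ (EFin \o (fun u => C * (1 + u ^+ 2)^-1))) => //.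
- exact/measurable_EFinP.
- move=> u; rewrite /= in_itv/= andbT => u0; rewrite lee_fin (le_trans (fC u u0))//.
  exact: ler_norm.
- exact: (integrableZl mD C integrable_oneDsqV).
Qed.

Lemma measurable_sqV : measurable_fun D (fun u : K => (u ^+ 2)^-1).
Proof.
apply: open_continuous_measurable_fun; first exact: interval_open.
move=> u /[!inE]/=; rewrite in_itv/= andbT => u0.
apply: cvgV; first by rewrite expf_neq0// gt_eqF.
exact: exprn_continuous.
Qed.

(** A numerator that is [O(u^2)] at [0] and bounded at infinity makes the quotient by
    [u^2] integrable on the half-line. *)
Lemma ler_kernel (f : K -> K) (A B u : K) : 0 < u -> `|f u| <= A * u ^+ 2 -> `|f u| <= B ->
  `|f u / u ^+ 2| <= (A + B) / (1 + u ^+ 2).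
Proof.
move=> u0 fA fB; have u2 : 0 < u ^+ 2 by rewrite exprn_gt0.
rewrite normrM normfV (ger0_norm (ltW u2)) ler_pdivlMr ?oneDsq_gt0// mulrDr mulr1.
by rewrite lerD ?ler_pdivrMr// divfK ?gt_eqF.
Qed.

Definition abs_kernel (y u : K) := (1 - cos (u * y)) / u ^+ 2.

Lemma measurable_cosM (y : K) (E : set K) : measurable_fun E (fun u => cos (u * y)).
Proof.
apply: measurable_funTS; apply: measurableT_comp; first exact: measurable_cos.
exact: mulrr_measurable.
Qed.

Lemma measurable_abs_kernel (y : K) : measurable_fun D (abs_kernel y).
Proof.
apply: measurable_funM; last exact: measurable_sqV.
by apply: measurable_funB => //; exact: measurable_cosM.
Qed.

Lemma abs_kernel_bound (y u : K) : 0 < u -> `|abs_kernel y u| <= (y ^+ 2 + 2) / (1 + u ^+ 2).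
Proof.
move=> u0; apply: (@ler_kernel (fun u => 1 - cos (u * y))) => //.
  by rewrite -exprMn mulrC norm_1Bcos_le2.
by rewrite (le_trans (ler_normB _ _))// normr1 lerD2l cos_max.
Qed.

Lemma integrable_abs_kernel (y : K) : mu.-integrable D (EFin \o abs_kernel y).
Proof. by apply: integrable_kernel (abs_kernel_bound y); exact: measurable_abs_kernel. Qed.

Definition abs_const : K := \int[mu]_(u in D) abs_kernel 1 u.

Lemma abs_kernel_ge0 (y u : K) : 0 <= abs_kernel y u.
Proof. by rewrite divr_ge0 ?sqr_ge0// subr_ge0 cos_le1. Qed.

(** The kernel is at least [1/4] on ]0, 1/2], by the Taylor bound for [cos]. *)
Lemma abs_const_gt0 : 0 < abs_const.
Proof.
pose E : set K := `]0, 2^-1]%classic.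
have ED : E `<=` D by move=> u /=; rewrite !in_itv/= andbT => /andP[].
have mE : measurable (E : set (measurableTypeR K)) by exact: measurable_itv.
have iE := integrableS mD mE ED (integrable_abs_kernel 1).
have le1 : \int[mu]_(u in E) abs_kernel 1 u <= abs_const.
  rewrite Rintegral_mkcond /abs_const [leRHS]Rintegral_mkcond; apply: le_Rintegral => //.
  - rewrite -restrict_EFin; exact/(integrable_mkcond _ mE).
  - rewrite -restrict_EFin; exact/(integrable_mkcond _ mD)/integrable_abs_kernel.
  - move=> u _; rewrite /patch; case: ifPn => uE; case: ifPn => // uD.
      by move: uD uE; rewrite notin_setE inE => nD /ED.
    exact: abs_kernel_ge0.
apply: lt_le_trans le1.
have /(@lt_le_trans _ _ _) : 0 < \int[mu]_(u in E) (4^-1 : K).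
  rewrite Rintegral_cst//= lebesgue_measure_itv/= lte_fin invr_gt0 ltr0n/= oppr0 addr0.
  by rewrite mulr_gt0 ?invr_gt0.
apply; apply: le_Rintegral => //.
  apply/integrableP; split; first exact/measurable_EFinP.
  rewrite integral_cst//= lebesgue_measure_itv/= lte_fin invr_gt0 ltr0n/= oppr0 addr0.
  by rewrite -EFinM ltry.
move=> u; rewrite /E/= in_itv/= => /andP[u0 u12].
have u2 : 0 < u ^+ 2 by rewrite exprn_gt0.
rewrite /abs_kernel mulr1 ler_pdivlMr//.
have := norm_cos_taylor_le u; rewrite ler_norml => /andP[_ h].
have u4 : u ^+ 4 <= u ^+ 2 / 4.
  rewrite (_ : u ^+ 4 = u ^+ 2 * u ^+ 2) ?ler_pM2l//; last by rewrite -exprD.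
  have -> : 4^-1 = 2^-1 ^+ 2 :> K by field.
  by rewrite lerXn2r ?nnegrE ?invr_ge0// ltW.
lra.
Qed.

(** The integral is even in [y], and homogeneous of degree one by the substitution
    [u |y|]. *)
Lemma abs_kernel_integral (y : K) : \int[mu]_(u in D) abs_kernel y u = `|y| * abs_const.
Proof.
have [->|y0] := eqVneq y 0.
  rewrite normr0 mul0r; under eq_Rintegral do rewrite /abs_kernel mulr0 cos0 subrr mul0r.
  by rewrite Rintegral_cst// mul0r.
have ny : 0 < `|y| by rewrite normr_gt0.
have E u : abs_kernel y u = `|y| ^+ 2 * abs_kernel 1 (u * `|y|).
  rewrite /abs_kernel mulr1 -(cos_norm (u * y)) -(cos_norm (u * `|y|)) !normrM normr_id.
  rewrite exprMn (invfM (u ^+ 2)) [RHS]mulrCA; congr (_ * _).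
  by rewrite mulrCA mulfV ?mulr1// expf_neq0// gt_eqF.
have i1 : mu.-integrable D (EFin \o (fun u => abs_kernel 1 (u * `|y|))).
  have : mu.-integrable D (EFin \o (fun u => `|y| ^- 2 * abs_kernel y u)).
    exact: (integrableZl mD (`|y| ^- 2) (integrable_abs_kernel y)).
  apply: eq_integrable => // u _ /=; rewrite E mulrA mulVf ?mul1r//.
  by rewrite expf_neq0// gt_eqF.
rewrite /abs_const (Rintegral_dilation (abs_kernel 1) _ ny)//; last exact: measurable_abs_kernel.
rewrite mulrA -expr2 -RintegralZl//.
by under eq_Rintegral do rewrite E.
Qed.

End absolute_value_fourier.

(** * Trapezoids *)

Section trapezoid.
Context {K : realType}.
Notation mu := (@lebesgue_measure K).
Notation D := (`]0, +oo[%classic : set K).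
Implicit Types (r R y u c : K).

Let mD : measurable (D : set (measurableTypeR K)). Proof. exact: measurable_itv. Qed.

(** The piecewise linear function that is [1] on [-r, r] and [0] off [-R, R]: with
    absolute values as building blocks it inherits their representation by cosines. *)
Definition trapezoid r R y : K :=
  (`|y + R| + `|y - R| - `|y + r| - `|y - r|) / (2 * (R - r)).

Lemma trapezoid_top r R y : 0 <= r -> r < R -> `|y| <= r -> trapezoid r R y = 1.
Proof.
move=> r0 rR; rewrite ler_norml => /andP[h1 h2].
have d0 : 0 < 2 * (R - r) by lra.
rewrite /trapezoid (ger0_norm (x := y + R)); last lra.
rewrite (ler0_norm (x := y - R)); last lra.
rewrite (ger0_norm (x := y + r)); last lra.
rewrite (ler0_norm (x := y - r)); last lra.
have n0 : 2 * (R - r) != 0 by rewrite gt_eqF.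
by apply: (mulIf n0); rewrite divfK// mul1r; lra.
Qed.

Lemma trapezoid_out r R y : 0 <= r -> r < R -> R <= `|y| -> trapezoid r R y = 0.
Proof.
move=> r0 rR; rewrite ler_normr /trapezoid => /orP[h|h].
  rewrite !ger0_norm; [|lra..].
  rewrite (_ : _ - _ = 0) ?mul0r//; lra.
rewrite !ler0_norm; [|lra..].
rewrite (_ : _ - _ = 0) ?mul0r//; lra.
Qed.

Lemma trapezoid01 r R y : 0 <= r -> r < R -> 0 <= trapezoid r R y <= 1.
Proof.
move=> r0 rR; have d0 : 0 < 2 * (R - r) by lra.
rewrite /trapezoid ler_pdivrMr// ler_pdivlMr//.
by have [?|?] := ler0P (y + R); have [?|?] := ler0P (y - R);
  have [?|?] := ler0P (y + r); have [?|?] := ler0P (y - r); apply/andP; split; lra.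
Qed.

Lemma trapezoid_le1 r R y : 0 <= r -> r < R -> `|trapezoid r R y| <= 1.
Proof. by move=> r0 rR; have /andP[h1 h2] := trapezoid01 r R y r0 rR; rewrite ger0_norm. Qed.

Definition trap_kernel r R u : K := (cos (u * r) - cos (u * R)) / u ^+ 2.

Lemma measurable_trap_kernel r R : measurable_fun D (trap_kernel r R).
Proof.
apply: measurable_funM; last exact: measurable_sqV.
by apply: measurable_funB; exact: measurable_cosM.
Qed.

Definition trap_bound r R u : K := (r ^+ 2 + R ^+ 2 + 2) / (1 + u ^+ 2).

Lemma trap_kernel_bound r R u : 0 < u -> `|trap_kernel r R u| <= trap_bound r R u.
Proof.
move=> u0; apply: (@ler_kernel _ (fun u => cos (u * r) - cos (u * R))) => //.
  rewrite (_ : _ - _ = (1 - cos (u * R)) - (1 - cos (u * r))); last by ring.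
  rewrite (le_trans (ler_normB _ _))// addrC mulrDl lerD//.
    by rewrite -exprMn mulrC norm_1Bcos_le2.
  by rewrite -exprMn mulrC norm_1Bcos_le2.
by rewrite (le_trans (ler_normB _ _))// lerD// cos_max.
Qed.

Lemma trap_bound_ge0 r R u : 0 <= trap_bound r R u.
Proof. by rewrite divr_ge0 ?(ltW (oneDsq_gt0 _))// !addr_ge0 ?sqr_ge0. Qed.

Lemma integrable_trap_bound r R : mu.-integrable D (EFin \o trap_bound r R).
Proof. exact: (integrableZl mD _ integrable_oneDsqV). Qed.

Definition trap_const r R : K := ((R - r) * abs_const)^-1.

Lemma trap_const_gt0 r R : r < R -> 0 < trap_const r R.
Proof. by move=> rR; rewrite invr_gt0 mulr_gt0 ?subr_gt0// abs_const_gt0. Qed.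

(** [cos (u (y + R)) + cos (u (y - R)) = 2 cos (u y) cos (u R)], so the four absolute
    values combine into a single kernel. *)
Lemma trapezoidE r R y : r < R ->
  trapezoid r R y = trap_const r R * \int[mu]_(u in D) (cos (u * y) * trap_kernel r R u).
Proof.
move=> rR.
have iA := @integrable_abs_kernel K.
have E u : cos (u * y) * trap_kernel r R u =
    2^-1 * ((abs_kernel (y + R) u + abs_kernel (y - R) u) -
            (abs_kernel (y + r) u + abs_kernel (y - r) u)).
  rewrite /abs_kernel /trap_kernel !mulrDr !mulrN !cosD !cosN !sinN.
  by set v := (u ^+ 2)^-1; field.
under eq_Rintegral do rewrite E.
have i1 : mu.-integrable D (EFin \o (fun u => abs_kernel (y + R) u + abs_kernel (y - R) u)).
  exact: (integrableD mD (iA (y + R)) (iA (y - R))).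
have i2 : mu.-integrable D (EFin \o (fun u => abs_kernel (y + r) u + abs_kernel (y - r) u)).
  exact: (integrableD mD (iA (y + r)) (iA (y - r))).
rewrite RintegralZl//; last exact: (integrableB mD i1 i2).
rewrite RintegralB// !RintegralD// !abs_kernel_integral.
have := @abs_const_gt0 K; rewrite /trapezoid /trap_const; move: (@abs_const K) => A A0.
by field; rewrite (gt_eqF A0) subr_eq0 (gt_eqF rR).
Qed.

Section mean.
Context {d : measure_display} {T : measurableType d} (P : probability T K).
Variable X : T -> K.
Hypothesis mX : measurable_fun setT X.

Lemma measurable_cos_rv u c : measurable_fun setT (fun w => cos (u * (X w - c))).
Proof.
apply: measurableT_comp; first exact: measurable_cos.
by apply: measurable_funM => //; exact: measurable_funB.
Qed.

(** Fubini: the kernel is integrable in [u] and the cosine is bounded. *)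
Lemma mean_trapezoid r R c : 0 <= r -> r < R ->
  measurable_fun D (fun u => trap_kernel r R u * \int[P]_w cos (u * (X w - c))) /\
  \int[P]_w trapezoid r R (X w - c) =
  trap_const r R * \int[mu]_(u in D) (trap_kernel r R u * \int[P]_w cos (u * (X w - c))).
Proof.
move=> r0 rR.
pose k := trap_kernel r R \_ D.
have mk : measurable_fun [set: measurableTypeR K] k.
  by apply/(measurable_restrictT _ mD); exact: measurable_trap_kernel.
have kb u : `|k u| <= trap_bound r R u.
  rewrite /k /patch; case: ifPn => [|_]; last by rewrite normr0 trap_bound_ge0.
  by rewrite inE/= in_itv/= andbT => u0; exact: trap_kernel_bound.
have ik : mu.-integrable setT (EFin \o k).
  rewrite /k -restrict_EFin; apply/(integrable_mkcond _ mD).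
  apply: integrable_kernel; first exact: measurable_trap_kernel.
  by move=> u u0; exact: trap_kernel_bound.
pose f (p : T * measurableTypeR K) : \bar K := (cos (p.2 * (X p.1 - c)) * k p.2)%:E.
have mf : measurable_fun setT f.
  apply/measurable_EFinP; apply: measurable_funM; last exact: measurableT_comp.
  apply: measurableT_comp; first exact: measurable_cos.
  apply: measurable_funM => //; apply: measurable_funB => //.
  exact: measurableT_comp.
have intf : (P \x mu)%E.-integrable setT f.
  apply/integrable12ltyP => //.
  apply: (@le_lt_trans _ _ (\int[P]_w (\int[mu]_u `|(k u)%:E|))%E).
    apply: le_integral_any => w; apply: le_integral_any => u.
    by rewrite /f /= lee_fin normrM ler_piMl// cos_max.
  rewrite integral_cst//= probability_setT mule1.
  by move/integrableP: ik => [].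
have iC u : P.-integrable setT (EFin \o (fun w => cos (u * (X w - c)))).
  by apply: (@bounded_integrable _ _ _ _ _ 1) => [|w]; [exact: measurable_cos_rv|exact: cos_max].
have Gk u : (\int[P]_w f (w, u) = (k u * \int[P]_w cos (u * (X w - c)))%:E)%E.
  rewrite /f /=; under eq_integral do rewrite mulrC EFinM.
  rewrite integralZl//; last exact: iC.
  rewrite EFinM fineK//; exact: (integrable_fin_num measurableT (iC u)).
have kE (g : K -> K) : \int[mu]_(u in D) (trap_kernel r R u * g u) = \int[mu]_u (k u * g u).
  rewrite Rintegral_mkcond; apply: eq_Rintegral => u _.
  by rewrite /k /patch; case: ifPn => //; rewrite mul0r.
split.
  have := measurable_fubini_G intf; rewrite /fubini_G.
  under eq_fun do rewrite Gk.
  move/measurable_EFinP => h.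
  have : measurable_fun D (fun u => k u * \int[P]_w cos (u * (X w - c))) by exact: measurable_funS h.
  apply: eq_measurable_fun => u uD; rewrite /k /patch uD//.
have Fk w : fubini_F mu f w = (\int[mu]_(u in D) (cos (u * (X w - c)) * trap_kernel r R u))%:E.
  under eq_Rintegral do rewrite mulrC.
  rewrite kE /fubini_F /f/= fineK.
    by apply: eq_integral => u _; rewrite mulrC.
  apply: integrable_fin_num => //.
  apply: (@le_integrable _ _ _ mu setT _ _ (EFin \o k)) => //.
    apply/measurable_EFinP; apply: measurable_funM => //; exact: measurable_cosM.
  by move=> u _ /=; rewrite lee_fin normrM ler_piMr// cos_max.
under eq_Rintegral do rewrite (trapezoidE _ _ _ rR).
rewrite RintegralZl//; last first.
  have := integrable_fubini_F intf.
  suff -> : fubini_F mu f = EFin \o (fun w =>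
    \int[mu]_(u in D) (cos (u * (X w - c)) * trap_kernel r R u)) by [].
  by apply/funext => w; exact: Fk.
congr (_ * _); rewrite kE /Rintegral.
under eq_integral do rewrite -Fk.
rewrite (Fubini intf); congr fine.
by apply: eq_integral => u _; exact: Gk.
Qed.

End mean.

Lemma trap_integrable_bounded (G : K -> K) B r R : 
  measurable_fun D (fun u => trap_kernel r R u * G u) ->
  (forall u, 0 < u -> `|G u| <= B) ->
  mu.-integrable D (EFin \o (fun u => trap_kernel r R u * G u)).
Proof.
move=> mG GB.
apply: (@integrable_kernel _ _ ((r ^+ 2 + R ^+ 2 + 2) * B)) => // u u0.
by rewrite normrM mulrAC ler_pM// ?trap_kernel_bound// GB.
Qed.

Lemma cos_rv_bound {d : measure_display} {T : measurableType d} (P : probability T K)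
    (X : T -> K) u c : `|\int[P]_w cos (u * (X w - c))| <= 1.
Proof.
rewrite ler_norml; apply/andP; split.
  rewrite -[leLHS](mean_cst P); apply: (@le_mean_bounded _ _ _ _ _ _ 1 1) => w.
  - by rewrite normrN normr1.
  - exact: cos_max.
  - exact: cos_geN1.
rewrite -[leRHS](mean_cst P); apply: (@le_mean_bounded _ _ _ _ _ _ 1 1) => w.
- exact: cos_max.
- by rewrite normr1.
- exact: cos_le1.
Qed.

Lemma mean_cosB {d : measure_display} {T : measurableType d} (P : probability T K)
    (X : T -> K) u c : measurable_fun setT X ->
  \int[P]_w cos (u * (X w - c)) =
  cos (u * c) * (\int[P]_w cos (u * X w)) + sin (u * c) * (\int[P]_w sin (u * X w)).
Proof.
move=> mX.
have mM : measurable_fun setT (fun w => u * X w) by exact: measurable_funM.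
have ic : P.-integrable setT (EFin \o (fun w => cos (u * X w))).
  apply: (@bounded_integrable _ _ _ _ _ 1) => [|w]; last exact: cos_max.
  by apply: measurableT_comp; [exact: measurable_cos|exact: mM].
have is_ : P.-integrable setT (EFin \o (fun w => sin (u * X w))).
  apply: (@bounded_integrable _ _ _ _ _ 1) => [|w]; last exact: sin_max.
  by apply: measurableT_comp; [exact: measurable_sin|exact: mM].
rewrite -!RintegralZl// -RintegralD//.
- by apply: eq_Rintegral => w _; rewrite mulrBr cosB mulrC [in X in _ + X]mulrC.
- exact: (integrableZl measurableT _ ic).
- exact: (integrableZl measurableT _ is_).
Qed.

(** Reduced to the cosine by a shift of [pi / 2] in the argument. *)
Lemma mean_sinB {d : measure_display} {T : measurableType d} (P : probability T K)
    (X : T -> K) (u c : K) : measurable_fun setT X ->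
  \int[P]_w sin (u * (X w - c)) =
  cos (u * c) * (\int[P]_w sin (u * X w)) - sin (u * c) * (\int[P]_w cos (u * X w)).
Proof.
move=> mX; have [->|u0] := eqVneq u 0.
  under eq_Rintegral do rewrite mul0r sin0.
  under [in RHS]eq_Rintegral do rewrite mul0r sin0.
  by rewrite mean_cst mul0r sin0 mul0r mulr0 subrr.
have E w : sin (u * (X w - c)) = cos (u * (X w - (c + pi / 2 / u))).
  rewrite (_ : u * (X w - (c + _)) = u * (X w - c) - pi / 2); last by field.
  by rewrite cosBpihalf.
under eq_Rintegral do rewrite E.
rewrite mean_cosB// (_ : u * (c + _) = u * c + pi / 2); last by field.
by rewrite sinDpihalf cosDpihalf mulNr addrC.
Qed.

(** The kernel dominates, so pointwise convergence of the characteristic functions is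
    enough. *)
Lemma cvg_mean_trapezoid {d : measure_display} {T : measurableType d} (P : probability T K)
    {d' : measure_display} {T' : measurableType d'} (P' : probability T' K)
    (X : nat -> T -> K) (Y : T' -> K) r R c :
  0 <= r -> r < R ->
  (forall n, measurable_fun setT (X n)) -> measurable_fun setT Y ->
  (forall u, \int[P]_w cos (u * X n w) @[n --> \oo] --> \int[P']_w cos (u * Y w)) ->
  (forall u, \int[P]_w sin (u * X n w) @[n --> \oo] --> \int[P']_w sin (u * Y w)) ->
  \int[P]_w trapezoid r R (X n w - c) @[n --> \oo] --> \int[P']_w trapezoid r R (Y w - c).
Proof.
move=> r0 rR mX mY hc hs.
have [mYk ->] := mean_trapezoid P' Y mY r R c r0 rR.
under eq_fun => n do rewrite (mean_trapezoid P (X n) (mX n) r R c r0 rR).2.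
apply: cvgMl_tmp.
apply: (@Rintegral_dominated_cvg K _ (measurableTypeR K) mu D
  (fun n u => trap_kernel r R u * \int[P]_w cos (u * (X n w - c)))
  (fun u => trap_kernel r R u * \int[P']_w cos (u * (Y w - c))) (trap_bound r R)) => //.
- by move=> n; have [] := mean_trapezoid P (X n) (mX n) r R c r0 rR.
- exact: integrable_trap_bound.
- move=> u _; apply: cvgMl_tmp; rewrite mean_cosB//.
  under eq_fun do rewrite mean_cosB//.
  by apply: cvgD; apply: cvgMl_tmp; [exact: hc|exact: hs].
- move=> n u; rewrite /= in_itv/= andbT => u0; rewrite normrM -[leRHS]mulr1.
  by rewrite ler_pM// ?trap_kernel_bound// cos_rv_bound.
Qed.

End trapezoid.

(** * Interval probabilities from characteristic functions *)

Section interval_probabilities.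
Context {K : realType}.
Notation mu := (@lebesgue_measure K).
Notation D := (`]0, +oo[%classic : set K).

Let mD : measurable (D : set (measurableTypeR K)). Proof. exact: measurable_itv. Qed.

Lemma measurable_rv_set {d : measure_display} {T : measurableType d} (X : T -> K) (B : set K) :
  measurable_fun setT X -> measurable B -> measurable [set w | B (X w)].
Proof. by move=> mX mB; rewrite -[X in measurable X]setTI; exact: mX. Qed.

Definition prob_itv {d : measure_display} {T : measurableType d} (P : probability T K)
  (X : T -> K) (p q : K) : K := fine (P [set w | p < X w <= q]).

Lemma measurable_rv_itv {d : measure_display} {T : measurableType d} (X : T -> K) (p q : K) :
  measurable_fun setT X -> measurable [set w | p < X w <= q].
Proof.
move=> mX; have := measurable_rv_set X `]p, q]%classic mX (measurable_itv _).
by congr measurable; apply/seteqP; split=> w /=; rewrite in_itv.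
Qed.

Lemma measurable_norm_gt {d : measure_display} {T : measurableType d} (e : K) (Z : T -> K) :
  measurable_fun setT Z -> measurable [set w | e < `|Z w|].
Proof.
move=> mZ; have mN : measurable_fun setT (fun w => `|Z w|) by exact: measurableT_comp.
have := measurable_rv_set _ `]e, +oo[%classic mN (measurable_itv _).
by congr measurable; apply/seteqP; split=> w /=; rewrite in_itv/= andbT.
Qed.

Lemma prob_itvE {d : measure_display} {T : measurableType d} (P : probability T K)
  (X : T -> K) (p q : K) : measurable_fun setT X ->
  prob_itv P X p q = \int[P]_w \1_[set w | p < X w <= q] w.
Proof. by move=> mX; rewrite mean_indic//; exact: measurable_rv_itv. Qed.

Lemma measurable_trapezoid r R : measurable_fun setT (@trapezoid K r R).
Proof.
apply: continuous_measurable_fun => y.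
apply: cvgMr_tmp; apply: cvgB; last first.
  by apply: cvg_norm; apply: cvgB; [exact: cvg_id|exact: cvg_cst].
apply: cvgB; last first.
  by apply: cvg_norm; apply: cvgD; [exact: cvg_id|exact: cvg_cst].
by apply: cvgD; apply: cvg_norm; [apply: cvgD|apply: cvgB]; (exact: cvg_id || exact: cvg_cst).
Qed.

Lemma measurable_trapezoid_rv {d : measure_display} {T : measurableType d}
  (X : T -> K) r R c : measurable_fun setT X ->
  measurable_fun setT (fun w => trapezoid r R (X w - c)).
Proof.
move=> mX; apply: (@measurableT_comp _ _ _ _ _ _ (@trapezoid K r R)).
  exact: measurable_trapezoid.
exact: measurable_funB.
Qed.

Section convergence.
Context {d : measure_display} {T : measurableType d} (P : probability T K).
Context {d' : measure_display} {T' : measurableType d'} (P' : probability T' K).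
Variables (X : nat -> T -> K) (Y : T' -> K).
Hypothesis mX : forall n, measurable_fun setT (X n).
Hypothesis mY : measurable_fun setT Y.
Hypothesis cos_cvg : forall u,
  \int[P]_w cos (u * X n w) @[n --> \oo] --> \int[P']_w cos (u * Y w).
Hypothesis sin_cvg : forall u,
  \int[P]_w sin (u * X n w) @[n --> \oo] --> \int[P']_w sin (u * Y w).

(** The indicator of ]p, q] is squeezed between two trapezoids centred at [c] whose
    slopes have width [dl k].  Both have the right mean under [Y] in the limit of
    large [k], since [Y] charges neither end point. *)
Lemma cvg_prob_itv p q : p < q ->
  P' [set w | Y w = p] = 0%E -> P' [set w | Y w = q] = 0%E ->
  prob_itv P (X n) p q @[n --> \oo] --> prob_itv P' Y p q.
Proof.
move=> pq Yp Yq.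
pose c := (p + q) / 2; pose h := (q - p) / 2.
have h0 : 0 < h by rewrite divr_gt0// subr_gt0.
pose dl (k : nat) := h / k.+2%:R.
have dl0 k : 0 < dl k by rewrite divr_gt0.
have dlh k : dl k < h by rewrite ltr_pdivrMr// ltr_pMr// ltr1n.
have dlc : dl k @[k --> \oo] --> 0.
  rewrite -[X in _ --> X](mulr0 h); apply: cvgMl_tmp.
  by have := @cvg_harmonic K; rewrite -(cvg_shiftS (@harmonic K)).
pose inner k := trapezoid (h - dl k) h; pose outer k := trapezoid h (h + dl k).
have hd k : 0 <= h - dl k by rewrite subr_ge0 ltW.
have hd' k : h - dl k < h by rewrite gtrBl.
have ho k : h < h + dl k by rewrite ltrDl.
have mh := ltW h0.
pose I (y : K) : bool := p < y <= q.
have IE (S : Type) (Z : S -> K) w : \1_[set w | p < Z w <= q] w = (I (Z w))%:R :> K.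
  by rewrite indicE; congr (nat_of_bool _)%:R; apply/idP/idP; rewrite inE.
have in_le k y : inner k (y - c) <= (I y)%:R.
  rewrite /I.
  have [yI|yI] := boolP (p < y <= q).
    by have /andP[_] := trapezoid01 _ _ (y - c) (hd k) (hd' k).
  rewrite /inner trapezoid_out//.
  rewrite ler_normr /c /h; move: yI; rewrite negb_and -leNgt -ltNge => /orP[yp|qy].
    by apply/orP; right; lra.
  by apply/orP; left; lra.
have out_ge k y : (I y)%:R <= outer k (y - c).
  rewrite /I.
  have [yI|yI] := boolP (p < y <= q); last first.
    by have /andP[+ _] := trapezoid01 _ _ (y - c) mh (ho k).
  rewrite /outer trapezoid_top//.
  by rewrite ler_norml /c /h; move: yI => /andP[yp qy]; apply/andP; split; lra.
have mE (A : set K) : measurable A -> measurable [set w | A (Y w)] by exact: measurable_rv_set.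
have mi : measurable [set w | p < Y w < q].
  have := mE `]p, q[%classic (measurable_itv _).
  by congr measurable; apply/seteqP; split=> w /=; rewrite in_itv.
have mo : measurable [set w | p <= Y w <= q].
  have := mE `[p, q]%classic (measurable_itv _).
  by congr measurable; apply/seteqP; split=> w /=; rewrite in_itv.
have Ei : fine (P' [set w | p < Y w < q]) = prob_itv P' Y p q.
  congr fine; rewrite -(@measureU0 _ _ _ P' [set w | p < Y w < q] [set w | Y w = q])//; last first.
    exact: (mE [set q]).
  congr (P' _); apply/seteqP; split=> w /=.
    by move=> [/andP[-> /ltW]|->]//; rewrite pq lexx.
  move=> /andP[pY]; rewrite le_eqVlt => /orP[/eqP|Yq']; first by right.
  by left; rewrite pY.
have Eo : fine (P' [set w | p <= Y w <= q]) = prob_itv P' Y p q.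
  congr fine; rewrite -(@measureU0 _ _ _ P' [set w | p < Y w <= q] [set w | Y w = p])//; last 2 first.
  - exact: measurable_rv_itv.
  - exact: (mE [set p]).
  congr (P' _); apply/seteqP; split=> w /=.
    move=> /andP[+ Yq']; rewrite le_eqVlt => /orP[/eqP|pY]; first by right.
    by left; rewrite pY.
  by move=> [/andP[/ltW -> ->]|->]//; rewrite (ltW pq) lexx.
have innerc : \int[P']_w inner k (Y w - c) @[k --> \oo] --> prob_itv P' Y p q.
  rewrite -Ei -mean_indic//.
  apply: (@Rintegral_dominated_cvg _ _ _ P' _ _ _ (cst 1)) => //.
  - by move=> k; exact: measurable_trapezoid_rv.
  - by apply: (@bounded_integrable _ _ _ _ _ 1) => // w; rewrite normr1.
  - move=> w _; rewrite indicE; have [wI|wI] := boolP (_ \in _).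
      have lt : `|Y w - c| < h.
        rewrite ltr_norml /c /h; move: wI; rewrite inE/= => /andP[? ?].
        by apply/andP; split; lra.
      have : \forall k \near \oo, `|dl k| < h - `|Y w - c|.
        by move/cvgr0_norm_lt : dlc; apply; rewrite subr_gt0.
      move=> H; apply: cvg_near_cst; apply: filterS H => k.
      rewrite gtr0_norm// => dk; rewrite /inner trapezoid_top//.
      by rewrite lerBrDl -lerBrDr ltW.
    apply: cvg_near_cst; apply: nearW => k; rewrite /inner trapezoid_out//.
    rewrite ler_normr /c /h; move: wI; rewrite notin_setE/= => /negP.
    rewrite negb_and -!leNgt => /orP[yp|qy]; apply/orP; [right; lra|left; lra].
  - by move=> k w _; exact: trapezoid_le1.
have outerc : \int[P']_w outer k (Y w - c) @[k --> \oo] --> prob_itv P' Y p q.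
  rewrite -Eo -mean_indic//.
  apply: (@Rintegral_dominated_cvg _ _ _ P' _ _ _ (cst 1)) => //.
  - by move=> k; exact: measurable_trapezoid_rv.
  - by apply: (@bounded_integrable _ _ _ _ _ 1) => // w; rewrite normr1.
  - move=> w _; rewrite indicE; have [wI|wI] := boolP (_ \in _).
      apply: cvg_near_cst; apply: nearW => k; rewrite /outer trapezoid_top//.
      rewrite ler_norml /c /h; move: wI; rewrite inE/= => /andP[? ?].
      by apply/andP; split; lra.
    have lt : h < `|Y w - c|.
      rewrite ltr_normr /c /h; move: wI; rewrite notin_setE/= => /negP.
      by rewrite negb_and -!ltNge => /orP[yp|qy]; apply/orP; [right; lra|left; lra].
    have : \forall k \near \oo, `|dl k| < `|Y w - c| - h.
      by move/cvgr0_norm_lt : dlc; apply; rewrite subr_gt0.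
    move=> H; apply: cvg_near_cst; apply: filterS H => k.
    rewrite gtr0_norm// => dk; rewrite /outer trapezoid_out//.
    by rewrite -lerBrDl ltW.
  - by move=> k w _; exact: trapezoid_le1.
apply/cvgrPdist_le => e e0; have e20 : 0 < e / 2 by rewrite divr_gt0.
have /cvgrPdist_le/(_ _ e20)[ki _ /(_ ki (leqnn _)) /= hi] := innerc.
have /cvgrPdist_le/(_ _ e20)[ko _ /(_ ko (leqnn _)) /= hout] := outerc.
have /cvgrPdist_le/(_ _ e20) ci := @cvg_mean_trapezoid K _ _ P _ _ P' X Y _ _ c
  (hd ki) (hd' ki) mX mY cos_cvg sin_cvg.
have /cvgrPdist_le/(_ _ e20) co := @cvg_mean_trapezoid K _ _ P _ _ P' X Y _ _ c
  mh (ho ko) mX mY cos_cvg sin_cvg.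
near=> n.
have h1 : \int[P]_w inner ki (X n w - c) <= prob_itv P (X n) p q.
  rewrite prob_itvE//; apply: (@le_mean_bounded _ _ _ _ _ _ 1 1) => w.
  - exact: trapezoid_le1.
  - exact: indic_le1.
  - by rewrite IE in_le.
have h2 : prob_itv P (X n) p q <= \int[P]_w outer ko (X n w - c).
  rewrite prob_itvE//; apply: (@le_mean_bounded _ _ _ _ _ _ 1 1) => w.
  - exact: indic_le1.
  - exact: trapezoid_le1.
  - by rewrite IE out_ge.
have h3 : `|\int[P']_w inner ki (Y w - c) - \int[P]_w inner ki (X n w - c)| <= e / 2.
  by near: n.
have h4 : `|\int[P']_w outer ko (Y w - c) - \int[P]_w outer ko (X n w - c)| <= e / 2.
  by near: n.
move: hi hout h3 h4; rewrite !ler_distl => /andP[? ?] /andP[? ?] /andP[? ?] /andP[? ?].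
by apply/andP; split; lra.
Unshelve. all: end_near. Qed.

End convergence.

(** The truncation inequality: [1 - trapezoid 0 e] dominates the indicator of the
    tail, and its mean is an integral of [1 - E cos (u X)] against an integrable
    kernel.  The bound on [1 - E cos (u X)] makes that integral small for large [m],
    uniformly over all laws, which is why the law is quantified after [m]. *)
Lemma tail_le_half (e C : K) : 0 < e -> 0 <= C ->
  \forall m \near \oo, forall (d : measure_display) (T : measurableType d)
    (P : probability T K) (X : T -> K), measurable_fun setT X ->
    (forall u, 1 - \int[P]_w cos (u * X w) <= C * (1 + u ^+ 2) / m%:R) ->
    fine (P [set w | e < `|X w|]) <= 2^-1.
Proof.
move=> e0 C0.
pose g (m : nat) u : K := Num.min 2 (C * (1 + u ^+ 2) / m%:R).
pose f m u := trap_kernel 0 e u * g m u.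
have ker0 u : 0 <= trap_kernel 0 e u.
  by rewrite /trap_kernel mulr0 cos0 divr_ge0 ?sqr_ge0// subr_ge0 cos_le1.
have b0 m u : 0 <= C * (1 + u ^+ 2) / m%:R.
  by rewrite divr_ge0 ?mulr_ge0 ?(ltW (oneDsq_gt0 _)).
have g0 m u : 0 <= g m u by rewrite le_min b0 ler0n.
have mf m : measurable_fun D (f m).
  apply: measurable_funM; first exact: measurable_trap_kernel.
  apply: measurable_funTS; apply: measurable_minr => //.
  apply: continuous_measurable_fun => u; apply: cvgMr_tmp; apply: cvgMl_tmp.
  by apply: cvgD; [exact: cvg_cst|exact: exprn_continuous].
have fb m u : 0 < u -> `|f m u| <= 2 * trap_bound 0 e u.
  move=> u0; rewrite normrM mulrC ler_pM ?trap_kernel_bound//.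
  by rewrite ger0_norm// ge_min lexx.
have ib : mu.-integrable D (EFin \o (fun u => 2 * trap_bound 0 e u)).
  exact: (integrableZl mD _ (integrable_trap_bound 0 e)).
have Bc : trap_const 0 e * \int[mu]_(u in D) f m u @[m --> \oo] --> 0.
  rewrite -[X in _ --> X](mulr0 (trap_const 0 e)); apply: cvgMl_tmp.
  have Z : \int[mu]_(u in D) (cst 0 u) = 0 :> K by rewrite Rintegral_cst ?mul0r.
  rewrite -[X in _ --> X]Z.
  apply: (@Rintegral_dominated_cvg K _ (measurableTypeR K) mu D f (cst 0)
    (fun u => 2 * trap_bound 0 e u)) => //.
  - move=> u _; rewrite -[X in _ --> X](mulr0 (trap_kernel 0 e u)); apply: cvgMl_tmp.
    apply: (@squeeze_cvgr _ _ _ _ (cst 0) (fun m => C * (1 + u ^+ 2) / m%:R)).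
    + by apply: nearW => m; rewrite g0 ge_min lexx orbT.
    + exact: cvg_cst.
    + rewrite -[X in _ --> X](mulr0 (C * (1 + u ^+ 2))); apply: cvgMl_tmp.
      apply/gtr0_cvgV0; last exact: cvgr_idn.
      by near=> m; rewrite ltr0n; near: m; exact: nbhs_infty_gt.
  - by move=> m u; rewrite /= in_itv/= andbT => u0; exact: fb.
have h20 : 0 < 2^-1 :> K by rewrite invr_gt0.
move/cvgr0_norm_lt : Bc => /(_ _ h20) near_half.
near=> m => d T P X mX hX.
have hm : `|trap_const 0 e * \int[mu]_(u in D) f m u| < 2^-1 by near: m.
apply: le_trans (ltW (le_lt_trans (ler_norm _) hm)).
have mE : measurable [set w | e < `|X w|] by exact: measurable_norm_gt.
have mt : P.-integrable setT (EFin \o (fun w => trapezoid 0 e (X w - 0))).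
  apply: (@bounded_integrable _ _ _ _ _ 1) => [|w]; last exact: trapezoid_le1.
  exact: measurable_trapezoid_rv.
have i1 : P.-integrable setT (EFin \o cst (1 : K)).
  by apply: (@bounded_integrable _ _ _ _ _ 1) => // w; rewrite normr1.
apply: (@le_trans _ _ (\int[P]_w (1 - trapezoid 0 e (X w - 0)))).
  rewrite -mean_indic//; apply: (@le_mean_bounded _ _ _ _ _ _ 1 1) => w.
  - exact: indic_le1.
  - have /andP[? ?] := trapezoid01 0 e (X w - 0) (lexx _) e0.
    by rewrite ger0_norm; lra.
  - have /andP[? ?] := trapezoid01 0 e (X w - 0) (lexx _) e0.
    rewrite indicE; have [|_] := boolP (_ \in _); last by rewrite subr_ge0.
    rewrite inE/= => eX; rewrite trapezoid_out// ?subr0//.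
    by rewrite ltW.
rewrite RintegralB// mean_cst.
have [mk ->] := mean_trapezoid P X mX 0 e 0 (lexx 0) e0.
rewrite -[X in X - _](trapezoid_top 0 e 0 (lexx 0) e0) ?normr0//.
rewrite trapezoidE// -mulrBr ler_pM2l ?trap_const_gt0//.
have ik : mu.-integrable D (EFin \o (fun u => cos (u * 0) * trap_kernel 0 e u)).
  apply: (@integrable_kernel _ _ (0 ^+ 2 + e ^+ 2 + 2)).
    by apply: measurable_funM; [exact: measurable_cosM|exact: measurable_trap_kernel].
  by move=> u u0; rewrite mulr0 cos0 mul1r trap_kernel_bound.
have ikX : mu.-integrable D (EFin \o (fun u =>
    trap_kernel 0 e u * \int[P]_w cos (u * (X w - 0)))).
  by apply: (@trap_integrable_bounded _ _ 1) => // u _; exact: cos_rv_bound.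
rewrite -RintegralB//; apply: le_Rintegral => //.
- exact: (integrableB mD ik ikX).
- apply: (le_integrable mD _ _ ib); first by apply/measurable_EFinP; exact: mf.
  move=> u; rewrite /= in_itv/= andbT => u0; rewrite lee_fin (le_trans (fb m u u0))//.
  exact: ler_norm.
- move=> u _; rewrite mulr0 cos0 mul1r -[X in X - _]mulr1 -mulrBr /f ler_wpM2l//.
  rewrite /g le_min; apply/andP; split.
    have := cos_rv_bound P X u 0; rewrite ler_norml => /andP[? _]; lra.
  by have := hX u; under eq_Rintegral do rewrite -[X in cos (_ * X)](subr0 (X _)).
Unshelve. all: end_near. Qed.

End interval_probabilities.

(** * Ottaviani's inequality for independent increments *)

Section stationary.
Context {K : realType} {d : measure_display} {T : measurableType d}.
Variable P : probability T K.

(** What the rescaled Levy process and the Wiener process have in common; both are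
    only given on the unit interval. *)
Record stationary_process (Y : K -> T -> K) : Prop := StationaryProcess {
  stat_measurable : forall t, 0 <= t <= 1 -> measurable_fun setT (Y t) ;
  stat_start : forall w, Y 0 w = 0 ;
  stat_right_continuous : forall w t, 0 <= t < 1 -> Y u w @[u --> t^'+] --> Y t w ;
  stat_independent : independent_increments P `[0, 1]%classic Y ;
  stat_homogeneous : forall s h (B : set K), 0 <= s -> 0 <= h -> s + h <= 1 ->
    measurable B ->
    P [set w | B (Y (s + h) w - Y s w)] = P [set w | B (Y h w)] }.

Variable Y : K -> T -> K.
Hypothesis statY : stationary_process Y.

Lemma measurable_increment a b : 0 <= a <= 1 -> 0 <= b <= 1 ->
  measurable_fun setT (fun w => Y b w - Y a w).
Proof. by move=> a01 b01; apply: measurable_funB; apply: (stat_measurable _ statY). Qed.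

Section ottaviani.
Variables (N : nat) (t : nat -> K).
Hypothesis t01 : forall i, (i <= N)%N -> 0 <= t i <= 1.
Hypothesis t_nd : forall i, (i < N)%N -> t i <= t i.+1.

Let inc i w := Y (t i.+1) w - Y (t i) w.
Let S i w := Y (t i) w - Y (t 0) w.

Let t_mono i j : (i <= j)%N -> (j <= N)%N -> t i <= t j.
Proof.
elim: j => [|j IH]; first by rewrite leqn0 => /eqP->.
move=> ij jN; have [->//|ne] := eqVneq i j.+1.
apply: le_trans (t_nd _ jN); apply: IH; last exact: ltnW.
by rewrite -ltnS ltn_neqAle ne.
Qed.

(** A pi-system that generates the events of the past up to time [t j]. *)
Definition rectangles (j : nat) : set (set T) :=
  [set R | exists2 B : nat -> set K, (forall i, measurable (B i)) &
    R = [set w | forall i, (i < j)%N -> B i (inc i w)]].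

Lemma rectangles_measurable j : (j <= N)%N -> rectangles j `<=` measurable.
Proof.
move=> jN _ [B mB ->].
rewrite (_ : [set w | _] = \bigcap_(i in [set i | (i < j)%N]) [set w | B i (inc i w)]); last by [].
apply: bigcap_measurableType => i /= ij; apply: measurable_rv_set => //.
by apply: measurable_increment; apply: t01; rewrite ?(leq_trans ij)// (leq_trans (ltnW ij)).
Qed.

Lemma rectangles_setI j : setI_closed (rectangles j).
Proof.
move=> _ _ [B mB ->] [B' mB' ->]; exists (fun i => B i `&` B' i).
  by move=> i; exact: measurableI.
apply/seteqP; split=> w /=.
  by move=> [h1 h2] i ij; split; [exact: h1|exact: h2].
by move=> h; split=> i /h[].
Qed.

(** On the coarser grid [u] the whole stretch from [t j] to [t N] is a single
    increment, so that independence of the increments applies as it stands. *)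
Lemma rectangle_indep j (C : set K) : (j <= N)%N -> measurable C ->
  forall R, rectangles j R ->
  (P (R `&` [set w | C (Y (t N) w - Y (t j) w)%R]) =
   P R * P [set w | C (Y (t N) w - Y (t j) w)%R])%E.
Proof.
move=> jN mC _ [B mB ->].
pose u i := if (i <= j)%N then t i else t N.
have u01 i : (i <= j.+1)%N -> `[0, 1]%classic (u i).
  by move=> _; rewrite /= in_itv/= /u; case: ifPn => ij; apply: t01 => //; exact: leq_trans jN.
have u_nd i : (i < j.+1)%N -> u i <= u i.+1.
  rewrite ltnS /u => ij; rewrite ij; case: ifPn => ij'; first exact/t_nd/(leq_trans ij').
  by apply: t_mono => //; exact: leq_trans ij jN.
pose BB C' (i : 'I_j.+1) := if (i < j)%N then B i else C'.
have key C' : measurable C' ->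
    (P ([set w | forall i, (i < j)%N -> B i (inc i w)] `&`
       [set w | C' (Y (t N) w - Y (t j) w)%R]) =
     (\prod_(i < j) fine (P [set w | B i (inc i w)]))%:E *
      P [set w | C' (Y (t N) w - Y (t j) w)%R])%E.
  move=> mC'.
  have := stat_independent _ statY j.+1 u u01 u_nd (BB C') _.
  have mBB i : measurable (BB C' i) by rewrite /BB; case: ifPn.
  move=> /(_ mBB).
  have El : [set w | BB C' ord_max (Y (u j.+1) w - Y (u j) w)] =
      [set w | C' (Y (t N) w - Y (t j) w)] by rewrite /BB /u /= ltnn leqnn.
  rewrite big_ord_recr/= El => E.
  have -> : [set w | forall i, (i < j)%N -> B i (inc i w)] `&`
       [set w | C' (Y (t N) w - Y (t j) w)] =
     [set w | forall i : 'I_j.+1, BB C' i (Y (u i.+1) w - Y (u i) w)].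
    apply/seteqP; split=> w /=.
      move=> [h1 h2] i; rewrite /BB /u; case: ifPn => ij.
        by rewrite ltnW//; exact: h1.
      have -> : i = j :> nat by apply/eqP; rewrite eqn_leq -ltnS ltn_ord/= leqNgt.
      by rewrite leqnn.
    move=> h; split.
      move=> i ij; have := h (Ordinal (ltnW ij : (i < j.+1)%N)).
      by rewrite /BB /u/= ij ltnW.
    by have := h ord_max; rewrite /BB /u/= ltnn leqnn.
  rewrite E; congr (_ * _)%E.
  rewrite (big_morph EFin EFinM erefl); apply: eq_bigr => i _.
  rewrite /BB/= ltn_ord /u (ltnW (ltn_ord i)) ltn_ord fineK//.
  apply: fin_num_measure; apply: measurable_rv_set => //.
  have iN : (i < N)%N := leq_trans (ltn_ord i) jN.
  by apply: measurable_increment; apply: t01 => //; exact: ltnW.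
(* the past event itself is the case of a trivial future *)
have -> : P [set w | forall i, (i < j)%N -> B i (inc i w)] =
    (\prod_(i < j) fine (P [set w | B i (inc i w)]))%:E.
  have := key setT measurableT.
  by rewrite (_ : [set w | setT _] = setT)// setIT probability_setT mule1.
exact: key.
Qed.

(** Both sides are finite measures in [E] that agree on a pi-system. *)
Lemma past_indep j (C : set K) : (j <= N)%N -> measurable C ->
  forall E, <<s rectangles j >> E ->
  (P (E `&` [set w | C (Y (t N) w - Y (t j) w)%R]) =
   P E * P [set w | C (Y (t N) w - Y (t j) w)%R])%E.
Proof.
move=> jN mC E sE.
set Z := [set w | C _].
have mZ : measurable Z.
  by apply: measurable_rv_set => //; apply: measurable_increment; apply: t01.
have PZ : P Z \is a fin_num by exact: fin_num_measure.
pose k : {nonneg K} := NngNum (fine_ge0 (measure_ge0 P Z)).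
have := @g_sigma_algebra_measure_unique _ K T (rectangles j)
  (@rectangles_measurable j jN) (fun=> setT) _ _ (mrestr P mZ) (mscale k P)
  (@rectangles_setI j) _ _ E sE.
have kE : (k%:num)%:E = P Z by rewrite /k/= fineK.
move=> uniq; rewrite -kE muleC; apply: uniq.
- by move=> _; exists (fun=> setT) => //; apply/seteqP; split.
- by apply/seteqP; split=> // w _; exists 0%N.
- move=> A RA; rewrite -[RHS]/(k%:num%:E * P A)%E kE muleC.
  exact: (rectangle_indep _ _ jN mC).
- move=> _; rewrite /mrestr (le_lt_trans (probability_le1 P _)) ?ltry//.
  exact: measurableI.
Qed.

Let past_measurable j i : (i <= j)%N ->
  measurable_fun [set: g_sigma_algebraType (rectangles j)]
    (S i : g_sigma_algebraType (rectangles j) -> K).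
Proof.
elim: i => [_|i IH ij].
  rewrite (_ : S 0%N = cst 0) //; apply/funext => w; rewrite /S subrr//.
rewrite (_ : S i.+1 = (fun w => S i w + inc i w)); last first.
  by apply/funext => w; rewrite /S /inc; ring.
apply: measurable_funD; first exact: IH (ltnW ij).
move=> _ B mB; rewrite setTI; apply: sub_sigma_algebra.
exists (fun k => if k == i then B else setT); first by move=> k; case: ifP.
apply/seteqP; split=> w /=.
  by move=> Bw k kj; case: eqP => // ->.
by move=> /(_ i ij); rewrite eqxx.
Qed.

Definition exceed_before (e : K) (j : nat) : set T :=
  [set w | e < `|S j w| /\ forall i, (i < j)%N -> `|S i w| <= e].

Let exceed_past e j : <<s rectangles j >> (exceed_before e j).
Proof.
have mS i : (i <= j)%N -> measurable_fun [set: g_sigma_algebraType (rectangles j)]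
    (fun w : g_sigma_algebraType (rectangles j) => `|S i w|).
  by move=> ij; apply: measurableT_comp => //; exact: past_measurable.
have -> : exceed_before e j = (fun w => `|S j w|) @^-1` `]e, +oo[%classic `&`
   \bigcap_(i in [set i | (i < j)%N]) ((fun w => `|S i w|) @^-1` `]-oo, e]%classic).
  apply/seteqP; split=> w /=.
    move=> [h1 h2]; split; first by rewrite in_itv/= andbT.
    by move=> i /= /h2; rewrite in_itv.
  rewrite in_itv/= andbT => -[h1 h2]; split=> // i ij.
apply: (@measurableI _ (g_sigma_algebraType (rectangles j))).
  by rewrite -[X in measurable X]setTI; apply: mS => //; exact: measurable_itv.
apply: (@bigcap_measurableType _ (g_sigma_algebraType (rectangles j))) => i /= ij.
by rewrite -[X in measurable X]setTI; apply: mS (ltnW ij) _ _ _ => //; exact: measurable_itv.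
Qed.

Let mS j : (j <= N)%N -> measurable_fun setT (S j).
Proof. by move=> jN; apply: measurable_increment; apply: t01. Qed.

Let exceed_measurable e j : (j <= N)%N -> measurable (exceed_before e j).
Proof.
move=> jN.
rewrite (_ : exceed_before e j = [set w | e < `|S j w|] `&`
   \bigcap_(i in [set i | (i < j)%N]) ~` [set w | e < `|S i w|]); last first.
  apply/seteqP; split=> w /=.
    by move=> [h1 h2]; split=> // i ij /=; apply/negP; rewrite -leNgt; exact: h2.
  by move=> [h1 h2]; split=> // i ij; rewrite leNgt; apply/negP; exact: h2.
apply: measurableI; first exact/measurable_norm_gt/mS.
apply: bigcap_measurableType => i /= ij; apply: measurableC; apply/measurable_norm_gt/mS.
exact: leq_trans (ltnW ij) jN.
Qed.

(** At the first [j] where the path exceeds [2 e], the rest of the way to time [t N]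
    is independent of the past and stays below [e] with probability at least [1/2];
    when it does, the path still exceeds [e] at time [t N]. *)
Lemma ottaviani (e : K) :
  (forall j, (j <= N)%N -> fine (P [set w | e < `|Y (t N) w - Y (t j) w|]) <= 2^-1) ->
  fine (P [set w | exists2 j, (j <= N)%N & e *+ 2 < `|S j w|]) <=
   2 * fine (P [set w | e < `|S N w|]).
Proof.
move=> half.
pose A j := exceed_before (e *+ 2) j.
have mA j : (j <= N)%N -> measurable (A j) by exact: exceed_measurable.
pose C : set K := [set x | `|x| <= e].
have mC : measurable C.
  rewrite (_ : C = `[- e, e]%classic); first exact: measurable_itv.
  by apply/seteqP; split=> x; rewrite /C/= in_itv/= ler_norml.
pose Z j := [set w | C (Y (t N) w - Y (t j) w)].
have mZ j : (j <= N)%N -> measurable (Z j).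
  move=> jN; apply: (measurable_rv_set (fun w => Y (t N) w - Y (t j) w)) => //.
  by apply: measurable_increment; apply: t01.
have Zhalf j : (j <= N)%N -> 2^-1 <= fine (P (Z j)).
  move=> jN; have -> : Z j = ~` [set w | e < `|Y (t N) w - Y (t j) w|].
    by apply/seteqP; split=> w /=; rewrite /Z/C/= leNgt => /negP.
  rewrite probability_setC; last by apply: measurable_norm_gt; apply: measurable_increment; apply: t01.
  rewrite fineB//; last by apply: fin_num_measure; apply: measurable_norm_gt; apply: measurable_increment; apply: t01.
  have := half j jN; rewrite /=; lra.
have trivA : trivIset setT (fun j : 'I_N.+1 => A j).
  apply/trivIsetP => i j _ _ ij; apply/seteqP; split=> w //= [[h1 h2] [h3 h4]].
  move: ij; rewrite -val_eqE/= neq_ltn => /orP[/h4|/h2]; rewrite leNgt.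
    by rewrite h1.
  by rewrite h3.
have E : [set w | exists2 j, (j <= N)%N & e *+ 2 < `|S j w|] = \big[setU/set0]_(j < N.+1) A j.
  rewrite -(bigcup_mkord N.+1 A); apply/seteqP; split=> w /=; last first.
    by move=> [j /=]; rewrite ltnS => jN [h1 _]; exists j.
  move=> [j jN hj].
  have ex : exists k, e *+ 2 < `|S k w| by exists j.
  have [k hk kmin] := ex_minnP ex; exists k => /=.
    by rewrite ltnS (leq_trans _ jN)// kmin.
  split=> // i ik; rewrite leNgt; apply/negP => /kmin.
  by rewrite leqNgt ik.
have incl : \big[setU/set0]_(j < N.+1) (A j `&` Z j) `<=` [set w | e < `|S N w|].
  rewrite -(bigcup_mkord N.+1 (fun j => A j `&` Z j)) => w [j /=]; rewrite ltnS => jN [[h1 _]].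
  rewrite /Z/C/= => h2; rewrite ltNge; apply/negP => h3.
  move: h1; rewrite ltNge => /negP; apply.
  have -> : S j w = S N w - (Y (t N) w - Y (t j) w) by rewrite /S; ring.
  by rewrite (le_trans (ler_normB _ _))// mulr2n lerD.
have trivAZ : trivIset setT (fun j : 'I_N.+1 => A j `&` Z j).
  apply/trivIsetP => i j _ _ ij; apply/seteqP; split=> w //= [[a _] [b _]].
  have /trivIsetP/(_ i j I I ij) E0 := trivA.
  by have : (A i `&` A j) w by []; rewrite E0.
have jle (j : 'I_N.+1) : (j <= N)%N by rewrite -ltnS.
have mAZ (j : 'I_N.+1) : measurable (A j `&` Z j) by apply: measurableI; [exact: mA|exact: mZ].
rewrite E measure_bigsetU_ord//; last by move=> j; exact: mA.
have le2 : (\sum_(j < N.+1) P (A j `&` Z j) <= P [set w | (e < `|S N w|)%R])%E.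
  rewrite -measure_bigsetU_ord//; apply: le_measure => //; rewrite inE.
    by apply: bigsetU_measurable => j _; exact: mAZ.
  exact/measurable_norm_gt/mS.
have PN : P [set w | e < `|S N w|] \is a fin_num by apply: fin_num_measure; exact/measurable_norm_gt/mS.
have -> : (2 : K) = fine (2%:E) by [].
rewrite -fineM// fine_le//.
- by apply/sum_fin_numP => j _ _; apply: fin_num_measure; exact: mA.
- by rewrite fin_numM.
apply: le_trans (lee_wpmul2l _ le2); last by rewrite lee_fin.
rewrite ge0_sume_distrr//; apply: lee_sum => j _.
rewrite (past_indep _ _ (jle j) mC)//; last exact: exceed_past.
rewrite -/(Z j) muleCA -[leLHS]mule1 lee_wpmul2l//.
have PZ : P (Z j) \is a fin_num by apply: fin_num_measure; exact: mZ.
by rewrite -(fineK PZ) -EFinM lee_fin; have := Zhalf j (jle j); lra.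
Qed.

End ottaviani.
End stationary.

(** * Oscillation over a block of time *)

Section oscillation.
Context {K : realType} {d : measure_display} {T : measurableType d}.
Variable P : probability T K.
Variable Y : K -> T -> K.
Hypothesis statY : stationary_process P Y.

Lemma prob_increment_gt (e a b : K) : 0 <= a -> a <= b -> b <= 1 ->
  P [set w | e < `|Y b w - Y a w|] = P [set w | e < `|Y (b - a) w|].
Proof.
move=> a0 ab b1.
have mB : measurable [set x : K | e < `|x|] by apply: (measurable_norm_gt e id); exact: measurable_id.
have := stat_homogeneous _ _ statY a (b - a) _ a0 _ _ mB.
rewrite (addrC a) subrK subr_ge0; exact.
Qed.

Variables (s h e : K).
Hypotheses (s0 : 0 <= s) (h0 : 0 < h) (sh1 : s + h <= 1).
Hypothesis half : forall t, 0 <= t <= h -> fine (P [set w | e < `|Y t w|]) <= 2^-1.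

Let tm (r j : nat) : K := s + h * (j%:R / (2 ^ r)%:R).

Let tmN r : tm r (2 ^ r) = s + h.
Proof. by rewrite /tm mulfV ?mulr1// pnatr_eq0 expn_eq0. Qed.

Let tm0 r : tm r 0 = s. Proof. by rewrite /tm mul0r mulr0 addr0. Qed.

Let tm_mono r i j : (i <= j)%N -> tm r i <= tm r j.
Proof. by move=> ij; rewrite lerD2l ler_wpM2l ?(ltW h0)// ler_wpM2r ?invr_ge0// ler_nat. Qed.

Let tm_le r j : (j <= 2 ^ r)%N -> s <= tm r j <= s + h.
Proof. by move=> jr; rewrite -{1}(tm0 r) -(tmN r) !tm_mono. Qed.

Let tm01 r j : (j <= 2 ^ r)%N -> 0 <= tm r j <= 1.
Proof. by move=> /tm_le/andP[h1 h2]; rewrite (le_trans s0 h1) (le_trans h2 sh1). Qed.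

Let O r : set T := [set w | exists2 j, (j <= 2 ^ r)%N & e *+ 2 < `|Y (tm r j) w - Y s w|].

Let mO r : measurable (O r).
Proof.
rewrite (_ : O r = \bigcup_(j in [set j | (j <= 2 ^ r)%N])
    [set w | e *+ 2 < `|Y (tm r j) w - Y s w|]); last by [].
apply: bigcup_measurable => j /= jr; apply: measurable_norm_gt.
by rewrite -(tm0 r); apply: (measurable_increment _ _ statY); exact: tm01.
Qed.

Let O_le r : fine (P (O r)) <= 2 * fine (P [set w | e < `|Y h w|]).
Proof.
have := @ottaviani _ _ _ P Y statY (2 ^ r) (tm r) (@tm01 r) (fun i _ => tm_mono r _ _ (leqnSn i)) e.
rewrite tmN tm0 prob_increment_gt ?lerDl ?(ltW h0)// addrAC subrr add0r; apply=> j jr.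
have /andP[h1 h2] := tm_le r j jr; have /andP[h3 h4] := tm01 r j jr.
rewrite prob_increment_gt//; apply: half.
by rewrite subr_ge0 h2/=; lra.
Qed.

(** Dyadic subdivisions are nested, so the exceptional events increase. *)
Let O_nd : nondecreasing_seq O.
Proof.
apply/nondecreasing_seqP => r; apply/subsetPset => w [j jr hj]; exists (2 * j)%N.
  by rewrite expnS leq_pmul2l.
suff -> : tm r.+1 (2 * j) = tm r j by [].
congr (s + h * _); rewrite expnS !natrM invfM mulrACA mulfV ?mul1r//.
Qed.

(** Ottaviani's inequality bounds the maximum over every dyadic subdivision of the
    block by the same constant; right-continuity carries the bound from the dyadic
    points to the whole block. *)
Lemma block_oscillation : exists O : set T, [/\ measurable O,
  fine (P O) <= 2 * fine (P [set w | e < `|Y h w|]) &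
  forall w, ~ O w -> forall t, s <= t <= s + h -> `|Y t w - Y s w| <= e *+ 2].
Proof.
have mU : measurable (\bigcup_r O r) by exact: bigcupT_measurable.
exists (\bigcup_r O r); split=> //.
  have c := nondecreasing_cvg_mu (mu := P) mO mU O_nd.
  have c' : fine (P (O r)) @[r --> \oo] --> fine (P (\bigcup_r O r)).
    apply: fine_cvg; rewrite fineK; first exact: c.
    exact: fin_num_measure.
  have /cvg_lim <- // := c'.
  apply: limr_le; first exact: cvgP c'.
  by apply: nearW => r; exact: O_le.
move=> w nO t /andP[st]; rewrite le_eqVlt => /predU1P[->|tsh].
  rewrite leNgt; apply/negP => hj; apply: nO; exists 0%N => //; exists 1%N => //.
  by have := tmN 0; rewrite expn0 => ->.
rewrite leNgt; apply/negP => hj; apply: nO.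
have t01 : 0 <= t < 1 by rewrite (le_trans s0 st) (lt_le_trans tsh sh1).
have cn : `|Y u w - Y s w| @[u --> t^'+] --> `|Y t w - Y s w|.
  by apply: cvg_norm; apply: cvgB; [exact: (stat_right_continuous _ _ statY)|exact: cvg_cst].
have := cvgr_gt _ cn _ hj.
rewrite /at_right near_withinE => /(_ _) Hn.
have [dl /= dl0 H] := (iffLR (nbhs_ballP _ _)) Hn.
pose q := Num.min dl (s + h - t); have q0 : 0 < q by rewrite lt_min dl0 subr_gt0.
(* a dyadic point of the block within [q] to the right of [t] *)
have [r hr] : exists r : nat, h / (2 ^ r)%:R < q.
  have : h / 2 ^+ r @[r --> \oo] --> 0.
    rewrite -[X in _ --> X](mulr0 h); apply: cvgMl_tmp.
    under eq_fun do rewrite -exprVn; apply: cvg_expr.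
    by rewrite ger0_norm ?invr_ge0// invf_lt1// ltr1n.
  move/cvgr0_norm_lt => /(_ _ q0)[r _ /(_ r (leqnn r))] /= hr.
  by exists r; rewrite natrX; apply: le_lt_trans hr; exact: ler_norm.
pose N : K := (2 ^ r)%:R; have N0 : 0 < N by rewrite ltr0n expn_gt0.
pose z := (t - s) * N / h; have z0 : 0 <= z by rewrite divr_ge0 ?(ltW h0)// mulr_ge0 ?subr_ge0// ltW.
have /andP[k1 k2] := truncn_itv z0.
set k := Num.truncn z in k1 k2; pose j := k.+1.
have tj : t < tm r j.
  rewrite /tm -ltrBlDl mulrA ltr_pdivlMr// (mulrC h).
  by move: k2; rewrite /z ltr_pdivrMr.
have jt : tm r j < t + q.
  rewrite /tm; apply: (@le_lt_trans _ _ (t + h / N)); last by rewrite ltrD2l.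
  rewrite -lerBlDl -/N /j -natr1 mulrDl mul1r mulrDr [leLHS]addrC.
  rewrite -lerBrDl addrA addrAC.
  have : h * (k%:R / N) <= t - s.
    by move: k1; rewrite /z ler_pdivlMr// mulrA ler_pdivrMr// (mulrC h).
  by lra.
have jN : (j <= 2 ^ r)%N.
  have : tm r j < s + h by apply: lt_le_trans jt _; rewrite -lerBrDl ge_min lexx orbT.
  rewrite /tm ltrD2l -[ltRHS]mulr1 ltr_pM2l// ltr_pdivrMr// mul1r ltr_nat.
  exact: ltnW.
exists r => //; exists j => //.
apply: H => //=; rewrite /ball/= ltr0_norm ?subr_lt0// opprB ltrBlDl.
by apply: lt_le_trans jt _; rewrite lerD2l ge_min lexx.
Qed.

End oscillation.

(** * Step paths *)

Section step_paths.
Context {K : realType}.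

Lemma skorohod_dist_le_sup (x y : skorohod K) (e : K) : 0 <= e ->
  (forall t, 0 <= t <= 1 -> `|x t - y t| <= e) -> mdist x y <= e.
Proof.
move=> e0 xy; apply/ler_addgt0Pr => dl dl0.
apply: ge_inf; first by exists 0 => e' [/ltW].
split; first by rewrite ltr_wpDl.
exists id; first exact: time_change_id.
move=> t t01; rewrite subrr normr0; split; first by rewrite addr_ge0// ltW.
by rewrite (le_trans (xy t t01))// lerDl ltW.
Qed.

(** The [i]-th jump sits at the end of the [i]-th block, so that at the grid times the
    values are the partial sums of the jumps. *)
Definition step_fun (m : nat) (y : 'I_m -> K) (t : K) : K :=
  if 0 <= t <= 1 then \sum_(i < m) y i * (i.+1%:R / m%:R <= t)%R%:R else 0.

Let step_right (c t : K) : ((c <= u)%R%:R : K) @[u --> t^'+] --> ((c <= t)%R%:R : K).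
Proof.
apply: cvg_near_cst; have [ct|tc] := leP c t.
  near=> u; have -> : c <= u by rewrite (le_trans ct)// ltW//; near: u; exact: nbhs_right_gt.
  by [].
near=> u; suff -> : (c <= u) = false by [].
by apply/negbTE; rewrite -ltNge; near: u; exact: nbhs_right_lt.
Unshelve. all: end_near. Qed.

Let step_left (c t : K) : ((c <= u)%R%:R : K) @[u --> t^'-] --> ((c < t)%R%:R : K).
Proof.
apply: cvg_near_cst; have [ct|tc] := ltP c t.
  near=> u; have -> : c <= u by rewrite ltW//; near: u; exact: nbhs_left_gt.
  by [].
near=> u; suff -> : (c <= u) = false by [].
by apply/negbTE; rewrite -ltNge (lt_le_trans _ tc)//; near: u; exact: nbhs_left_lt.
Unshelve. all: end_near. Qed.

Lemma step_fun_cadlag m (y : 'I_m -> K) : cadlag01 (step_fun m y).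
Proof.
split=> t /andP[t0 t1].
  rewrite {2}/step_fun t0 (ltW t1)/=.
  suff c : \sum_(i < m) y i * (i.+1%:R / m%:R <= u)%R%:R @[u --> t^'+] -->
      \sum_(i < m) y i * (i.+1%:R / m%:R <= t)%R%:R.
    apply: cvg_trans c; apply: near_eq_cvg; near=> u; rewrite /step_fun ifT//.
    rewrite (le_trans t0)/=; last by rewrite ltW//; near: u; exact: nbhs_right_gt.
    by rewrite ltW//; near: u; exact: nbhs_right_lt.
  apply: cvg_big => [|i _]; [exact: add_continuous|apply: cvgMl_tmp; exact: step_right].
apply/cvg_ex; exists (\sum_(i < m) y i * (i.+1%:R / m%:R < t)%R%:R).
suff c : \sum_(i < m) y i * (i.+1%:R / m%:R <= u)%R%:R @[u --> t^'-] -->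
    \sum_(i < m) y i * (i.+1%:R / m%:R < t)%R%:R.
  apply: cvg_trans c; apply: near_eq_cvg; near=> u; rewrite /step_fun ifT//.
  rewrite ltW/=; last by near: u; exact: nbhs_left_gt.
  by rewrite (le_trans _ t1)// ltW//; near: u; exact: nbhs_left_lt.
apply: cvg_big => [|i _]; [exact: add_continuous|apply: cvgMl_tmp; exact: step_left].
Unshelve. all: end_near. Qed.

Lemma step_fun_off m (y : 'I_m -> K) t : ~~ (0 <= t <= 1) -> step_fun m y t = 0.
Proof. by rewrite /step_fun => /negbTE ->. Qed.

Definition step_path m (y : 'I_m -> K) : skorohod K :=
  Skorohod (step_fun_cadlag m y) (step_fun_off m y).

(** At grid times the two paths differ by the rounding errors of at most [m]
    increments, and between grid times [x] moves by at most [e] more. *)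
Lemma step_path_close m (y : 'I_m -> K) (x : skorohod K) (e eta : K) : (0 < m)%N ->
  0 <= eta -> x 0 = 0 ->
  (forall i : 'I_m, `|x (i.+1%:R / m%:R) - x (i%:R / m%:R) - y i| <= eta) ->
  (forall i : 'I_m, forall t, i%:R / m%:R <= t <= i%:R / m%:R + m%:R^-1 ->
    `|x t - x (i%:R / m%:R)| <= e) ->
  0 <= e -> mdist x (step_path m y) <= e + m%:R * eta.
Proof.
move=> m0 eta0 x0 hy hx e0.
have m0' : 0 < m%:R :> K by rewrite ltr0n.
apply: skorohod_dist_le_sup => [|t /andP[t0 t1]]; first by rewrite addr_ge0// mulr_ge0.
rewrite /= /step_fun t0 t1/=.
have mt0 : 0 <= m%:R * t by rewrite mulr_ge0.
have /andP[j1 j2] := truncn_itv mt0.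
set J := Num.truncn (m%:R * t) in j1 j2.
have Jm : (J <= m)%N.
  rewrite -(ler_nat K) (le_trans j1)//.
  by rewrite -[leRHS]mulr1 ler_pM2l.
have xJ : `|x t - x (J%:R / m%:R)| <= e.
  move: Jm; rewrite leq_eqVlt => /predU1P[Jm|Jm].
    have -> : t = J%:R / m%:R.
      rewrite Jm divff ?gt_eqF//; apply/eqP; rewrite eq_le t1/=.
      by move: j1; rewrite Jm -[leLHS]mulr1 ler_pM2l.
    by rewrite subrr normr0.
  apply: (hx (Ordinal Jm)) => /=; rewrite ler_pdivrMr// mulrC j1/=.
  rewrite -[X in _ + X]mul1r -mulrDl ler_pdivlMr// mulrC natr1 ltW//.
have tele : x (J%:R / m%:R) = \sum_(i < m) (x (i.+1%:R / m%:R) - x (i%:R / m%:R)) * (i < J)%N%:R.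
  rewrite -(big_mkord predT (fun i => (x (i.+1%:R / m%:R) - x (i%:R / m%:R)) * (i < J)%N%:R)).
  rewrite (big_cat_nat (leq0n J) Jm)/= [X in _ + X]big_nat_cond [X in _ + X]big1 ?addr0; last first.
    by move=> i /andP[/andP[Ji _] _]; rewrite ltnNge Ji mulr0.
  rewrite big_nat_cond (eq_bigr (fun i => x (i.+1%:R / m%:R) - x (i%:R / m%:R))); last first.
    by move=> i /andP[/andP[_ ->] _]; rewrite mulr1.
  by rewrite -big_nat_cond (telescope_sumr (fun i => x (i%:R / m%:R)))// mul0r x0 subr0.
have ind (i : 'I_m) : (i.+1%:R / m%:R <= t) = (i < J)%N.
  rewrite ler_pdivrMr// mulrC; apply/idP/idP => h.
    by rewrite -ltnS -(ltr_nat K) (le_lt_trans h).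
  by rewrite (le_trans _ j1)// ler_nat.
under eq_bigr do rewrite ind.
rewrite -(subrKA (x (J%:R / m%:R))) (le_trans (ler_normD _ _))// lerD//.
rewrite tele -sumrB; under eq_bigr do rewrite -mulrBl.
rewrite (le_trans (ler_norm_sum _ _ _))//.
rewrite (@le_trans _ _ (\sum_(i < m) eta))//; last by rewrite sumr_const card_ord mulr_natl.
apply: ler_sum => i _; rewrite normrM -[leRHS]mulr1 ler_pM// normr_nat lern1.
by case: (i < J)%N.
Qed.

End step_paths.

(** * Functionals of quantized increments *)

Section quantization.
Context {K : realType} {d : measure_display} {T : measurableType d}.
Variable P : probability T K.
Variable X : T -> skorohod K.
Hypothesis statX : stationary_process P (fun t w => X w t).
Variables (m n : nat) (g : nat -> K) (eta : K).
Hypotheses (m0 : (0 < m)%N) (g_step : forall k, g k <= g k.+1 <= g k + eta).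

Let m0' : 0 < m%:R :> K. Proof. by rewrite ltr0n. Qed.

Definition step_increment (i : nat) (w : T) : K := X w (i.+1%:R / m%:R) - X w (i%:R / m%:R).

Let tm01 i : (i <= m)%N -> 0 <= (i%:R / m%:R : K) <= 1.
Proof. by move=> im; rewrite divr_ge0//= ler_pdivrMr// mul1r ler_nat. Qed.

Lemma measurable_step_increment i : (i < m)%N -> measurable_fun setT (step_increment i).
Proof.
by move=> im; apply: (measurable_increment P _ statX); apply: tm01 => //; exact: ltnW.
Qed.

Definition cell (c : {ffun 'I_m -> 'I_n}) : set T :=
  [set w | forall i : 'I_m, g (c i) < step_increment i w <= g (c i).+1].

Lemma measurable_cell c : measurable (cell c).
Proof.
rewrite (_ : cell c = \bigcap_(i in [set: 'I_m])
    [set w | g (c i) < step_increment i w <= g (c i).+1]); last first.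
  by apply/seteqP; split=> w /= h i; [move=> _; exact: h|exact: h].
apply: fin_bigcap_measurable => // i _; apply: measurable_rv_itv.
exact: measurable_step_increment.
Qed.

Lemma prob_step_increment i p q : (i < m)%N ->
  P [set w | p < step_increment i w <= q] = P [set w | p < X w m%:R^-1 <= q].
Proof.
move=> im; have mB : measurable (`]p, q]%classic : set K) by exact: measurable_itv.
have := stat_homogeneous _ _ statX (i%:R / m%:R) m%:R^-1 _ _ _ _ mB.
have -> : i%:R / m%:R + m%:R^-1 = i.+1%:R / m%:R :> K by rewrite -natr1 mulrDl mul1r.
have E (Z : T -> K) : [set w | `]p, q]%classic (Z w)] = [set w | p < Z w <= q].
  by apply/seteqP; split=> w /=; rewrite in_itv.
rewrite !E; apply; first by have /andP[] := tm01 i (ltnW im).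
  by rewrite invr_ge0.
by have /andP[] := tm01 i.+1 im.
Qed.

Notation p1 := (prob_itv P (fun w => X w m%:R^-1)).

(** The increments are independent and each is distributed as the value at time [1/m]. *)
Lemma prob_cell c : fine (P (cell c)) = \prod_(i < m) p1 (g (c i)) (g (c i).+1).
Proof.
have t01 i : (i <= m)%N -> `[0, 1]%classic (i%:R / m%:R : K).
  by move=> im; rewrite /= in_itv/=; exact: tm01.
have t_nd i : (i < m)%N -> i%:R / m%:R <= i.+1%:R / m%:R :> K.
  by move=> im; rewrite ler_pM2r ?invr_gt0// ler_nat.
have mB (i : 'I_m) : measurable (`]g (c i), g (c i).+1]%classic : set K) by exact: measurable_itv.
have := stat_independent _ _ statX m (fun i => i%:R / m%:R) t01 t_nd _ mB.
have E (Z : T -> K) p q : [set w | `]p, q]%classic (Z w)] = [set w | p < Z w <= q].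
  by apply/seteqP; split=> w /=; rewrite in_itv.
rewrite (_ : [set w | _] = cell c); last first.
  by apply/seteqP; split=> w /= h i; have := h i; rewrite /= in_itv.
move=> ->; rewrite (_ : (\prod_(i < m) p1 _ _) = fine (\prod_(i < m) p1 (g (c i)) (g (c i).+1))%:E)//.
congr fine; rewrite (big_morph EFin EFinM erefl); apply: eq_bigr => i _.
rewrite E (prob_step_increment i)//= fineK//; apply: fin_num_measure.
apply: measurable_rv_itv; apply: (stat_measurable _ _ statX).
by rewrite invr_ge0 ler0n invf_le1// ler1n.
Qed.

Let g_mono i j : (i <= j)%N -> g i <= g j.
Proof.
elim: j => [|j IH] in i *; first by rewrite leqn0 => /eqP->.
move=> ij; have [->//|ne] := eqVneq i j.+1.
apply: le_trans (IH i _) _; first by rewrite -ltnS ltn_neqAle ne.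
by have /andP[] := g_step j.
Qed.

Lemma grid_cover y : g 0%N < y <= g n -> exists k : 'I_n, g k < y <= g k.+1.
Proof.
move=> /andP[y0 yn].
have ex : exists k, y <= g k by exists n.
have [k yk kmin] := ex_minnP ex.
have k0 : (0 < k)%N by rewrite lt0n; apply: contraTneq yk => ->; rewrite -ltNge.
have kn : (k.-1 < n)%N by rewrite prednK// kmin.
exists (Ordinal kn) => /=; rewrite prednK// yk andbT ltNge; apply/negP => /kmin.
by rewrite leqNgt prednK// leqnn.
Qed.

Lemma cell_inj c c' w : cell c w -> cell c' w -> c = c'.
Proof.
move=> h h'; apply/ffunP => i; apply/val_inj; apply/eqP; rewrite eqn_leq; apply/andP.
have /andP[a1 a2] := h i; have /andP[b1 b2] := h' i.
split; rewrite leqNgt; apply/negP => lt.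
  by have := lt_le_trans (lt_le_trans a1 b2) (g_mono _ _ lt); rewrite ltxx.
by have := lt_le_trans (lt_le_trans b1 a2) (g_mono _ _ lt); rewrite ltxx.
Qed.

Variables (f : skorohod K -> K) (M k : K).
Hypothesis fM : forall x, `|f x| <= M.
Hypothesis k0 : 0 <= k.
Hypothesis fk : lipschitz_for f k.

(** The value of [f] on the step path of the increments rounded down to the grid, and
    [0] as soon as an increment is off the grid. *)
Definition quantized (w : T) : K :=
  \sum_(c : {ffun 'I_m -> 'I_n}) f (step_path m (fun i => g (c i))) * \1_(cell c) w.

Lemma quantized_cell c w : cell c w -> quantized w = f (step_path m (fun i => g (c i))).
Proof.
move=> cw; rewrite /quantized (bigD1 c)//= indicE mem_set// mulr1 big1 ?addr0// => c' cc'.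
rewrite indicE memNset ?mulr0// => c'w; move: cc'.
by rewrite (cell_inj _ _ _ c'w cw) eqxx.
Qed.

Lemma quantized_out w : (forall c, ~ cell c w) -> quantized w = 0.
Proof. by move=> h; rewrite /quantized big1// => c _; rewrite indicE memNset ?mulr0. Qed.

Let M0 : 0 <= M. Proof. by apply: le_trans (fM (step_path 0 (fun=> 0))). Qed.

Lemma quantized_bounded w : `|quantized w| <= M.
Proof.
have [[c cw]|h] := pselect (exists c, cell c w).
  by rewrite (quantized_cell c).
by rewrite quantized_out ?normr0// => c cw; apply: h; exists c.
Qed.

Lemma measurable_quantized : measurable_fun setT quantized.
Proof.
apply: measurable_sum => c; apply: measurable_funM => //.
by apply: measurable_indic; exact: measurable_cell.
Qed.

Lemma mean_quantized : \int[P]_w quantized w =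
  \sum_(c : {ffun 'I_m -> 'I_n}) f (step_path m (fun i => g (c i))) *
     \prod_(i < m) p1 (g (c i)) (g (c i).+1).
Proof.
have ic (c : {ffun 'I_m -> 'I_n}) : P.-integrable setT (EFin \o (fun w => f (step_path m (fun i => g (c i))) * \1_(cell c) w)).
  exact: (integrableZl measurableT _ (integrable_indic_prob P _ (measurable_cell c))).
rewrite /Rintegral /quantized; under eq_integral do rewrite -sumEFin.
rewrite integral_sum//=.
rewrite -EFin_sum_fine; last by move=> c _; exact: (integrable_fin_num measurableT (ic c)).
rewrite /=; apply: eq_bigr => c _; rewrite -/(Rintegral _ _ _) RintegralZl//.
  by rewrite mean_indic ?prob_cell//; exact: measurable_cell.
exact: (integrable_indic_prob P _ (measurable_cell c)).
Qed.

Lemma quantized_close e w : 0 <= e ->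
  (forall i : 'I_m, g 0%N < step_increment i w <= g n) ->
  (forall i : 'I_m, forall t, i%:R / m%:R <= t <= i%:R / m%:R + m%:R^-1 ->
    `|X w t - X w (i%:R / m%:R)| <= e) ->
  `|f (X w) - quantized w| <= k * (e + m%:R * eta).
Proof.
move=> e0 hinc hosc.
have /choice[c hc] : forall i : 'I_m, exists j : 'I_n, g j < step_increment i w <= g j.+1.
  by move=> i; exact: grid_cover.
have cw : cell (finfun c) w by move=> i; rewrite ffunE.
rewrite (quantized_cell _ _ cw) (le_trans (fk _ _))// ler_wpM2l//.
apply: step_path_close => //.
- by have /andP[h1 h2] := g_step 0; rewrite -(lerD2l (g 0%N)) addr0 (le_trans h1 h2).
- exact: (stat_start _ _ statX).
- move=> i; rewrite ffunE -/(step_increment i w); have /andP[h1 h2] := hc i.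
  rewrite ger0_norm ?subr_ge0 ?(ltW h1)// lerBlDl (le_trans h2)//.
  by have /andP[] := g_step (c i).
Qed.

(** The exceptional event is that some block sees an oscillation above [2 e] or some
    increment is off the grid; there the two functions differ by at most [2 M]. *)
Lemma mean_quantized_close e : 0 < e ->
  (forall t, 0 <= t <= m%:R^-1 -> fine (P [set w | e < `|X w t|]) <= 2^-1) ->
  `|\int[P]_w f (X w) - \int[P]_w quantized w| <=
    k * (e *+ 2 + m%:R * eta) + (M *+ 2) *
     (m%:R * (2 * (1 - p1 (- e) e) + (1 - p1 (g 0%N) (g n)))).
Proof.
move=> e0 half.
have m1 : m%:R^-1 <= 1 :> K by rewrite invf_le1// ler1n.
have mV0 : 0 < m%:R^-1 :> K by rewrite invr_gt0.
have mX : measurable_fun setT (fun w => X w m%:R^-1).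
  by apply: (stat_measurable _ _ statX); rewrite ltW.
have block i := @block_oscillation _ _ _ P _ statX (i%:R / m%:R) m%:R^-1 e.
have /choice[U hU] : forall i : 'I_m, exists U : set T, [/\ measurable U,
    fine (P U) <= 2 * fine (P [set w | e < `|X w m%:R^-1|]) &
    forall w, ~ U w -> forall t, i%:R / m%:R <= t <= i%:R / m%:R + m%:R^-1 ->
      `|X w t - X w (i%:R / m%:R)| <= e *+ 2].
  move=> i; apply: block => //.
  rewrite -[X in _ + X]mul1r -mulrDl natr1.
  by have /andP[] := tm01 i.+1 (ltn_ord i).
pose N (i : 'I_m) := ~` [set w | g 0%N < step_increment i w <= g n].
have mN i : measurable (N i).
  by apply: measurableC; apply: measurable_rv_itv; exact: measurable_step_increment.
have mU i : measurable (U i) by have [] := hU i.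
have pE p q : fine (P (~` [set w | p < X w m%:R^-1 <= q])) = 1 - p1 p q.
  rewrite probability_setC ?fineB//; first by apply: fin_num_measure; exact: measurable_rv_itv.
  exact: measurable_rv_itv.
have PN i : fine (P (N i)) = 1 - p1 (g 0%N) (g n).
  rewrite /N probability_setC; last by apply: measurable_rv_itv; exact: measurable_step_increment.
  rewrite fineB//; first by rewrite prob_step_increment.
  by apply: fin_num_measure; apply: measurable_rv_itv; exact: measurable_step_increment.
have PU i : fine (P (U i)) <= 2 * (1 - p1 (- e) e).
  have [_ h _] := hU i; apply: le_trans h _; rewrite ler_pM2l// -pE fine_le//.
  - by apply: fin_num_measure; exact: measurable_norm_gt.
  - by apply: fin_num_measure; apply: measurableC; exact: measurable_rv_itv.
  - apply: le_measure; rewrite ?inE.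
    + exact: measurable_norm_gt.
    + by apply: measurableC; exact: measurable_rv_itv.
    + move=> w /= eX /andP[X1 X2]; move: eX; apply/negP; rewrite -leNgt ler_norml X2.
      by rewrite ltW.
pose B := \big[setU/set0]_(i < m) (U i `|` N i).
have mB : measurable B by apply: bigsetU_measurable => i _; exact: measurableU.
have PB : fine (P B) <= m%:R * (2 * (1 - p1 (- e) e) + (1 - p1 (g 0%N) (g n))).
  have [_ sub] : measurable B /\ (P B <= \sum_(i < m) (P (U i) + P (N i)))%E.
    apply: (big_ind2 (fun A x => measurable A /\ (P A <= x)%E)).
    - by rewrite measure0.
    - move=> A1 x1 A2 x2 [mA1 h1] [mA2 h2]; split; first exact: measurableU.
      by rewrite (le_trans (measureU2 _ _ _))// leeD.
    - by move=> i _; split; [exact: measurableU|exact: measureU2].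
  have fU i : P (U i) \is a fin_num by exact: fin_num_measure.
  have fN i : P (N i) \is a fin_num by exact: fin_num_measure.
  apply: (@le_trans _ _ (\sum_(i < m) (fine (P (U i)) + fine (P (N i))))).
    rewrite -lee_fin fineK; last exact: fin_num_measure.
    apply: le_trans sub _; rewrite -sumEFin lee_sum// => i _.
    by rewrite EFinD !fineK.
  rewrite mulr_natl -[X in _ *+ X]card_ord -sumr_const ler_sum// => i _.
  by rewrite lerD// PN.
apply: (@le_trans _ _ (k * (e *+ 2 + m%:R * eta) + (M *+ 2) * fine (P B))); last first.
  by rewrite lerD2l ler_wpM2l// mulrn_wge0.
have eta0 : 0 <= eta.
  by have /andP[h1 h2] := g_step 0; rewrite -(lerD2l (g 0%N)) addr0 (le_trans h1 h2).
have c0 : 0 <= k * (e *+ 2 + m%:R * eta).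
  by rewrite mulr_ge0// addr_ge0 ?mulr_ge0 ?mulrn_wge0// ltW.
apply: (@mean_close _ _ _ P _ _ M M) => //.
- exact: measurable_quantized.
- exact: quantized_bounded.
- by rewrite mulrn_wge0.
move=> w; rewrite indicE; have [wB|wB] := boolP (_ \in _).
  rewrite mulr1 (le_trans (ler_normB _ _))// -[leLHS]add0r lerD// mulr2n lerD//.
  exact: quantized_bounded.
rewrite mulr0 addr0; move: wB; rewrite notin_setE => wB.
apply: quantized_close; first by rewrite mulrn_wge0// ltW.
- move=> i; apply: contrapT => h; apply: wB.
  by rewrite /B (bigD1 i)//=; left; right.
- move=> i t ti; have [_ _ h] := hU i; apply: h => // Ow; apply: wB.
  by rewrite /B (bigD1 i)//=; left; left.
Qed.

End quantization.

(** * A functional limit theorem for stationary increments *)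

Section functional_limit.
Context {K : realType}.

Lemma uniform_continuity01 (y : K -> K) (e : K) : {within `[0, 1], continuous y} -> 0 < e ->
  \forall dl \near (0 : K)^'+, forall s t : K, 0 <= s <= 1 -> 0 <= t <= 1 ->
    `|t - s| < dl -> `|y t - y s| <= e.
Proof.
move=> cy e0.
have /compact_near_coveringP cov := @segment_compact K 0 1.
have H : \forall dl \near (0 : K)^'+, `[0, 1]%classic `<=` (fun s => 0 <= s <= 1 ->
    forall t, 0 <= t <= 1 -> `|t - s| < dl -> `|y t - y s| <= e).
  apply: cov => x; rewrite /= in_itv/= => x01.
  have e20 : 0 < e / 2 by rewrite divr_gt0.
  move: cy => /subspace_continuousP/(_ x); rewrite /= in_itv/= => /(_ x01).
  move/cvgrPdist_le/(_ _ e20); rewrite near_withinE => Hx.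
  have [r /= r0 Hr] := (iffLR (nbhs_ballP _ _)) Hx.
  have r20 : 0 < r / 2 by rewrite divr_gt0.
  have hr u : `|u - x| < r -> 0 <= u <= 1 -> `|y x - y u| <= e / 2.
    by move=> ur u01; apply: Hr; rewrite /ball/= ?in_itv//= distrC.
  exists (ball x (r / 2), [set dl | dl < r / 2]) => /=.
    by split; [exact: nbhsx_ballx|exact: nbhs_right_lt].
  move=> [s dl] /= [xs dlr] s01 t t01 ts.
  have sx : `|s - x| < r / 2 by rewrite distrC.
  have h1 : `|y x - y s| <= e / 2 by apply: hr => //; apply: lt_trans sx _; rewrite ltr_pdivrMr// ltr_pMr// ltr1n.
  have h2 : `|y x - y t| <= e / 2.
    apply: hr => //; rewrite -(subrKA s) (splitr r) (le_lt_trans (ler_normD _ _))// ltrD//.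
    exact: lt_trans ts dlr.
  by rewrite -(subrKA (y x)) (splitr e) (le_trans (ler_normD _ _))// lerD// distrC.
apply: filterS H => dl H s t s01 t01 ts; apply: (H s) => //=.
Qed.

(** Linear in [t]: over a time [1/m] the characteristic function is within [O(1/m)] of
    [1], as the truncation inequality asks. *)
Lemma one_sub_exp_cos_le (t a b : K) : 0 <= t -> a <= 0 ->
  1 - expR (t * a) * cos (t * b) <= t * (`|a| + `|b|).
Proof.
move=> t0 a0; have ta0 : t * a <= 0 by rewrite mulr_ge0_le0.
have h1 := expR_ge1Dx (t * a).
have h2 : expR (t * a) * (1 - cos (t * b)) <= t * `|b|.
  rewrite -[leRHS]mul1r ler_pM ?expR_ge0 ?subr_ge0 ?cos_le1//.
    by rewrite -expR0 ler_expR.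
  by rewrite (le_trans (ler_norm _))// (le_trans (norm_1Bcos_le _))// normrM ger0_norm.
rewrite (ler0_norm a0); lra.
Qed.

Context {d : measure_display} {T : measurableType d} (P : probability T K).
Context {d' : measure_display} {T' : measurableType d'} (P' : probability T' K).
Variables (X : nat -> T -> skorohod K) (Y : T' -> skorohod K).
Variables (al be : nat -> K -> K) (v C : K).
Hypotheses (statX : forall n, stationary_process P (fun t w => X n w t))
  (statY : stationary_process P' (fun t w => Y w t)).
Hypothesis cosX : forall n (u t : K), 0 <= t <= 1 ->
  \int[P]_w cos (u * X n w t) = expR (t * al n u) * cos (t * be n u).
Hypothesis sinX : forall n (u t : K), 0 <= t <= 1 ->
  \int[P]_w sin (u * X n w t) = expR (t * al n u) * sin (t * be n u).
Hypothesis cosY : forall u t : K, 0 <= t <= 1 ->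
  \int[P']_w cos (u * Y w t) = expR (t * - (v * u ^+ 2 / 2)).
Hypothesis sinY : forall u t : K, 0 <= t <= 1 -> \int[P']_w sin (u * Y w t) = 0.
Hypotheses (v0 : 0 <= v) (C0 : 0 <= C).
Hypothesis al_le0 : forall n u, al n u <= 0.
Hypothesis al_cvg : forall u, al n u @[n --> \oo] --> - (v * u ^+ 2 / 2).
Hypothesis be_cvg : forall u, be n u @[n --> \oo] --> (0 : K).
Hypothesis exponent_bound :
  \forall n \near \oo, forall u, `|al n u| + `|be n u| <= C * (1 + u ^+ 2).
Hypothesis Y_continuous : forall w, {within `[0, 1], continuous (Y w)}.
Hypothesis Y_atom : forall t x : K, 0 < t <= 1 -> x != 0 -> P' [set w | Y w t = x] = 0%E.
Hypothesis Y_tail : forall e : K, 0 < e ->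
  m%:R * (1 - prob_itv P' (fun w => Y w m%:R^-1) (- e) e) @[m --> \oo] --> (0 : K).

Let half_small e : 0 < e -> \forall m \near \oo, 
  (\forall n \near \oo, forall t, 0 <= t <= m%:R^-1 ->
    fine (P [set w | e < `|X n w t|]) <= 2^-1) /\
  (forall t, 0 <= t <= m%:R^-1 -> fine (P' [set w | e < `|Y w t|]) <= 2^-1).
Proof.
move=> e0.
have Cv0 : 0 <= C + v by rewrite addr_ge0.
have := tail_le_half e (C + v) e0 Cv0.
move=> H; near=> m.
have m0 : (0 < m)%N by near: m; exact: nbhs_infty_gt.
have m0' : 0 < m%:R :> K by rewrite ltr0n.
have m1 : m%:R^-1 <= 1 :> K by rewrite invf_le1// ler1n.
have Hm : forall (d : measure_display) (T : measurableType d)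
    (P : probability T K) (X : T -> K), measurable_fun setT X ->
    (forall u, 1 - \int[P]_w cos (u * X w) <= (C + v) * (1 + u ^+ 2) / m%:R) ->
    fine (P [set w | e < `|X w|]) <= 2^-1 by near: m.
have u20 (u : K) : 0 <= 1 + u ^+ 2 by rewrite addr_ge0 ?sqr_ge0.
split; last first.
  move=> t /andP[t0 tm]; apply: Hm => [|u].
    by apply: (stat_measurable _ _ statY); rewrite t0 (le_trans tm m1).
  rewrite cosY ?t0 ?(le_trans tm m1)//.
  have w0 : 0 <= v * u ^+ 2 / 2 by rewrite divr_ge0// mulr_ge0 ?sqr_ge0.
  have := one_sub_exp_cos_le t (- (v * u ^+ 2 / 2)) 0 t0 _.
  rewrite oppr_le0 mulr0 cos0 mulr1 normr0 addr0 normrN (ger0_norm w0) => /(_ w0)/le_trans; apply.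
  rewrite [leRHS]mulrC ler_pM//.
  have := mulr_ge0 C0 (sqr_ge0 u); rewrite mulrDl !mulrDr !mulr1; lra.
have := exponent_bound; apply: filterS => n hn t /andP[t0 tm].
apply: Hm => [|u]; first by apply: (stat_measurable _ _ (statX n)); rewrite t0 (le_trans tm m1).
rewrite cosX ?t0 ?(le_trans tm m1)// (le_trans (one_sub_exp_cos_le _ _ _ _ _))//.
rewrite [leRHS]mulrC ler_pM ?addr_ge0//.
by rewrite (le_trans (hn u))// ler_wpM2r// lerDl.
Unshelve. all: end_near. Qed.

(** The points [p] and [q] avoid [0], the only possible atom of the limit. *)
Let itv_cvg t p q : 0 < t <= 1 -> p < q -> p != 0 -> q != 0 ->
  prob_itv P (fun w => X n w t) p q @[n --> \oo] --> prob_itv P' (fun w => Y w t) p q.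
Proof.
move=> /andP[t0 t1] pq p0 q0; have t01 : 0 <= t <= 1 by rewrite (ltW t0).
have expc u : expR (t * al n u) @[n --> \oo] --> expR (t * - (v * u ^+ 2 / 2)).
  by apply: continuous_cvg; [exact: continuous_expR|apply: cvgMl_tmp; exact: al_cvg].
have bec u : t * be n u @[n --> \oo] --> (0 : K).
  by rewrite -[X in _ --> X](mulr0 t); apply: cvgMl_tmp; exact: be_cvg.
apply: cvg_prob_itv => //.
- by move=> n; exact: (stat_measurable _ _ (statX n)).
- exact: (stat_measurable _ _ statY).
- move=> u; rewrite cosY//; under eq_fun do rewrite cosX//.
  have c : cos (t * be n u) @[n --> \oo] --> cos (0 : K).
    by apply: continuous_cvg; [exact: continuous_cos|exact: bec].
  have := cvgM (expc u) c; rewrite cos0 mulr1; exact.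
- move=> u; rewrite sinY//; under eq_fun do rewrite sinX//.
  have c : sin (t * be n u) @[n --> \oo] --> sin (0 : K).
    by apply: continuous_cvg; [exact: continuous_sin|exact: bec].
  have := cvgM (expc u) c; rewrite sin0 mulr0; exact.
- by apply: Y_atom; rewrite ?t0.
- by apply: Y_atom; rewrite ?t0.
Qed.

(** The half-integer offset keeps the grid away from [0], where the limit has an atom
    when its variance vanishes. *)
Let grid (eta : K) (N k : nat) : K := eta * (k%:R - N%:R + 2^-1).

Let grid_step eta N k : 0 <= eta -> grid eta N k <= grid eta N k.+1 <= grid eta N k + eta.
Proof.
by move=> eta0; rewrite /grid -natr1; apply/andP; split; nra.
Qed.

Let grid_lt eta N k : 0 < eta -> grid eta N k < grid eta N k.+1.
Proof. by move=> eta0; rewrite /grid ltr_pM2l// -natr1; lra. Qed.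

Let grid_neq0 eta N k : 0 < eta -> grid eta N k != 0.
Proof.
move=> eta0; apply: mulf_neq0; first by rewrite gt_eqF.
apply/eqP => E.
have : (k.*2.+1)%:R = (N.*2)%:R :> K by rewrite -natr1 -!muln2 !natrM; lra.
move/eqP; rewrite eqr_nat => /eqP/(congr1 odd); rewrite /= !odd_double.
by [].
Qed.

Let grid_lt0 eta N : 0 < eta -> (0 < N)%N -> grid eta N 0 < grid eta N (2 * N).
Proof.
move=> eta0 N0; rewrite /grid ltr_pM2l// natrM.
have : 0 < N%:R :> K by rewrite ltr0n.
by lra.
Qed.

Let mass_cvg1 (Z : T' -> K) eta : 0 < eta -> measurable_fun setT Z ->
  prob_itv P' Z (grid eta N 0) (grid eta N (2 * N)) @[N --> \oo] --> (1 : K).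
Proof.
move=> eta0 mZ; rewrite -[X in _ --> X](mean_cst P').
under eq_fun do rewrite prob_itvE//.
apply: (@Rintegral_dominated_cvg _ _ _ P' _ _ _ (cst 1)) => //.
- by move=> N; apply: measurable_indic; exact: measurable_rv_itv.
- by apply: (@bounded_integrable _ _ _ _ _ 1) => // w; rewrite normr1.
- move=> w _; apply: cvg_near_cst; near=> N.
  rewrite indicE mem_set// /grid/= natrM.
  have : `|Z w| / eta + 1 < N%:R by near: N; exact: nbhs_infty_gtr.
  rewrite -ltrBrDr ltr_pdivrMr// ltr_norml => /andP[h1 h2].
  by apply/andP; split; nra.
- by move=> N w _; exact: indic_le1.
Unshelve. all: end_near. Qed.

(** The order of choices matters: [e] for the Lipschitz constant, then [m] for the
    Gaussian tails at time [1/m], then the mesh [eta] and the range [N] of the grid,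
    and [n] last, for the finitely many interval probabilities that are left. *)
Let lipschitz_mean (f : skorohod K -> K) M k : 0 <= k -> (forall x, `|f x| <= M) ->
  lipschitz_for f k -> \int[P]_w f (X n w) @[n --> \oo] --> \int[P']_w f (Y w).
Proof.
move=> k0 fM fk; apply/cvgrPdist_le => e0 e00.
have M0 : 0 <= M by apply: le_trans (fM (step_path 0 (fun=> 0))).
pose dl := e0 / 16; have dl0 : 0 < dl by rewrite divr_gt0.
have k1 : 0 < k + 1 by rewrite ltr_wpDl.
pose e := dl / (2 * (k + 1)); have eg0 : 0 < e by rewrite divr_gt0// mulr_gt0.
have ke : k * (e *+ 2) <= dl.
  rewrite /e -mulr_natr.
  have -> : k * (dl / (2 * (k + 1)) * 2) = dl * (k / (k + 1)) by field; rewrite gt_eqF.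
  by rewrite ler_piMr ?(ltW dl0)// ler_pdivrMr// mul1r lerDl.
have tail : \forall m \near \oo, M *+ 2 * (m%:R * (2 * (1 - prob_itv P' (fun w => Y w m%:R^-1) (- e) e))) <= dl.
  have c : (M *+ 2 * 2) * (m%:R * (1 - prob_itv P' (fun w => Y w m%:R^-1) (- e) e))
      @[m --> \oo] --> (0 : K).
    by rewrite -[X in _ --> X](mulr0 (M *+ 2 * 2)); apply: cvgMl_tmp; exact: Y_tail.
  move/cvgr0_norm_le : c => /(_ _ dl0); apply: filterS => m.
  apply: le_trans; rewrite (le_trans _ (ler_norm _))//.
  by rewrite -mulrA (mulrCA 2).
have [m [m0 [half_X half_Y] tail_m]] : exists m : nat, [/\ (0 < m)%N,
    (\forall n \near \oo, forall t, 0 <= t <= m%:R^-1 ->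
      fine (P [set w | e < `|X n w t|]) <= 2^-1) /\
    (forall t, 0 <= t <= m%:R^-1 -> fine (P' [set w | e < `|Y w t|]) <= 2^-1) &
    M *+ 2 * (m%:R * (2 * (1 - prob_itv P' (fun w => Y w m%:R^-1) (- e) e))) <= dl].
  have := nbhs_infty_gt 0; have := half_small e eg0; move: tail.
  move=> h1 h2 h3.
  have [m _ /(_ m (leqnn m)) /= [? [? ?]]] := filterI h3 (filterI h2 h1).
  by exists m; split.
have m0' : 0 < m%:R :> K by rewrite ltr0n.
have t01 : 0 < (m%:R^-1 : K) <= 1 by rewrite invr_gt0 m0' invf_le1// ler1n.
pose eta := dl / ((k + 1) * m%:R); have eta0 : 0 < eta by rewrite divr_gt0// mulr_gt0.
have keta : k * (m%:R * eta) <= dl.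
  rewrite /eta.
  have -> : k * (m%:R * (dl / ((k + 1) * m%:R))) = dl * (k / (k + 1)).
    by field; rewrite !gt_eqF.
  by rewrite ler_piMr ?(ltW dl0)// ler_pdivrMr// mul1r lerDl.
pose pX n := prob_itv P (fun w => X n w m%:R^-1); pose pY := prob_itv P' (fun w => Y w m%:R^-1).
have mYm : measurable_fun setT (fun w => Y w m%:R^-1).
  by apply: (stat_measurable _ _ statY); case/andP: t01 => /ltW-> ->.
have [N [N0 massN]] : exists N : nat, (0 < N)%N /\
    M *+ 2 * (m%:R * (1 - pY (grid eta N 0) (grid eta N (2 * N)))) <= dl.
  have c : M *+ 2 * (m%:R * (1 - pY (grid eta N 0) (grid eta N (2 * N)))) @[N --> \oo] --> (0 : K).
    rewrite -[X in _ --> X](mulr0 (M *+ 2)); apply: cvgMl_tmp.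
    rewrite -[X in _ --> X](mulr0 m%:R); apply: cvgMl_tmp.
    rewrite -[X in _ --> X](subrr 1); apply: cvgB; first exact: cvg_cst.
    exact: mass_cvg1.
  move/cvgr0_norm_le : c => /(_ _ dl0) h1.
  have [N _ /(_ N (leqnn N)) /= [? h]] := filterI (nbhs_infty_gt 0) h1.
  by exists N; split=> //; exact: le_trans (ler_norm _) h.
pose g := grid eta N.
have gs j : g j <= g j.+1 <= g j + eta by apply: grid_step; exact: ltW.
pose err p := k * (e *+ 2 + m%:R * eta) + M *+ 2 * (m%:R * (2 * (1 - p (- e) e) + (1 - p (g 0%N) (g (2 * N)%N)))).
have errY : err pY <= 4 * dl.
  rewrite /err !mulrDr; move: tail_m massN; rewrite -/pY -/g; lra.
have errc : err (pX n) @[n --> \oo] --> err pY.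
  apply: cvgD; first exact: cvg_cst.
  apply: cvgMl_tmp; apply: cvgMl_tmp; apply: cvgD.
    apply: cvgMl_tmp; apply: cvgB; first exact: cvg_cst.
    apply: itv_cvg => //; first by lra.
      by rewrite oppr_eq0 gt_eqF.
    by rewrite gt_eqF.
  apply: cvgB; first exact: cvg_cst.
  by apply: itv_cvg => //; [exact: grid_lt0|exact: grid_neq0..].
pose qX n := \int[P]_w quantized (X n) m (2 * N) g f w.
pose qY := \int[P']_w quantized Y m (2 * N) g f w.
have qc : qX n @[n --> \oo] --> qY.
  rewrite /qX /qY (mean_quantized _ _ statY)//.
  under eq_fun do rewrite (mean_quantized _ _ (statX _))//.
  apply: cvg_big => [|c _]; first exact: add_continuous.
  apply: cvgMl_tmp; apply: cvg_big => [|i _]; first exact: mul_continuous.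
  by apply: itv_cvg => //; [exact: grid_lt|exact: grid_neq0..].
have hY : `|\int[P']_w f (Y w) - qY| <= err pY.
  apply: (mean_quantized_close P' Y statY m (2 * N) g eta) => //.
near=> n.
have hX : `|\int[P]_w f (X n w) - qX n| <= err (pX n).
  apply: (mean_quantized_close P (X n) (statX n) m (2 * N) g eta) => //.
  by near: n.
have h1 : `|err pY - err (pX n)| <= dl.
  by near: n; move/cvgrPdist_le : errc; apply.
have h2 : `|qY - qX n| <= dl.
  by near: n; move/cvgrPdist_le : qc; apply.
have e0E : e0 = 16 * dl by rewrite /dl; field.
move: hX hY h1 h2; rewrite !ler_distl => /andP[? ?] /andP[? ?] /andP[? ?] /andP[? ?].
by rewrite e0E; apply/andP; split; lra.
Unshelve. all: end_near. Qed.

(** The functional of [Y] is a pointwise limit of functionals of quantized increments.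
    With mesh [(m + 1)^-2] the rounding errors add up to [1 / (m + 1)], and
    [2 (m + 1)^3] cells reach out to about [m + 1], which exceeds the increments of any
    given path for large [m]. *)
Let measurable_lipschitz_target (f : skorohod K -> K) M k : 0 <= k -> (forall x, `|f x| <= M) ->
  lipschitz_for f k -> measurable_fun setT (f \o Y).
Proof.
move=> k0 fM fk.
pose g (m : nat) := grid ((m.+1%:R ^+ 2)^-1) (m.+1 ^ 3).
pose S (m : nat) := quantized Y m.+1 (2 * m.+1 ^ 3) (g m) f.
have mS m : measurable_fun setT (S m) by exact: (measurable_quantized P' Y statY).
apply: (measurable_fun_cvg mS) => w _ /=.
apply/cvgrPdist_le => e e0.
have [B hB] := cadlag01_bounded (path_cadlag (Y w)).
have k1 : 0 < k + 1 by rewrite ltr_wpDl.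
pose e' := e / (2 * (k + 1)); have e'0 : 0 < e' by rewrite divr_gt0// mulr_gt0.
have ke : k * (e' + e') <= e.
  have -> : k * (e' + e') = e * (k / (k + 1)) by rewrite /e'; field; rewrite gt_eqF.
  by rewrite ler_piMr ?(ltW e0)// ler_pdivrMr// mul1r lerDl.
have [dl [Hdl dl0]] := filter_ex (filterI (uniform_continuity01 (Y w) e' (Y_continuous w) e'0)
  (nbhs_right_gt 0)).
have inv0 : (m.+1%:R)^-1 @[m --> \oo] --> (0 : K) by exact: cvg_harmonic.
near=> m.
have m0 : 0 < m.+1%:R :> K by rewrite ltr0n.
have sm1 : m.+1%:R^-1 <= e' :> K.
  rewrite (le_trans (ler_norm _))//; near: m.
  by move/cvgr0_norm_le : inv0; apply.
have sm2 : m.+1%:R^-1 < dl :> K.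
  rewrite (le_lt_trans (ler_norm _))//; near: m.
  by move/cvgr0_norm_lt : inv0; apply.
have mB : B + B + 1 <= m.+1%:R.
  rewrite (@le_trans _ _ m%:R) ?ler_nat//; near: m.
  by apply: nbhs_infty_ger; exact: num_real.
apply: le_trans ke.
have tm01 i : (i <= m.+1)%N -> 0 <= (i%:R / m.+1%:R : K) <= 1.
  by move=> im; rewrite divr_ge0//= ler_pdivrMr// mul1r ler_nat.
have q0 : 0 < (m.+1%:R ^+ 2)^-1 :> K by rewrite invr_gt0 exprn_gt0.
apply: (@le_trans _ _ (k * (e' + m.+1%:R * (m.+1%:R ^+ 2)^-1))); last first.
  rewrite ler_wpM2l// lerD2l expr2 invfM mulrA mulfV ?mul1r//.
apply: (quantized_close P' Y statY m.+1 (2 * m.+1 ^ 3) (g m)) => //.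
- by move=> j; apply: grid_step; exact: ltW.
- exact: ltW.
- move=> i; have : `|step_increment Y m.+1 i w| <= B + B.
    rewrite (le_trans (ler_normB _ _))// lerD//; apply: hB; apply: tm01 => //.
    exact: ltnW.
  rewrite ler_norml => /andP[h1 h2].
  have E : (m.+1%:R ^+ 2)^-1 * (m.+1 ^ 3)%:R = m.+1%:R :> K.
    by rewrite natrX exprS mulrCA mulVf ?mulr1// expf_neq0// gt_eqF.
  have q1 : (m.+1%:R ^+ 2)^-1 <= 1 :> K.
    by rewrite invf_le1 ?exprn_gt0// exprn_ege1// ler1n.
  rewrite /g /grid natrM.
  apply/andP; split.
    apply: lt_le_trans h1.
    rewrite mulr0n sub0r mulrDr mulrN E.
    by move: mB q1; set z : K := m.+1%:R; set y := z ^- 2; lra.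
  apply: (le_trans h2).
  rewrite mulrDr mulrBr mulrCA E.
  by move: mB q0; set z : K := m.+1%:R; set y := z ^- 2; lra.
- move=> i t /andP[t1 t2].
  have /andP[a0 a1] := tm01 i (ltnW (ltn_ord i)).
  have /andP[b0 b1] := tm01 i.+1 (ltn_ord i).
  have tb : t <= i.+1%:R / m.+1%:R by rewrite -natr1 mulrDl mul1r.
  apply: Hdl; rewrite ?a0 ?a1 ?(le_trans a0 t1) ?(le_trans tb b1)//.
  by rewrite ger0_norm ?subr_ge0// (le_lt_trans _ sm2)// lerBlDl.
Unshelve. all: end_near. Qed.

Theorem cvg_in_distribution_stationary : cvg_in_distribution P X P' Y.
Proof.
apply: lipschitz_cvg_in_distribution.
- exact: measurable_lipschitz_target.
- exact: lipschitz_mean.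
Qed.

End functional_limit.

(** * The Fourier transform and the tails of the normal law *)

Section gaussian_transform.
Context {K : realType}.
Notation mu := (@lebesgue_measure K).
Variables (s : K).
Hypothesis s0 : 0 < s.

Let p : K -> K := normal_pdf 0 s.

Let pE x : p x = normal_peak s * expR (- (2 * s ^+ 2)^-1 * x ^+ 2).
Proof.
rewrite /p normal_pdfE ?gt_eqF// /normal_fun subr0; congr (_ * expR _).
by rewrite mulNr mulrC mulr_natl mulNr.
Qed.

Let p_ge0 x : 0 <= p x. Proof. exact: normal_pdf_ge0. Qed.

Let mp : measurable_fun setT p. Proof. exact: measurable_normal_pdf. Qed.

Let ip : mu.-integrable setT (EFin \o p). Proof. exact: integrable_normal_pdf. Qed.

Let is_derive_p x : is_derive x (1 : K) p (- (s ^- 2) * x * p x).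
Proof.
pose q (x : K) := - (2 * s ^+ 2)^-1 * x ^+ 2.
have -> : p = normal_peak s \*: (expR \o q) by apply/funext => y; rewrite pE.
have d1 : is_derive x (1 : K) q (- (s ^- 2) * x).
  rewrite (_ : q = - (2 * s ^+ 2)^-1 \*: (fun x : K => x ^+ 2)); last by [].
  apply: is_derive_eq; rewrite /GRing.scale/=; field.
  by rewrite gt_eqF.
have d2 : is_derive x (1 : K) (expR \o q) (expR (q x) * (- (s ^- 2) * x)).
  exact: is_derive1_comp.
by apply: is_derive_eq; rewrite -[X in _ = _ * X]/(normal_peak s * expR (q x)) /GRing.scale/=; ring.
Qed.

Let p_continuous : continuous p.
Proof. by apply: continuous_normal_pdf; rewrite gt_eqF. Qed.

Let wide : K := s * Num.sqrt 2.

Let wide0 : wide != 0. Proof. by rewrite mulf_neq0 ?gt_eqF// sqrtr_gt0. Qed.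

Let s2 : 0 < s ^+ 2. Proof. by rewrite exprn_gt0. Qed.

(** The exponent is halved: one half is left as a factor, the other is the density of
    twice the variance. *)
Let p_split x : p x = Num.sqrt 2 * expR (- (x ^+ 2 / (4 * s ^+ 2))) * normal_pdf 0 wide x.
Proof.
have -> : p x = normal_peak s * expR (- (2 * s ^+ 2)^-1 * x ^+ 2) by exact: pE.
have -> : normal_peak s = Num.sqrt 2 * normal_peak wide.
  rewrite /normal_peak /wide exprMn sqr_sqrtr//.
  have -> : (s ^+ 2 * 2 * pi) *+ 2 = 2 * ((s ^+ 2 * pi) *+ 2) by rewrite !mulr2n; ring.
  by rewrite sqrtrM// invfM mulrA mulfV ?mul1r// gt_eqF// sqrtr_gt0.
rewrite normal_pdfE// /normal_fun subr0 exprMn sqr_sqrtr//.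
set y := x ^+ 2 / (4 * s ^+ 2).
have -> : - x ^+ 2 / ((s ^+ 2 * 2) *+ 2) = - y.
  by rewrite /y -mulr_natr; field; rewrite gt_eqF.
have -> : - (2 * s ^+ 2)^-1 * x ^+ 2 = - y - y.
  by rewrite /y; field; rewrite gt_eqF.
by rewrite expRD; ring.
Qed.

Let moment_const : K := (1 + 4 * s ^+ 2) * Num.sqrt 2.

Let moment_const_ge0 : 0 <= moment_const.
Proof. by rewrite mulr_ge0 ?sqrtr_ge0// addr_ge0// mulr_ge0// ltW. Qed.

(** The factor in [p_split] absorbs [|x|]. *)
Let p_moment x : `|x| * p x <= moment_const * normal_pdf 0 wide x.
Proof.
rewrite p_split (mulrA `|x|) ler_wpM2r ?normal_pdf_ge0// mulrCA.
rewrite /moment_const [leRHS]mulrC ler_wpM2l ?sqrtr_ge0//.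
set y := x ^+ 2 / (4 * s ^+ 2); rewrite expRN ler_pdivrMr ?expR_gt0//.
have y0 : 0 <= y by rewrite divr_ge0 ?sqr_ge0// mulr_ge0// ltW.
apply: (@le_trans _ _ ((1 + 4 * s ^+ 2) * (1 + y))); last first.
  by rewrite ler_wpM2l ?expR_ge1Dx// addr_ge0// mulr_ge0// ltW.
have E : 4 * s ^+ 2 * y = x ^+ 2 by rewrite /y mulrC divfK// mulf_neq0// gt_eqF.
have xE : x ^+ 2 = `|x| ^+ 2 by rewrite real_normK ?num_real.
have := sqr_ge0 (`|x| - 1); rewrite sqrrB1 -xE => h.
rewrite mulrDl mul1r !mulrDr mulr1 E; have := sqr_ge0 x; have := s2.
by move: y0; generalize y => z z0 ? ?; lra.
Qed.

Let integrable_xp : mu.-integrable setT (EFin \o (fun x => `|x| * p x)).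
Proof.
have i2 := integrableZl measurableT moment_const (@integrable_normal_pdf K 0 wide).
apply: le_integrable i2 => //.
  by apply/measurable_EFinP; apply: measurable_funM => //; exact: measurableT_comp.
move=> x _ /=; rewrite lee_fin ger0_norm ?mulr_ge0//.
by rewrite (le_trans (p_moment x))// ler_norm.
Qed.

Section transform.
Variables (h dh : K -> K).
Hypotheses (d_h : forall y, is_derive y (1 : K) h (dh y))
  (d_dh : forall y, is_derive y (1 : K) dh (- h y)).
Hypotheses (h1 : forall y, `|h y| <= 1) (dh1 : forall y, `|dh y| <= 1).

Let ch : continuous h.
Proof. by move=> y; apply/differentiable_continuous/derivable1_diffP; have [] := d_h y. Qed.

Let cdh : continuous dh.
Proof. by move=> y; apply/differentiable_continuous/derivable1_diffP; have [] := d_dh y. Qed.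

Let cM (f : K -> K) (u : K) : continuous f -> continuous (fun x => f (u * x)).
Proof. by move=> cf x; apply: continuous_comp; [exact: mulrl_continuous|exact: cf]. Qed.

(** The transform is computed for [cos] and [sin] at once: they are the functions [h]
    with [h'' = - h], here with derivative [dh]. *)
Let F (u : K) := \int[mu]_x (h (u * x) * p x).

Let intF (u : K) : mu.-integrable setT (EFin \o (fun x => h (u * x) * p x)).
Proof.
apply: le_integrable ip => //.
  apply/measurable_EFinP; apply: measurable_funM => //.
  by apply: continuous_measurable_fun; exact: cM.
move=> x _ /=; rewrite lee_fin normrM ler_piMl//.
Qed.

Let intdF (u : K) : mu.-integrable setT (EFin \o (fun x => x * dh (u * x) * p x)).
Proof.
apply: le_integrable integrable_xp => //.
  apply/measurable_EFinP; apply: measurable_funM => //; apply: measurable_funM => //.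
  by apply: continuous_measurable_fun; exact: cM.
move=> x _ /=; rewrite lee_fin !normrM normr_id (ger0_norm (p_ge0 x)) ler_wpM2r//.
by rewrite ler_piMr.
Qed.

(** The density satisfies [p' = - x p / s^2], so the derivative of [dh (u x) p x] has
    integral [0]; its boundary values vanish because [|x| p x] is bounded. *)
Let transform_by_parts (u : K) : \int[mu]_x (x * dh (u * x) * p x) = - (s ^+ 2 * u) * F u.
Proof.
pose G x := dh (u * x) * p x.
pose g x := - u * (h (u * x) * p x) - s ^- 2 * (x * dh (u * x) * p x).
have dG x : is_derive x (1 : K) G (g x).
  have dm : is_derive x (1 : K) ( *%R u) u.
    rewrite (_ : *%R u = u \*: (@id K)); last by [].
    by apply: is_derive_eq; rewrite /GRing.scale/= mulr1.
  have d1 : is_derive x (1 : K) (dh \o ( *%R u)) (- h (u * x) * u) by exact: is_derive1_comp.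
  have d2 := is_derive_p x.
  rewrite (_ : G = (dh \o ( *%R u)) * p); last by [].
  by apply: is_derive_eq; rewrite /g /GRing.scale/=; ring.
have ig : mu.-integrable setT (EFin \o g).
  exact: (integrableB measurableT (integrableZl measurableT (- u) (intF u))
    (integrableZl measurableT (s ^- 2) (intdF u))).
have Ig : \int[mu]_x g x = - u * F u - s ^- 2 * \int[mu]_x (x * dh (u * x) * p x).
  rewrite RintegralB//; last 2 first.
  - exact: (integrableZl measurableT (- u) (intF u)).
  - exact: (integrableZl measurableT (s ^- 2) (intdF u)).
  by rewrite !RintegralZl//.
suff Z : \int[mu]_x g x = 0.
  move: Ig; rewrite Z; set I := \int[mu]_x _ => E.
  have -> : I = s ^+ 2 * (s ^- 2 * I) by rewrite mulrA mulfV ?mul1r// expf_neq0// gt_eqF.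
  have -> : s ^- 2 * I = - u * F u by lra.
  by ring.
have cg : continuous g.
  move=> x; apply: cvgB.
    by apply: cvgMl_tmp; apply: cvgM; [exact: cM|exact: p_continuous].
  apply: cvgMl_tmp; apply: cvgM; last exact: p_continuous.
  by apply: cvgM; [exact: cvg_id|exact: cM].
have cG : continuous G.
  by move=> x; apply: cvgM; [exact: cM|exact: p_continuous].
pose J (n : nat) : set (measurableTypeR K) := `[- n.+1%:R, n.+1%:R]%classic.
have mJ n : measurable (J n) by exact: measurable_itv.
have c1 : \int[mu]_x (g \_ (J n)) x @[n --> \oo] --> \int[mu]_x g x.
  apply: (@Rintegral_dominated_cvg K _ (measurableTypeR K) mu setT
    (fun n => g \_ (J n)) g (fun x => `|g x|)) => //.
  - move=> n; apply/(measurable_restrictT _ (mJ n)); apply: measurable_funTS.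
    exact: continuous_measurable_fun.
  - exact: continuous_measurable_fun.
  - exact: (integrable_abse ig).
  - move=> x _; apply: cvg_near_cst; near=> n; rewrite patchE mem_set//.
    have : `|x| <= n%:R by near: n; apply: nbhs_infty_ger; exact: num_real.
    rewrite ler_norml /J/= in_itv/= -natr1 => /andP[? ?]; apply/andP; split; lra.
  - by move=> n x _; rewrite patchE; case: ifP; rewrite ?normr0.
have IJ n : \int[mu]_x (g \_ (J n)) x = G n.+1%:R - G (- n.+1%:R).
  rewrite -Rintegral_mkcond /Rintegral /J (@continuous_FTC2 _ g G)//.
  - by rewrite (@lt_trans _ _ 0)// ?oppr_lt0 ltr0n.
  - exact: continuous_subspaceT.
  - split.
    + by move=> x _; have [] := dG x.
    + by apply: cvg_at_right_filter; exact: cG.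
    + by apply: cvg_at_left_filter; exact: cG.
  - by move=> x _; rewrite derive1E; have [_ ->] := dG x.
pose B := moment_const * normal_peak wide.
have xG x : `|x| * `|G x| <= B.
  rewrite /G normrM mulrCA (ger0_norm (p_ge0 x)).
  apply: (@le_trans _ _ (`|x| * p x)).
    by rewrite ler_piMl ?mulr_ge0.
  by rewrite (le_trans (p_moment x))// ler_wpM2l ?normal_pdf_ub.
have c2 : \int[mu]_x (g \_ (J n)) x @[n --> \oo] --> (0 : K).
  apply: norm_cvg0.
  apply: (@squeeze_cvgr _ _ _ _ (cst 0) (fun n => (B + B) / n.+1%:R)).
  - apply: nearW => n; rewrite normr_ge0/= IJ ler_pdivlMr ?ltr0n//.
    have n0 : 0 <= n.+1%:R :> K by exact: ler0n.
    have := xG n.+1%:R; have := xG (- n.+1%:R); rewrite normrN (ger0_norm n0) => b1 b2.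
    rewrite mulrC (le_trans (ler_wpM2l n0 (ler_normB _ _)))// mulrDr lerD//.
  - exact: cvg_cst.
  - rewrite -[X in _ --> X](mulr0 (B + B)); apply: cvgMl_tmp; exact: cvg_harmonic.
by rewrite -(cvg_lim (@norm_hausdorff _ _) c1) (cvg_lim (@norm_hausdorff _ _) c2).
Unshelve. all: end_near. Qed.

Let is_derive_F a : is_derive a (1 : K) F (- (s ^+ 2 * a) * F a).
Proof.
have dpart u x : is_derive u (1 : K) (fun u => h (u * x) * p x) (x * dh (u * x) * p x).
  have dm : is_derive u (1 : K) ( *%R^~ x) x.
    rewrite (_ : *%R^~ x = x \*: (@id K)); last by apply/funext => y; rewrite mulrC.
    by apply: is_derive_eq; rewrite /GRing.scale/= mulr1.
  have d1 : is_derive u (1 : K) (h \o ( *%R^~ x)) (dh (u * x) * x) by exact: is_derive1_comp.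
  rewrite (_ : (fun u => _) = p x \*: (h \o ( *%R^~ x))); last first.
    by apply/funext => y; rewrite mulrC.
  by apply: is_derive_eq; rewrite /GRing.scale/=; ring.
have pE1 u x : partial1of2 (fun u x => h (u * x) * p x) u x = x * dh (u * x) * p x.
  by rewrite partial1of2E; have [_ ->] := dpart u x.
have aI : `]a - 1, a + 1[%classic a by rewrite /= in_itv/=; apply/andP; split; lra.
have i1 x : `]a - 1, a + 1[%classic x -> mu.-integrable setT (EFin \o (fun y => h (x * y) * p y)).
  by move=> _; exact: intF.
have d1 (x y : K) : `]a - 1, a + 1[%classic x -> setT y -> derivable (fun u : K => h (u * y) * p y) x 1.
  by move=> _ _; have [] := dpart x y.
have Gub (x y : K) : `]a - 1, a + 1[%classic x -> setT y ->
    `|partial1of2 (fun u x => h (u * x) * p x) x y| <= `|y| * p y.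
  move=> _ _; rewrite pE1 !normrM (ger0_norm (p_ge0 y)) ler_wpM2r//.
  by rewrite ler_piMr.
have G0 y : 0 <= `|y| * p y by rewrite mulr_ge0.
have D := derivable_under_integral measurableT aI i1 d1 G0 integrable_xp Gub.
have E := differentiation_under_integral measurableT aI i1 d1 G0 integrable_xp Gub.
apply: DeriveDef; first exact: D.
rewrite -derive1E [LHS]E -transform_by_parts.
by apply: eq_Rintegral => x _; rewrite -pE1.
Qed.

(** [F] solves [F' = - s^2 u F], hence [F u * expR (s^2 u^2 / 2)] is constant. *)
Lemma gaussian_transform (u : K) : F u = h 0 * expR (- (s ^+ 2 * u ^+ 2 / 2)).
Proof.
pose q (x : K) := s ^+ 2 / 2 * x ^+ 2.
pose H := F * (expR \o q).
have dq x : is_derive x (1 : K) q (s ^+ 2 * x).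
  rewrite (_ : q = (s ^+ 2 / 2) \*: (fun x : K => x ^+ 2)); last by [].
  by apply: is_derive_eq; rewrite /GRing.scale/=; field.
have dH x : is_derive x (1 : K) H 0.
  have d2 : is_derive x (1 : K) (expR \o q) (expR (q x) * (s ^+ 2 * x)) by exact: is_derive1_comp.
  have d1 := is_derive_F x.
  by apply: is_derive_eq; rewrite /GRing.scale/=; ring.
have HE : H u = H 0 by exact: is_derive_0_is_cst.
have F0 : F 0 = h 0.
  rewrite /F; under eq_Rintegral do rewrite mul0r.
  rewrite RintegralZl//.
  by rewrite /Rintegral integral_normal_pdf mulr1.
have E1 : expR (q u) * expR (- (s ^+ 2 * u ^+ 2 / 2)) = 1.
  by rewrite -expRD -[RHS]expR0; congr expR; rewrite /q; field.
have H0 : H 0 = h 0.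
  by rewrite -[LHS]/(F 0 * expR (q 0)) F0 /q expr0n/= mulr0 expR0 mulr1.
transitivity (H u * expR (- (s ^+ 2 * u ^+ 2 / 2))); last by rewrite HE H0.
by rewrite -[H u]/(F u * expR (q u)) -(mulrA (F u)) E1 mulr1.
Qed.

End transform.

Lemma normal_mean_cos (u : K) : \int[mu]_x (cos (u * x) * p x) = expR (- (s ^+ 2 * u ^+ 2 / 2)).
Proof.
have d1 (y : K) : is_derive y (1 : K) (@cos K) (- sin y) by exact: is_derive_cos.
have d2 (y : K) : is_derive y (1 : K) (fun x : K => - sin x) (- cos y).
  rewrite (_ : (fun x : K => - sin x) = - (@sin K)); last by [].
  by apply: is_deriveN.
have b (y : K) : `|- sin y| <= 1 by rewrite normrN sin_max.
by rewrite (gaussian_transform _ _ d1 d2 (@cos_max K) b) cos0 mul1r.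
Qed.

Lemma normal_mean_sin (u : K) : \int[mu]_x (sin (u * x) * p x) = 0.
Proof.
have d1 (y : K) : is_derive y (1 : K) (@sin K) (cos y) by exact: is_derive_sin.
have d2 (y : K) : is_derive y (1 : K) (@cos K) (- sin y) by exact: is_derive_cos.
by rewrite (gaussian_transform _ _ d1 d2 (@sin_max K) (@cos_max K)) sin0 mul0r.
Qed.

(** Beyond [c] the factor in [p_split] is at most its value at [c], and the density of
    twice the variance has mass at most [1]. *)
Lemma normal_tail (c : K) : 0 < c ->
  fine (normal_prob 0 s [set x | c <= `|x|]) <=
    Num.sqrt 2 * expR (- (c ^+ 2 / (4 * s ^+ 2))).
Proof.
move=> c0; set A := [set x | c <= `|x|].
have mA : measurable (A : set (measurableTypeR K)).
  rewrite (_ : A = ~` `]- c, c[%classic); first by apply: measurableC; exact: measurable_itv.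
  apply/seteqP; split=> x; rewrite /A/= in_itv/= -ltr_norml ltNge; first by move=> ->.
  by move/negP; rewrite negbK.
set B := Num.sqrt 2 * _.
have B0 : 0 <= B by rewrite mulr_ge0 ?sqrtr_ge0 ?expR_ge0.
have pB x : A x -> p x <= B * normal_pdf 0 wide x.
  rewrite /A/= => cx; rewrite p_split ler_wpM2r ?normal_pdf_ge0//.
  rewrite /B ler_wpM2l ?sqrtr_ge0// ler_expR lerN2 ler_pM2r ?invr_gt0 ?mulr_gt0//.
  by rewrite -[leRHS]real_normK ?num_real// lerXn2r ?nnegrE// ltW.
have i2 := @integrable_normal_pdf K 0 wide.
rewrite /normal_prob -/p -/(Rintegral mu A p).
apply: (@le_trans _ _ (\int[mu]_(x in A) (B * normal_pdf 0 wide x))).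
  apply: le_Rintegral => //.
  - exact: (integrableS measurableT mA (@subsetT _ _) ip).
  - exact: (integrableS measurableT mA (@subsetT _ _) (integrableZl measurableT B i2)).
rewrite RintegralZl//; last exact: (integrableS measurableT mA (@subsetT _ _) i2).
rewrite -[leRHS]mulr1 ler_wpM2l//.
have := @probability_le1 _ _ _ (normal_prob 0 wide) A mA.
rewrite /Rintegral -lee_fin fineK//.
exact: (integrable_fin_num mA (integrableS measurableT mA (@subsetT _ _) i2)).
Qed.

End gaussian_transform.

(** The density is the Radon-Nikodym derivative up to a null set. *)
Lemma normal_mean {K : realType} (s : K) (g : K -> K) : measurable_fun setT g ->
  (forall x, `|g x| <= 1) ->
  \int[normal_prob 0 s]_x g x = \int[lebesgue_measure]_x (g x * normal_pdf 0 s x).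
Proof.
move=> mg g1; rewrite /Rintegral; congr fine.
under [RHS]eq_integral do rewrite EFinM.
have dom := @normal_prob_dominates K 0 s.
have ig : (normal_prob 0 s).-integrable setT (EFin \o g) 
  by apply: (bounded_integrable (normal_prob 0 s : probability _ K) g 1).
rewrite -(Radon_Nikodym_change_of_variables dom)//=.
apply: ae_eq_integral => //.
- apply: emeasurable_funM; first exact/measurable_EFinP.
  by apply: (measurable_int lebesgue_measure); exact: Radon_Nikodym_integrable.
- apply: emeasurable_funM; first exact/measurable_EFinP.
  by apply/measurable_EFinP; exact: measurable_normal_pdf.
- apply: ae_eqe_mul2l; apply: integral_ae_eq => //.
  + exact: Radon_Nikodym_integrable.
  + by apply/measurable_EFinP; exact: measurable_normal_pdf.
  + by move=> E _ mE; rewrite -Radon_Nikodym_integral.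
Qed.

(** * Stieltjes measures under dilation and reflection *)

Section stieltjes_scaling.
Context {K : realType}.
Notation D := (`]0, +oo[%classic : set K).

Lemma cumul_pos_scale (F : K -> K) (s a : K) : 0 < s -> 0 < a -> cumul_pos F ->
  cumul_pos (fun z => s * F (a * z)).
Proof.
move=> s0 a0 [Fnd Frc]; split.
  move=> x y; rewrite !in_itv/= !andbT => x0 y0 xy.
  by rewrite ler_pM2l// Fnd ?in_itv/= ?andbT ?mulr_gt0// ler_pM2l.
move=> x x0; apply: cvgMl_tmp.
have ax0 : 0 < a * x by rewrite mulr_gt0.
apply: cvg_comp (Frc _ ax0).
move=> A; rewrite /at_right !nbhs_simpl/= /within/= => HA.
have := @mulrl_continuous K a x _ HA; rewrite !nbhs_simpl/=.
by apply: filterS => y h xy; apply: h; rewrite ltr_pM2l.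
Qed.

Lemma lebesgue_stieltjes_ocitv (f : cumulative K K) (x y : K) : x <= y ->
  lebesgue_stieltjes_measure f `]x, y]%classic = (f y - f x)%:E.
Proof.
move=> xy; rewrite /lebesgue_stieltjes_measure /measure_extension/=.
rewrite measurable_mu_extE/=; last exact: is_ocitv.
by rewrite wlength_itv_bnd.
Qed.

Let mshift (c : K) : measurable_fun [set: measurableTypeR K]
  ((fun x => x - c) : measurableTypeR K -> measurableTypeR K).
Proof. exact: measurable_funB. Qed.

Let mdivr (a : K) : measurable_fun [set: K] (fun y : K => y / a).
Proof. exact: mulrr_measurable. Qed.

(** Both measures are images under [expR] of Lebesgue-Stieltjes measures on the line,
    where dilation by [a] becomes translation by [ln a]. *)
Lemma stieltjes_pos_scale (F : K -> K) (s a : K) (s0 : 0 < s) : 0 < a -> cumul_pos F ->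
  forall A : set K, measurable A ->
  stieltjes_pos (fun z => s * F (a * z)) A =
  scaled_image (stieltjes_pos F) (fun y => y / a) (NngNum (ltW s0)) (mdivr a) A.
Proof.
move=> a0 H A mA; have H' := cumul_pos_scale F s a s0 a0 H.
rewrite scaled_imageE/= /stieltjes_pos; case: pselect => // {}H'; case: pselect => // {}H.
rewrite /= /stieltjes_exp /pushforward.
have := @lebesgue_stieltjes_measure_unique K (cumul_exp H')
  (scaled_image (lebesgue_stieltjes_measure (cumul_exp H)) _ (NngNum (ltW s0)) (mshift (ln a))).
move=> uniq; rewrite uniq.
- rewrite scaled_imageE/=; congr (_ * lebesgue_stieltjes_measure _ _)%E.
  apply/seteqP; split=> x /=; by rewrite expRB lnK// posrE.
- move=> _ [[x y] _ <-] /=; rewrite scaled_imageE/=.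
  have [yx|xy] := leP y x.
    rewrite set_itv_ge ?bnd_simp -?leNgt// measure0 preimage_set0 measure0 mule0//.
  rewrite (_ : _ @^-1` _ = `]x + ln a, y + ln a]%classic); last first.
    by apply/seteqP; split=> z /=; rewrite !in_itv/= ltrBrDr lerBlDr.
  rewrite !lebesgue_stieltjes_ocitv ?lerD2r ?(ltW xy)// -EFinM; congr EFin.
  by rewrite /= /cumul_exp /= !expRD !lnK ?posrE// (mulrC (expR y)) (mulrC (expR x)) mulrBr.
- by have := @measurable_expR K measurableT A mA; rewrite setTI.
Qed.

(** Continuity from below along the intervals ]e, e + n]. *)
Lemma stieltjes_pos_tail (F : K -> K) (e : K) : cumul_pos F -> 0 < e ->
  F y @[y --> +oo] --> (0 : K) -> stieltjes_pos F `]e, +oo[%classic = (- F e)%:E.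
Proof.
move=> H e0 F0.
have E : `]e, +oo[%classic = \bigcup_n `]e, e + n%:R]%classic :> set K.
  apply/seteqP; split=> x /=; last first.
    by move=> [n _]; rewrite /= !in_itv/= andbT => /andP[].
  rewrite in_itv/= andbT => ex.
  have ex0 : 0 <= x - e by rewrite subr_ge0 ltW.
  have /andP[_ h] := truncn_itv ex0.
  by exists (Num.truncn (x - e)).+1 => //=; rewrite in_itv/= ex/= -lerBlDl ltW.
have c1 : stieltjes_pos F (`]e, e + n%:R]%classic) @[n --> \oo] --> stieltjes_pos F `]e, +oo[%classic.
  rewrite E; apply: nondecreasing_cvg_mu.
  - by move=> n; exact: measurable_itv.
  - by apply: bigcupT_measurable => n; exact: measurable_itv.
  - move=> m n mn; apply/subsetPset => x /=; rewrite !in_itv/= => /andP[-> /= h].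
    by rewrite (le_trans h)// lerD2l ler_nat.
have c2 : stieltjes_pos F (`]e, e + n%:R]%classic) @[n --> \oo] --> (- F e)%:E.
  under eq_fun do rewrite stieltjes_pos_itv ?lerDl ?ler0n//.
  apply: cvg_EFin; first exact: nearW.
  rewrite -[X in _ --> X]add0r; apply: cvgB; last exact: cvg_cst.
  apply: (cvg_comp (fun n : nat => e + n%:R) F _ F0).
  apply/cvgryPge => B; near=> n; rewrite -lerBlDl; near: n.
  by apply: nbhs_infty_ger; exact: num_real.
by rewrite -(cvg_lim (@ereal_hausdorff _) c1) (cvg_lim (@ereal_hausdorff _) c2).
Unshelve. all: end_near. Qed.

Lemma stieltjes_pos_scale_integral (F : K -> K) (s a : K) (f : K -> K) (E : set K) :
  0 < s -> 0 < a -> cumul_pos F -> measurable E -> measurable_fun E f ->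
  (stieltjes_pos F).-integrable ((fun y => y / a) @^-1` E) (EFin \o (fun y => f (y / a))) ->
  (stieltjes_pos (fun z => s * F (a * z))).-integrable E (EFin \o f) /\
  \int[stieltjes_pos (fun z => s * F (a * z))]_(z in E) f z =
  s * \int[stieltjes_pos F]_(y in (fun y => y / a) @^-1` E) f (y / a).
Proof.
move=> s0 a0 H mE mf intf.
have eqm := stieltjes_pos_scale F s a s0 a0 H.
split; last first.
  rewrite /Rintegral (eq_measure_integral (scaled_image (stieltjes_pos F) (fun y => y / a)
    (NngNum (ltW s0)) (mdivr a))); last by move=> A mA _; exact: eqm.
  exact: (Rintegral_scaled_image (stieltjes_pos F) _ (NngNum (ltW s0)) (mdivr a) E f mE mf intf).
have /integrableP[_ i] := integrable_scaled_image (stieltjes_pos F) _ (NngNum (ltW s0)) (mdivr a) E f mE mf intf.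
apply/integrableP; split; first exact/measurable_EFinP.
rewrite (eq_measure_integral (scaled_image (stieltjes_pos F) (fun y => y / a)
    (NngNum (ltW s0)) (mdivr a))); last by move=> A mA _; exact: eqm.
exact: i.
Qed.

Let mopp : measurable_fun [set: K] (-%R : K -> K).
Proof. by apply: continuous_measurable_fun; exact: opp_continuous. Qed.

Let stieltjes_negE (L : K -> K) (A : set K) :
  stieltjes_neg L A = scaled_image (stieltjes_pos (fun y => - L (- y))) -%R (NngNum ler01) mopp A.
Proof. by rewrite scaled_imageE/= mul1e. Qed.

Lemma stieltjes_neg_ge0_integral (L : K -> K) (f : K -> K) (E : set K) : measurable E ->
  measurable_fun E f -> (forall y, E y -> 0 <= f y) ->
  (\int[stieltjes_neg L]_(y in E) (f y)%:E =
  \int[stieltjes_pos (fun y => - L (- y)%R)%R]_(y in -%R @^-1` E) (f (- y)%R)%:E)%E.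
Proof.
move=> mE mf f0.
rewrite (eq_measure_integral (scaled_image (stieltjes_pos (fun y => - L (- y))) -%R (NngNum ler01) mopp)).
  rewrite ge0_integral_scaled_image//; last exact/measurable_EFinP.
  by rewrite mul1e.
by move=> A _ _; exact: stieltjes_negE.
Qed.

Lemma stieltjes_neg_Rintegral (L : K -> K) (f : K -> K) (E : set K) : measurable E ->
  measurable_fun E f ->
  (stieltjes_pos (fun y => - L (- y))).-integrable (-%R @^-1` E) (EFin \o (fun y => f (- y))) ->
  \int[stieltjes_neg L]_(y in E) f y =
  \int[stieltjes_pos (fun y => - L (- y))]_(y in -%R @^-1` E) f (- y).
Proof.
move=> mE mf intf; rewrite {1}/Rintegral.
rewrite (eq_measure_integral (scaled_image (stieltjes_pos (fun y => - L (- y))) -%R (NngNum ler01) mopp)).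
  have := @Rintegral_scaled_image _ _ _ _ _ (stieltjes_pos (fun y => - L (- y))) -%R (NngNum ler01) mopp E f mE mf intf.
  by rewrite mul1r.
by move=> A _ _; exact: stieltjes_negE.
Qed.

End stieltjes_scaling.

(** * Integrals against a Levy measure on the half-line *)

Section levy_integrals.
Context {K : realType}.
Notation D := (`]0, +oo[%classic : set K).
Variable nu : {measure set K -> \bar K}.
Hypothesis square_int : forall e : K, 0 < e ->
  nu.-integrable `]0, e]%classic (EFin \o (fun z : K => z ^+ 2)).
Hypothesis tail_fin : forall e : K, 0 < e -> (nu `]e, +oo[%classic < +oo)%E.

Definition small_square (e : K) : K := \int[nu]_(z in `]0, e]) z ^+ 2.
Definition tail_mass (e : K) : K := fine (nu `]e, +oo[%classic).

Lemma small_square_ge0 e : 0 <= small_square e.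
Proof. by apply: Rintegral_ge0 => z _; exact: sqr_ge0. Qed.

Lemma tail_mass_ge0 e : 0 <= tail_mass e.
Proof. exact: fine_ge0. Qed.

Let mA (e : K) : measurable (`]0, e]%classic : set K). Proof. exact: measurable_itv. Qed.
Let mB (e : K) : measurable (`]e, +oo[%classic : set K). Proof. exact: measurable_itv. Qed.

Let DE (e : K) : 0 < e -> D = `]0, e]%classic `|` `]e, +oo[%classic.
Proof.
move=> e0; apply/seteqP; split=> z /=; rewrite !in_itv/= !andbT.
  by move=> z0; have [ze|ze] := leP z e; [left; rewrite z0|right].
by move=> [/andP[]//|]; exact: lt_trans.
Qed.

Section split.
Variables (f : K -> K) (e A B k : K).
Hypotheses (e0 : 0 < e) (mf : measurable_fun D f).
Hypothesis f_near : forall z, 0 < z <= e -> `|f z + k * z ^+ 2| <= A * z ^+ 2.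
Hypothesis f_far : forall z, e < z -> `|f z| <= B.

Let subA : `]0, e]%classic `<=` D.
Proof. by move=> z; rewrite /= !in_itv/= => /andP[->]. Qed.

Let subB : `]e, +oo[%classic `<=` D.
Proof. by move=> z; rewrite /= !in_itv/= !andbT; exact: lt_trans. Qed.

Let intA : nu.-integrable `]0, e]%classic (EFin \o f).
Proof.
have i := integrableZl (mA e) (A + `|k|) (square_int e e0).
apply: le_integrable i => //.
  by apply/measurable_EFinP; exact: measurable_funS mf.
move=> z; rewrite /= in_itv/= => ze; rewrite lee_fin; apply: le_trans (ler_norm _).
have -> : f z = (f z + k * z ^+ 2) - k * z ^+ 2 by ring.
rewrite (le_trans (ler_normB _ _))// mulrDl lerD ?f_near//.
by rewrite normrM (ger0_norm (sqr_ge0 _)).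
Qed.

Let intB : nu.-integrable `]e, +oo[%classic (EFin \o f).
Proof.
have i : nu.-integrable `]e, +oo[%classic (EFin \o cst B).
  apply/integrableP; split; first exact/measurable_EFinP.
  by rewrite /= integral_cst//= lte_mul_pinfty// tail_fin.
apply: le_integrable i => //.
  by apply/measurable_EFinP; exact: measurable_funS mf.
move=> z; rewrite /= in_itv/= andbT => ez; rewrite lee_fin; apply: le_trans (ler_norm _).
exact: f_far.
Qed.

Lemma levy_integrable_split : nu.-integrable D (EFin \o f).
Proof.
have /integrableP[_ iA] := intA; have /integrableP[_ iB] := intB.
apply/integrableP; split; first exact/measurable_EFinP.
rewrite (DE e e0) ge0_integral_setU//.
- by apply: lte_add_pinfty.
- by apply/measurable_EFinP/measurableT_comp => //; rewrite -DE.
- apply/disj_setPRL => z; rewrite /= !in_itv/= !andbT => ez /andP[_]; rewrite leNgt ez//.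
Qed.

(** With [k = u^2 / 2] this extracts the Gaussian part of an integral from a measure
    concentrated near [0]; with [k = 0] it is a plain bound. *)
Lemma levy_split_le : `|\int[nu]_(z in D) f z + k * small_square e| <=
  A * small_square e + B * tail_mass e.
Proof.
have iD : nu.-integrable (`]0, e]%classic `|` `]e, +oo[%classic) (EFin \o f).
  by rewrite -DE//; exact: levy_integrable_split.
rewrite (DE e e0) Rintegral_setU//; last first.
  apply/disj_set2P; apply/seteqP; split=> z //=; rewrite !in_itv/= andbT => -[/andP[_ h]].
  by rewrite ltNge h.
have sq := square_int e e0.
have ik := integrableZl (mA e) k sq.
have iA := integrableZl (mA e) A sq.
have E1 : \int[nu]_(z in `]0, e]) f z + k * small_square e =
    \int[nu]_(z in `]0, e]) (f z + k * z ^+ 2).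
  by rewrite RintegralD// RintegralZl.
have E2 : A * small_square e = \int[nu]_(z in `]0, e]) (A * z ^+ 2) by rewrite RintegralZl.
have h1 : `|\int[nu]_(z in `]0, e]) (f z + k * z ^+ 2)| <= A * small_square e.
  have i1 : nu.-integrable `]0, e]%classic (EFin \o (fun z => f z + k * z ^+ 2)).
    exact: (integrableD (mA e) intA ik).
  rewrite (le_trans (le_normr_Rintegral _ i1))// E2; apply: le_Rintegral => //.
    exact: (integrable_abse i1).
have h2 : `|\int[nu]_(z in `]e, +oo[) f z| <= B * tail_mass e.
  rewrite (le_trans (le_normr_Rintegral _ intB))// /tail_mass -Rintegral_cst//.
  apply: le_Rintegral => //.
    exact: (integrable_abse intB).
    apply/integrableP; split; first exact/measurable_EFinP.
    by rewrite /= integral_cst//= lte_mul_pinfty// tail_fin.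
  by move=> z; rewrite /= in_itv/= andbT => ze; exact: f_far.
rewrite -addrA [X in `|_ + X|]addrC addrA E1 (le_trans (ler_normD _ _))// lerD//.
Qed.

End split.
End levy_integrals.

Section levy_integrands.
Context {K : realType}.
Implicit Types u z e : K.

(** The real and imaginary parts of the integrand of the Levy exponent. *)
Definition cos_part u z : K := cos (u * z) - 1.
Definition sin_part u z : K := sin (u * z) - u * z / (1 + z ^+ 2).

Let oneDsq0 z : 0 < 1 + z ^+ 2. Proof. by rewrite ltr_pwDl// sqr_ge0. Qed.

Lemma measurable_cos_part u (E : set K) : measurable_fun E (cos_part u).
Proof.
apply: measurable_funTS; apply: continuous_measurable_fun => z; apply: cvgB; last exact: cvg_cst.
by apply: continuous_comp; [exact: mulrl_continuous|exact: continuous_cos].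
Qed.

Lemma measurable_sin_part u (E : set K) : measurable_fun E (sin_part u).
Proof.
apply: measurable_funTS; apply: continuous_measurable_fun => z; apply: cvgB.
  by apply: continuous_comp; [exact: mulrl_continuous|exact: continuous_sin].
apply: cvgM; first exact: mulrl_continuous.
apply: cvgV; first by rewrite gt_eqF.
by apply: cvgD; [exact: cvg_cst|exact: exprn_continuous].
Qed.

Lemma cos_part_near u e z : e <= 1 -> 0 < z <= e ->
  `|cos_part u z + u ^+ 2 / 2 * z ^+ 2| <= (u ^+ 4 * e) * z ^+ 2.
Proof.
move=> e1 /andP[z0 ze]; have := norm_cos_taylor_le (u * z).
have -> : (u * z) ^+ 2 / 2 = u ^+ 2 / 2 * z ^+ 2 by ring.
move/le_trans; apply; rewrite exprMn -mulrA ler_wpM2l ?exprn_even_ge0//.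
rewrite (exprD z 2 2) ler_wpM2r ?sqr_ge0// expr2.
by rewrite (le_trans _ ze)// ler_piMl ?(ltW z0)// (le_trans ze e1).
Qed.

Lemma cos_part_le2 u z : `|cos_part u z| <= 2.
Proof. by rewrite (le_trans (ler_normB _ _))// normr1 lerD2r cos_max. Qed.

Lemma cos_part_le0 u z : cos_part u z <= 0.
Proof. by rewrite subr_le0 cos_le1. Qed.

Lemma cos_part_quad u z : `|cos_part u z| <= u ^+ 2 * z ^+ 2.
Proof. by rewrite -exprMn distrC norm_1Bcos_le2. Qed.

Let sin_partE u z : sin_part u z = u * z ^+ 3 / (1 + z ^+ 2) - (u * z - sin (u * z)).
Proof. by rewrite /sin_part; field; rewrite gt_eqF. Qed.

Let cube_le u z : 0 < z -> `|u * z ^+ 3 / (1 + z ^+ 2)| <= `|u| * z ^+ 3.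
Proof.
move=> z0; have z3 : 0 <= z ^+ 3 by rewrite exprn_ge0// ltW.
rewrite normrM normfV (normrM u) (ger0_norm z3) (gtr0_norm (oneDsq0 z)).
by rewrite ler_pdivrMr// -[leLHS]mulr1 ler_wpM2l ?(mulr_ge0 (normr_ge0 u) z3)// lerDl sqr_ge0.
Qed.

(** Both [u z - sin (u z)] and [u z - u z / (1 + z^2)] are of third order in [z]. *)
Lemma sin_part_near u e z : e <= 1 -> 0 < z <= e ->
  `|sin_part u z + 0 * z ^+ 2| <= ((`|u| + `|u| ^+ 3) * e) * z ^+ 2.
Proof.
move=> e1 /andP[z0 ze]; rewrite mul0r addr0 sin_partE.
have z3 : z ^+ 3 <= e * z ^+ 2 by rewrite exprS ler_wpM2r ?sqr_ge0.
have -> : (`|u| + `|u| ^+ 3) * e * z ^+ 2 = `|u| * (e * z ^+ 2) + `|u| ^+ 3 * (e * z ^+ 2).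
  by ring.
rewrite (le_trans (ler_normB _ _))// lerD//.
  by rewrite (le_trans (cube_le _ _ z0))// ler_wpM2l.
rewrite (le_trans (norm_sinB_le _))// normrM exprMn (gtr0_norm z0) ler_wpM2l//.
Qed.

(** Quadratic in [u] for the sake of [exponent_bound], whereas the third order bound
    grows like [|u|^3]. *)
Lemma sin_part_quad u z : 0 < z <= 1 -> `|sin_part u z + 0 * z ^+ 2| <= (`|u| + 2 * u ^+ 2) * z ^+ 2.
Proof.
move=> /andP[z0 z1]; rewrite mul0r addr0 sin_partE.
rewrite (le_trans (ler_normB _ _))// mulrDl lerD//.
  rewrite (le_trans (cube_le _ _ z0))// ler_wpM2l// exprSr ler_piMr ?sqr_ge0//.
have -> : 2 * u ^+ 2 * z ^+ 2 = 2 * `|u * z| ^+ 2 by rewrite real_normK ?num_real//; ring.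
set x := u * z.
have [x1|x1] := leP `|x| 1.
  rewrite (le_trans (norm_sinB_le _))// exprS.
  have : 0 <= `|x| ^+ 2 by rewrite exprn_ge0.
  have := normr_ge0 x; nra.
rewrite (le_trans (ler_normB _ _))//.
have := norm_sin_le x; nra.
Qed.

Lemma sin_part_far u z : 0 < z -> `|sin_part u z| <= 1 + `|u|.
Proof.
move=> z0; rewrite (le_trans (ler_normB _ _))// lerD ?sin_max// -mulrA normrM ler_piMr//.
rewrite normrM normfV (gtr0_norm z0) (gtr0_norm (oneDsq0 z)) ler_pdivrMr// mul1r.
have := sqr_ge0 (z - 1); nra.
Qed.

End levy_integrands.

(** * Limits of Levy exponents *)

Section exponent_limit.
Context {K : realType}.
Notation D := (`]0, +oo[%classic : set K).
Variables (nup num : nat -> {measure set K -> \bar K}) (sg : nat -> K) (v : K).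
Hypothesis sqp : forall n (e : K), 0 < e ->
  (nup n).-integrable `]0, e]%classic (EFin \o (fun z : K => z ^+ 2)).
Hypothesis sqm : forall n (e : K), 0 < e ->
  (num n).-integrable `]0, e]%classic (EFin \o (fun z : K => z ^+ 2)).
Hypothesis finp : forall n (e : K), 0 < e -> (nup n `]e, +oo[%classic < +oo)%E.
Hypothesis finm : forall n (e : K), 0 < e -> (num n `]e, +oo[%classic < +oo)%E.
Hypothesis sg0 : forall n, 0 <= sg n.
Hypothesis tailp : forall e : K, 0 < e -> tail_mass (nup n) e @[n --> \oo] --> (0 : K).
Hypothesis tailm : forall e : K, 0 < e -> tail_mass (num n) e @[n --> \oo] --> (0 : K).

Definition total_square (e : K) (n : nat) : K :=
  small_square (num n) e + sg n + small_square (nup n) e.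

Hypothesis square_lim : forall dl : K, 0 < dl ->
  \forall e \near (0 : K)^'+, \forall n \near \oo, `|total_square e n - v| <= dl.

Definition exponent_re (n : nat) (u : K) : K :=
  - (sg n * u ^+ 2 / 2) +
  (\int[num n]_(z in D) cos_part u z + \int[nup n]_(z in D) cos_part u z).

Definition exponent_im (n : nat) (u : K) : K :=
  \int[nup n]_(z in D) sin_part u z - \int[num n]_(z in D) sin_part u z.

Lemma exponent_re_le0 n u : exponent_re n u <= 0.
Proof.
have h (nu : {measure set K -> \bar K}) : \int[nu]_(z in D) cos_part u z <= 0.
  rewrite /Rintegral fine_le0// integral_mkcond -(integral0 nu setT).
  apply: le_integral_any => z; rewrite patchE; case: ifP => // _.
  by rewrite lee_fin cos_part_le0.
have : 0 <= sg n * u ^+ 2 / 2 by rewrite divr_ge0// mulr_ge0 ?sqr_ge0.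
have := h (num n); have := h (nup n); rewrite /exponent_re; lra.
Qed.

(** The second moments on ]0, e] account for [- u^2 z^2 / 2] with a relative
    error [O(e)], and the rest is a bounded function integrated over the tails. *)
Let re_bound (e : K) n u : 0 < e -> e <= 1 ->
  `|exponent_re n u + u ^+ 2 / 2 * total_square e n| <=
  (u ^+ 4 * e) * total_square e n + 2 * (tail_mass (num n) e + tail_mass (nup n) e).
Proof.
move=> e0 e1.
have hm := @levy_split_le K (num n) (sqm n) (finm n) (cos_part u) e (u ^+ 4 * e) 2 (u ^+ 2 / 2)
  e0 (measurable_cos_part u _) (fun z ze => cos_part_near u e z e1 ze) (fun z _ => cos_part_le2 u z).
have hp := @levy_split_le K (nup n) (sqp n) (finp n) (cos_part u) e (u ^+ 4 * e) 2 (u ^+ 2 / 2)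
  e0 (measurable_cos_part u _) (fun z ze => cos_part_near u e z e1 ze) (fun z _ => cos_part_le2 u z).
rewrite /exponent_re /total_square.
have sgu : 0 <= (u ^+ 4 * e) * sg n by apply: mulr_ge0 => //; apply: mulr_ge0; [rewrite exprn_even_ge0|exact: ltW].
move: hm hp; rewrite !ler_norml => /andP[? ?] /andP[? ?].
by apply/andP; split; lra.
Qed.

Let im_bound (e : K) n u : 0 < e -> e <= 1 ->
  `|exponent_im n u| <=
  ((`|u| + `|u| ^+ 3) * e) * total_square e n +
  (1 + `|u|) * (tail_mass (num n) e + tail_mass (nup n) e).
Proof.
move=> e0 e1.
have far z : e < z -> `|sin_part u z| <= 1 + `|u| by move=> ez; apply: sin_part_far; exact: lt_trans ez.
have hm := @levy_split_le K (num n) (sqm n) (finm n) (sin_part u) e _ _ 0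
  e0 (measurable_sin_part u _) (fun z ze => sin_part_near u e z e1 ze) far.
have hp := @levy_split_le K (nup n) (sqp n) (finp n) (sin_part u) e _ _ 0
  e0 (measurable_sin_part u _) (fun z ze => sin_part_near u e z e1 ze) far.
rewrite /exponent_im /total_square.
have sgu : 0 <= ((`|u| + `|u| ^+ 3) * e) * sg n.
  by apply: mulr_ge0 => //; apply: mulr_ge0; [rewrite addr_ge0// exprn_ge0|exact: ltW].
move: hm hp; rewrite !mul0r !addr0 !ler_norml => /andP[? ?] /andP[? ?].
by apply/andP; split; lra.
Qed.

Let small_cut (dl A : K) : 0 < dl -> 0 <= A -> exists e : K, [/\ 0 < e, e <= 1,
  A * e <= dl & \forall n \near \oo, `|total_square e n - v| <= dl].
Proof.
move=> dl0 A0; have A1 : 0 < A + 1 by rewrite ltr_wpDl.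
have near_e : \forall e \near (0 : K)^'+, 0 < e /\ e < Num.min 1 (dl / (A + 1)).
  near=> e; split; near: e; first exact: nbhs_right_gt.
  by apply: nbhs_right_lt; rewrite lt_min ltr01 divr_gt0.
have [e [[e0 ee] He]] := filter_ex (filterI near_e (square_lim dl dl0)).
move: ee; rewrite lt_min => /andP[e1 eA].
exists e; split=> //; first exact: ltW.
rewrite (@le_trans _ _ ((A + 1) * e)) ?ler_wpM2r ?lerDl ?(ltW e0)//.
by rewrite -ler_pdivlMl// mulrC ltW.
Unshelve. all: end_near. Qed.

Let tails (e dl : K) : 0 < e -> 0 < dl ->
  \forall n \near \oo, tail_mass (num n) e + tail_mass (nup n) e <= dl.
Proof.
move=> e0 dl0.
have c : tail_mass (num n) e + tail_mass (nup n) e @[n --> \oo] --> (0 : K).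
  by rewrite -[X in _ --> X]addr0; apply: cvgD; [exact: tailm|exact: tailp].
move/cvgr0_norm_le : c => /(_ _ dl0); apply: filterS => n; apply: le_trans.
exact: ler_norm.
Qed.

Let v0 : 0 <= v.
Proof.
apply/ler_addgt0Pl => dl dl0.
have [e [e0 _ _ He]] := small_cut dl 0 dl0 (lexx 0).
have [n] := filter_ex He; rewrite ler_distl => /andP[_ h].
have : 0 <= total_square e n by rewrite !addr_ge0 ?small_square_ge0.
lra.
Qed.

(** The cut-off [e] is chosen for the Taylor error and for the closeness of the second
    moment to [v]; the tails beyond [e] then vanish as [n] grows. *)
Lemma exponent_re_cvg u : exponent_re n u @[n --> \oo] --> - (v * u ^+ 2 / 2).
Proof.
apply/cvgrPdist_le => dl dl0.
have u2 : 0 <= u ^+ 2 by exact: sqr_ge0.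
have u4 : 0 <= u ^+ 4 by rewrite exprn_even_ge0.
pose r := Num.min 1 (dl / 3 / (u ^+ 2 + 1)).
have r0 : 0 < r by rewrite lt_min ltr01 !divr_gt0// ltr_wpDl.
have r1 : r <= 1 by rewrite ge_min lexx.
have ru : u ^+ 2 / 2 * r <= dl / 3 /\ r <= dl / 3.
  have h : (u ^+ 2 + 1) * r <= dl / 3.
    by rewrite -ler_pdivlMl ?ltr_wpDl// mulrC ge_min lexx orbT.
  by split; apply: le_trans h; nra.
have A0 : 0 <= u ^+ 4 * (v + 1) by apply: mulr_ge0 => //; rewrite addr_ge0.
have [e [e0 e1 Ae He]] := small_cut r _ r0 A0.
have dl6 : 0 < dl / 6 by rewrite divr_gt0.
have Ht := tails e (dl / 6) e0 dl6.
near=> n.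
have hn : `|total_square e n - v| <= r by near: n.
have tn : tail_mass (num n) e + tail_mass (nup n) e <= dl / 6 by near: n.
have := re_bound e n u e0 e1; set Q := total_square e n in hn *; set t := _ + _ in tn * => hb.
have Qv : Q <= v + 1 by move: hn; rewrite ler_distl => /andP[_]; lra.
have AQ : u ^+ 4 * e * Q <= dl / 3.
  apply: le_trans ru.2; apply: le_trans Ae; rewrite mulrAC.
  by apply: ler_wpM2r; [exact: ltW|exact: ler_wpM2l].
have uQ : `|u ^+ 2 / 2 * (Q - v)| <= dl / 3.
  rewrite normrM ger0_norm ?divr_ge0// (le_trans _ ru.1)// ler_wpM2l ?divr_ge0//.
move: hb uQ; rewrite !ler_norml => /andP[? ?] /andP[? ?]; apply/andP; split; lra.
Unshelve. all: end_near. Qed.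

Lemma exponent_im_cvg u : exponent_im n u @[n --> \oo] --> (0 : K).
Proof.
apply/cvgrPdist_le => dl dl0.
pose a := `|u| + `|u| ^+ 3.
have a0 : 0 <= a by rewrite addr_ge0// exprn_ge0.
pose r := Num.min 1 (dl / 2).
have r0 : 0 < r by rewrite lt_min ltr01 divr_gt0.
have [e [e0 e1 Ae He]] := small_cut r (a * (v + 1)) r0 (mulr_ge0 a0 (addr_ge0 v0 ler01)).
have d2 : 0 < dl / 2 / (1 + `|u|) by rewrite !divr_gt0// ltr_pwDl.
have Ht := tails e _ e0 d2.
near=> n.
have hn : `|total_square e n - v| <= r by near: n.
have tn : tail_mass (num n) e + tail_mass (nup n) e <= dl / 2 / (1 + `|u|) by near: n.
have r1 : r <= 1 by rewrite ge_min lexx.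
have rd : r <= dl / 2 by rewrite ge_min lexx orbT.
have Qv : total_square e n <= v + 1 by move: hn; rewrite ler_distl => /andP[_]; lra.
rewrite sub0r normrN (le_trans (im_bound e n u e0 e1))// [leRHS]splitr lerD//.
  apply: le_trans rd; apply: le_trans Ae; rewrite -/a -!mulrA ler_wpM2l// mulrC.
  by rewrite ler_wpM2r// ltW.
by rewrite -ler_pdivlMl ?ltr_pwDl// mulrC.
Unshelve. all: end_near. Qed.

(** A cut-off that serves all [u] at once, with the bounds that are quadratic in [u]. *)
Lemma exponent_bound : exists2 C : K, 0 <= C &
  \forall n \near \oo, forall u, `|exponent_re n u| + `|exponent_im n u| <= C * (1 + u ^+ 2).
Proof.
have [e [e0 e1 _ He]] := small_cut 1 0 ltr01 (lexx 0).
have Ht := tails e 1 e0 ltr01.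
exists (6 * (v + 2)); first by rewrite mulr_ge0// addr_ge0.
near=> n => u.
have hn : `|total_square e n - v| <= 1 by near: n.
have tn : tail_mass (num n) e + tail_mass (nup n) e <= 1 by near: n.
have near_c z : 0 < z <= e -> `|cos_part u z + 0 * z ^+ 2| <= u ^+ 2 * z ^+ 2.
  by move=> _; rewrite mul0r addr0; exact: cos_part_quad.
have near_s z : 0 < z <= e -> `|sin_part u z + 0 * z ^+ 2| <= (`|u| + 2 * u ^+ 2) * z ^+ 2.
  by move=> /andP[z0 ze]; apply: sin_part_quad; rewrite z0 (le_trans ze e1).
have far_s z : e < z -> `|sin_part u z| <= 1 + `|u| by move=> ez; apply: sin_part_far; exact: lt_trans ez.
have cm := levy_split_le _ (sqm n) (finm n) _ e _ 2 0 e0 (measurable_cos_part u _) near_c (fun z _ => cos_part_le2 u z).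
have cp := levy_split_le _ (sqp n) (finp n) _ e _ 2 0 e0 (measurable_cos_part u _) near_c (fun z _ => cos_part_le2 u z).
have sm := levy_split_le _ (sqm n) (finm n) _ e _ _ 0 e0 (measurable_sin_part u _) near_s far_s.
have sp := levy_split_le _ (sqp n) (finp n) _ e _ _ 0 e0 (measurable_sin_part u _) near_s far_s.
move: cm cp sm sp; rewrite !mul0r !addr0 => cm cp sm sp.
have u2 : 0 <= u ^+ 2 by exact: sqr_ge0.
have uu : `|u| <= 1 + u ^+ 2.
  have := sqr_ge0 (`|u| - 1); rewrite sqrrB1 real_normK ?num_real//; lra.
set tm := tail_mass (num n) e in tn cm sm *; set tp := tail_mass (nup n) e in tn cp sp *.
have tm0 : 0 <= tm by exact: tail_mass_ge0.
have tp0 : 0 <= tp by exact: tail_mass_ge0.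
have qm0 := small_square_ge0 (num n) e; have qp0 := small_square_ge0 (nup n) e.
have sgn := sg0 n.
move: hn; rewrite /total_square ler_distl => /andP[_ hn].
set qm := small_square (num n) e in hn cm sm qm0 *; set qp := small_square (nup n) e in hn cp sp qp0 *.
have Hre : `|exponent_re n u| <= (1 + u ^+ 2) * (sg n + qm + qp + 2 * (tm + tp)).
  rewrite /exponent_re (le_trans (ler_normD _ _))// normrN.
  rewrite (ger0_norm (divr_ge0 (mulr_ge0 sgn u2) (ler0n _ 2))).
  have := ler_normD (\int[num n]_(z in D) cos_part u z) (\int[nup n]_(z in D) cos_part u z).
  nra.
have Him : `|exponent_im n u| <= (1 + u ^+ 2) * (3 * (qm + qp) + 2 * (tm + tp)).
  rewrite /exponent_im (le_trans (ler_normB _ _))//.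
  nra.
apply: (@le_trans _ _ ((1 + u ^+ 2) * (4 * (sg n + qm + qp) + 4 * (tm + tp)))).
  nra.
by rewrite (mulrC (6 * (v + 2))) ler_wpM2l ?addr_ge0//; lra.
Unshelve. all: end_near. Qed.

End exponent_limit.

(** * The scaled Wiener process *)

Section scaled_wiener.
Context {K : realType} {d' : measure_display} {T' : measurableType d'}.
Variables (P' : probability T' K) (W : T' -> skorohod K) (c : K).
Hypothesis stdW : standard_wiener P' W.
Hypothesis c0 : 0 <= c.
Notation Y := (fun w => skorohod_scale c (W w)).

Lemma wiener_normal0 (t : K) (B : set K) : 0 < t -> t <= 1 -> measurable B ->
  P' [set w | B (W w t)] = normal_prob 0 (Num.sqrt t) B.
Proof.
move=> t0 t1 mB; have := wiener_normal stdW (lexx 0) t0 t1 mB.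
rewrite subr0 => <-; congr (P' _); apply/seteqP; split=> w /=;
  by rewrite (wiener_start stdW) subr0.
Qed.

Lemma scaled_wiener_stationary : stationary_process P' (fun t w => Y w t).
Proof.
have mc : measurable_fun [set: K] ( *%R c) by exact: mulrl_measurable.
have mpre (B : set K) : measurable B -> measurable (( *%R c) @^-1` B).
  by move=> mB; rewrite -[X in measurable X]setTI; exact: mc.
split.
- move=> t t01 /=; apply: measurable_funM => //; exact: (wiener_measurable stdW).
- by move=> w /=; rewrite (wiener_start stdW) mulr0.
- by move=> w t t01; have [h _] := path_cadlag (Y w); exact: h.
- move=> n t t01 tnd B mB /=.
  have := wiener_independent stdW t01 tnd (fun i => mpre _ (mB i)).
  rewrite (_ : [set w | _] = [set w | forall i : 'I_n, B i (c * W w (t i.+1) - c * W w (t i))]); last first.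
    by apply/seteqP; split=> w /= h i; have := h i; rewrite mulrBr.
  move=> ->; apply: eq_bigr => i _; congr (P' _).
  by apply/seteqP; split=> w /=; rewrite mulrBr.
- move=> s h B s0 h0 sh1 mB /=.
  have [->|hn] := eqVneq h 0.
    congr (P' _); apply/seteqP; split=> w /=; rewrite addr0 subrr (wiener_start stdW) mulr0//.
  have h1 : 0 < h by rewrite lt_neqAle eq_sym hn.
  have E1 : [set w | B (c * W w (s + h) - c * W w s)] =
      [set w | (( *%R c) @^-1` B) (W w (s + h) - W w s)].
    by apply/seteqP; split=> w /=; rewrite mulrBr.
  rewrite E1 (@wiener_normal _ _ _ _ _ stdW s (s + h))//; [|by rewrite ltrDl|exact: mpre].
  rewrite addrC addKr.
  rewrite -(wiener_normal0 h (( *%R c) @^-1` B) h1 _ (mpre _ mB))//.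
  by rewrite (le_trans _ sh1)// lerDr.
Qed.

Lemma wiener_mean (g : K -> K) (t : K) : 0 < t -> t <= 1 -> measurable_fun setT g ->
  (forall x, `|g x| <= 1) ->
  \int[P']_w g (W w t) = \int[lebesgue_measure]_x (g x * normal_pdf 0 (Num.sqrt t) x).
Proof.
move=> t0 t1 mg g1.
have mW : measurable_fun setT (fun w => W w t : measurableTypeR K) by apply: (wiener_measurable stdW); rewrite (ltW t0).
rewrite -normal_mean//.
have ig : P'.-integrable ((fun w => W w t) @^-1` setT) (EFin \o g \o (fun w => W w t)).
  rewrite preimage_setT.
  by apply: (@bounded_integrable _ _ _ _ _ 1) => //; exact: measurableT_comp.
have := Rintegral_scaled_image P' (fun w => W w t : measurableTypeR K) (NngNum ler01) mW setT g measurableT mg ig.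
rewrite preimage_setT mul1r => <-; rewrite /Rintegral; congr fine.
rewrite [RHS](eq_measure_integral (scaled_image P' _ (NngNum ler01) mW))//.
by move=> A mA _; rewrite scaled_imageE mul1e; exact/esym/wiener_normal0.
Qed.

Let cos1 (x : K) : `|cos x| <= 1. Proof. exact: cos_max. Qed.
Let sin1 (x : K) : `|sin x| <= 1. Proof. exact: sin_max. Qed.

Let cases01 (t : K) : 0 <= t <= 1 -> t = 0 \/ 0 < t.
Proof. by case/andP; rewrite le_eqVlt => /predU1P[<-|]; [left|right]. Qed.

Lemma scaled_wiener_cos (u t : K) : 0 <= t <= 1 ->
  \int[P']_w cos (u * Y w t) = expR (t * - (c ^+ 2 * u ^+ 2 / 2)).
Proof.
move=> t01; have [->|t0] := cases01 t t01.
  under eq_Rintegral do rewrite /= (wiener_start stdW) !mulr0 cos0.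
  by rewrite mean_cst mul0r expR0.
have /andP[_ t1] := t01; have s0 : 0 < Num.sqrt t by rewrite sqrtr_gt0.
under eq_Rintegral do rewrite /= mulrA.
rewrite (wiener_mean (fun x => cos (u * c * x)))//; last first.
  by apply: measurableT_comp; [exact: measurable_cos|exact: mulrl_measurable].
rewrite (normal_mean_cos _ s0) sqr_sqrtr ?(ltW t0)//; congr expR; ring.
Qed.

Lemma scaled_wiener_sin (u t : K) : 0 <= t <= 1 -> \int[P']_w sin (u * Y w t) = 0.
Proof.
move=> t01; have [->|t0] := cases01 t t01.
  under eq_Rintegral do rewrite /= (wiener_start stdW) !mulr0 sin0.
  by rewrite mean_cst.
have /andP[_ t1] := t01; have s0 : 0 < Num.sqrt t by rewrite sqrtr_gt0.
under eq_Rintegral do rewrite /= mulrA.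
rewrite (wiener_mean (fun x => sin (u * c * x)))//; last first.
  by apply: measurableT_comp; [exact: measurable_sin|exact: mulrl_measurable].
exact: normal_mean_sin.
Qed.

Lemma scaled_wiener_atom (t x : K) : 0 < t <= 1 -> x != 0 -> P' [set w | Y w t = x] = 0%E.
Proof.
move=> /andP[t0 t1] x0; have [c_0|cn0] := eqVneq c 0.
  rewrite (_ : [set w | _] = set0) ?measure0//; apply/seteqP; split=> w //=.
  by rewrite c_0 mul0r => e; rewrite -e eqxx in x0.
rewrite (_ : [set w | _] = [set w | [set x / c] (W w t)]); last first.
  apply/seteqP; split=> w /= e; first by rewrite -e mulrC mulKf.
  by rewrite e mulrC divfK.
rewrite wiener_normal0//.
apply: (iffLR (null_content_dominatesP _ _) (@normal_prob_dominates K 0 (Num.sqrt t))) => //.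
exact: lebesgue_measure_set1.
Qed.

(** The normal tail at time [1/m] is [O(expR (- m k))], which beats the factor [m]. *)
Lemma scaled_wiener_tail (e : K) : 0 < e ->
  m%:R * (1 - prob_itv P' (fun w => Y w m%:R^-1) (- e) e) @[m --> \oo] --> (0 : K).
Proof.
move=> e0; have [c_0|cn0] := eqVneq c 0.
  rewrite (_ : (fun _ => _) = cst 0); first exact: cvg_cst.
  apply/funext => m; rewrite /prob_itv (_ : [set w | _] = setT).
    by rewrite probability_setT subrr mulr0.
  by apply/seteqP; split=> w //= _; rewrite c_0 mul0r oppr_lt0 e0 ltW.
have cgt0 : 0 < c by rewrite lt_neqAle eq_sym cn0.
pose k := (e / c) ^+ 2 / 4; have k0 : 0 < k by rewrite divr_gt0// exprn_gt0// divr_gt0.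
apply: (@squeeze_cvgr _ _ _ _ (cst 0) (fun m : nat => Num.sqrt 2 * (4 / k ^+ 2) * m%:R^-1)); first last.
- rewrite -(mulr0 (Num.sqrt 2 * (4 / k ^+ 2))); apply: cvgMl_tmp.
  apply/gtr0_cvgV0; last exact: cvgr_idn.
  by near=> m; rewrite ltr0n; near: m; exact: nbhs_infty_gt.
- exact: cvg_cst.
near=> m; have m0 : (0 < m)%N by near: m; exact: nbhs_infty_gt.
have mr0 : 0 < m%:R :> K by rewrite ltr0n.
have t0 : 0 < m%:R^-1 :> K by rewrite invr_gt0.
have t1 : m%:R^-1 <= 1 :> K by rewrite invf_le1// ler1n.
have mY : measurable_fun setT (fun w => Y w m%:R^-1).
  by apply: (stat_measurable _ _ scaled_wiener_stationary); rewrite ltW.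
have mI := measurable_rv_itv (fun w => Y w m%:R^-1) (- e) e mY.
have -> : 1 - prob_itv P' (fun w => Y w m%:R^-1) (- e) e =
    fine (P' (~` [set w | - e < Y w m%:R^-1 <= e])).
  by rewrite probability_setC// fineB ?fin_num_measure.
apply/andP; split; first by rewrite mulr_ge0// fine_ge0.
have mA : measurable ([set x | e / c <= `|x|] : set K).
  rewrite (_ : [set x | _] = ~` `]- (e / c), e / c[%classic); first by apply: measurableC; exact: measurable_itv.
  by apply/seteqP; split=> x /=; rewrite in_itv/= -ltr_norml leNgt => /negP.
have mW : measurable_fun setT (fun w => W w m%:R^-1).
  by apply: (wiener_measurable stdW); rewrite (ltW t0).
have h : fine (P' (~` [set w | - e < Y w m%:R^-1 <= e])) <= Num.sqrt 2 * expR (- (m%:R * k)).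
  have s0 : 0 < Num.sqrt (m%:R^-1 : K) by rewrite sqrtr_gt0.
  have -> : m%:R * k = (e / c) ^+ 2 / (4 * Num.sqrt (m%:R^-1) ^+ 2).
    by rewrite sqr_sqrtr ?(ltW t0)// /k; field; rewrite gt_eqF.
  apply: le_trans (normal_tail _ s0 _ (divr_gt0 e0 cgt0)).
  rewrite -(wiener_normal0 m%:R^-1)// fine_le ?fin_num_measure ?le_measure ?inE//.
  + exact: measurableC.
  + exact: measurable_rv_set mA.
  + exact: measurableC.
  + exact: measurable_rv_set mA.
  + move=> w /= /negP; rewrite negb_and -leNgt -ltNge ler_pdivrMr//.
    rewrite (_ : `|_| * c = `|c * W w m%:R^-1|); last by rewrite normrM (gtr0_norm cgt0) mulrC.
    rewrite ler_normr => /orP[h|h]; apply/orP.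
      by right; rewrite lerNr.
    by left; rewrite ltW.
rewrite (le_trans (ler_wpM2l (ltW mr0) h))//.
have mk : 0 < m%:R * k by rewrite mulr_gt0.
have h2 : (m%:R * k) ^+ 2 / 4 <= expR (m%:R * k).
  rewrite [X in expR X](splitr (m%:R * k)) expRD -expr2.
  have h3 : m%:R * k / 2 <= expR (m%:R * k / 2).
    by rewrite (le_trans _ (expR_ge1Dx _))// lerDr ler01.
  have -> : (m%:R * k) ^+ 2 / 4 = (m%:R * k / 2) ^+ 2 by field.
  by rewrite ler_sqr ?nnegrE ?expR_ge0// divr_ge0 ?ltW.
have h4 : expR (- (m%:R * k)) <= 4 / (m%:R * k) ^+ 2.
  by rewrite expRN -[leRHS]invf_div lef_pV2 ?posrE ?expR_gt0 ?divr_gt0 ?exprn_gt0.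
rewrite mulrCA /=.
have -> : Num.sqrt 2 * (4 / k ^+ 2) / m%:R = Num.sqrt 2 * (m%:R * (4 / (m%:R * k) ^+ 2)).
  by field; rewrite !gt_eqF.
by rewrite ler_wpM2l ?sqrtr_ge0// ler_wpM2l// ltW.
Unshelve. all: end_near. Qed.

Lemma scaled_wiener_continuous w : {within `[0, 1], continuous (Y w)}.
Proof.
have h := @wiener_continuous _ _ _ _ _ stdW w; move=> x.
by apply: cvgMl_tmp; exact: h.
Qed.

End scaled_wiener.

(** * Rescaled Levy measures on the half-line *)

Section levy_half_line.
Context {K : realType}.
Notation D := (`]0, +oo[%classic : set K).

(** One half of a Levy measure, carried to the positive half-line: [R], or the
    reflection of [L]. *)
Record levy_half (F : K -> K) : Prop := LevyHalf {
  half_cumul : cumul_pos F ;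
  half_lim : F y @[y --> +oo] --> (0 : K) ;
  half_square : forall e : K, 0 < e ->
    (stieltjes_pos F).-integrable `]0, e]%classic (EFin \o (fun z : K => z ^+ 2)) }.

Lemma half_tail_fin (F : K -> K) (e : K) : levy_half F -> 0 < e -> (stieltjes_pos F `]e, +oo[%classic < +oo)%E.
Proof.
by move=> [H F0 _] e0; rewrite stieltjes_pos_tail ?ltry.
Qed.

Lemma half_tail_mass (F : K -> K) (e : K) : levy_half F -> 0 < e -> tail_mass (stieltjes_pos F) e = - F e.
Proof.
by move=> [H F0 _] e0; rewrite /tail_mass stieltjes_pos_tail.
Qed.

Lemma cos_part_integrable (F : K -> K) (u : K) : levy_half F -> (stieltjes_pos F).-integrable D (EFin \o cos_part u).
Proof.
move=> HF; apply: (levy_integrable_split _ (half_square _ HF) (fun e => half_tail_fin F e HF) (cos_part u) 1 (u ^+ 2) 2 0).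
- exact: ltr01.
- exact: measurable_cos_part.
- by move=> z _; rewrite mul0r addr0; exact: cos_part_quad.
- by move=> z _; exact: cos_part_le2.
Qed.

Lemma sin_part_integrable (F : K -> K) (u : K) : levy_half F -> (stieltjes_pos F).-integrable D (EFin \o sin_part u).
Proof.
move=> HF; apply: (levy_integrable_split _ (half_square _ HF) (fun e => half_tail_fin F e HF) (sin_part u) 1 (`|u| + 2 * u ^+ 2) (1 + `|u|) 0).
- exact: ltr01.
- exact: measurable_sin_part.
- by move=> z z01; exact: sin_part_quad.
- by move=> z z1; apply: sin_part_far; exact: lt_trans z1.
Qed.

Variable F : K -> K.
Hypothesis HF : levy_half F.
Variables (s a : K).
Hypotheses (s0 : 0 < s) (a0 : 0 < a).
Notation Fsa := (fun z => s * F (a * z)).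

Let preD : (fun y => y / a) @^-1` D = D.
Proof. by apply/seteqP; split=> y /=; rewrite !in_itv/= !andbT pmulr_lgt0// invr_gt0. Qed.

Lemma levy_half_scale : levy_half Fsa.
Proof.
have H := half_cumul _ HF.
split; first exact: cumul_pos_scale.
  rewrite -(mulr0 s); apply: cvgMl_tmp; apply: cvg_comp (half_lim _ HF).
  by apply: gt0_cvgMry => //; exact: cvg_id.
move=> e e0.
apply: (proj1 (stieltjes_pos_scale_integral F s a (fun z => z ^+ 2) `]0, e]%classic s0 a0 H _ _ _)).
- exact: measurable_itv.
- by apply: measurable_funTS; exact: exprn_measurable.
rewrite (_ : _ @^-1` _ = `]0, a * e]%classic); last first.
  apply/seteqP; split=> y /=; rewrite !in_itv/= pmulr_lgt0 ?invr_gt0//;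
  by rewrite ler_pdivrMr// (mulrC e).
rewrite (_ : EFin \o _ = (fun y => ((a ^- 2)%:E * (y ^+ 2)%:E)%E)); last first.
  by apply/funext => y /=; rewrite -EFinM; congr EFin; rewrite exprMn exprVn mulrC.
by apply: integrableZl => //; apply: (half_square _ HF); rewrite mulr_gt0.
Qed.

Lemma cos_part_scale (u : K) :
  \int[stieltjes_pos Fsa]_(z in D) cos_part u z =
  s * \int[stieltjes_pos F]_(z in D) cos_part (u / a) z.
Proof.
have E : (fun y => cos_part u (y / a)) = cos_part (u / a).
  by apply/funext => y; rewrite /cos_part mulrAC mulrA.
have mD : measurable D by exact: measurable_itv.
have ic : (stieltjes_pos F).-integrable ((fun y => y / a) @^-1` D)
    (EFin \o (fun y => cos_part u (y / a))).
  by rewrite preD E; exact: cos_part_integrable.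
have [_ ->] := stieltjes_pos_scale_integral F s a (cos_part u) D s0 a0 (half_cumul _ HF)
  mD (measurable_cos_part u _) ic.
by rewrite preD E.
Qed.

(** The integrand of the centring constants [b n]. *)
Definition drift_term (z : K) : K :=
  z ^+ 3 * (a ^+ 2 - 1) / ((1 + z ^+ 2) * (1 + a ^+ 2 * z ^+ 2)).

(** Where [b n] comes from: after the substitution [z = y / a] the compensator
    [y / (1 + y^2)] becomes [a z / (1 + a^2 z^2)], and the drift term is its
    difference from [z / (1 + z^2)]. *)
Lemma sin_part_drift (u y : K) :
  sin_part u (y / a) + u * drift_term (y / a) = sin_part (u / a) y.
Proof.
rewrite /sin_part /drift_term mulrAC mulrA.
have h1 : 1 + (y / a) ^+ 2 != 0 by rewrite gt_eqF// ltr_pwDl// sqr_ge0.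
have h2 : 1 + y ^+ 2 != 0 by rewrite gt_eqF// ltr_pwDl// sqr_ge0.
have h3 : a ^+ 2 + y ^+ 2 != 0 by rewrite gt_eqF// ltr_pwDl ?exprn_gt0// sqr_ge0.
have an : a != 0 by rewrite gt_eqF.
rewrite (_ : u / a * y = u * y / a); last by rewrite mulrAC.
rewrite -addrA; congr (_ + _).
by field; rewrite ?an ?h1 ?h2 ?h3.
Qed.

Let sin_drift_scale (u : K) :
  (stieltjes_pos Fsa).-integrable D (EFin \o (fun z => sin_part u z + u * drift_term z)) /\
  \int[stieltjes_pos Fsa]_(z in D) (sin_part u z + u * drift_term z) =
  s * \int[stieltjes_pos F]_(z in D) sin_part (u / a) z.
Proof.
have E : (fun y => sin_part u (y / a) + u * drift_term (y / a)) = sin_part (u / a).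
  by apply/funext => y; exact: sin_part_drift.
have := stieltjes_pos_scale_integral F s a (fun z => sin_part u z + u * drift_term z) D s0 a0 (half_cumul _ HF).
rewrite preD E; apply.
- exact: measurable_itv.
- have := @measurable_sin_part K (u / a) setT.
  rewrite (_ : (fun z => sin_part u z + u * drift_term z) = sin_part (u / a) \o ( *%R a)); last first.
    by apply/funext => z /=; rewrite -sin_part_drift (mulrC a) mulfK// gt_eqF.
  move=> m; apply: measurable_funTS; apply: measurableT_comp => //; exact: mulrl_measurable.
- exact: sin_part_integrable.
Qed.

(** A difference of two compensated sines with [u = 1], each integrable. *)
Lemma drift_integrable : (stieltjes_pos Fsa).-integrable D (EFin \o drift_term).
Proof.
have [i _] := sin_drift_scale 1.
have mD : measurable D by exact: measurable_itv.
have HS := levy_half_scale.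
rewrite (_ : EFin \o _ = ((EFin \o (fun z => (sin_part 1 z + 1 * drift_term z)%R)) \- (EFin \o sin_part 1))%E).
  by apply: integrableB => //; exact: (sin_part_integrable _ _ HS).
by apply/funext => z /=; rewrite -EFinB; congr EFin; ring.
Qed.

Lemma sin_part_scale (u : K) :
  \int[stieltjes_pos Fsa]_(z in D) sin_part u z + u * \int[stieltjes_pos Fsa]_(z in D) drift_term z =
  s * \int[stieltjes_pos F]_(z in D) sin_part (u / a) z.
Proof.
have [_ <-] := sin_drift_scale u.
have mD : measurable D by exact: measurable_itv.
have i1 := sin_part_integrable _ u levy_half_scale.
have i2 : (stieltjes_pos Fsa).-integrable D (EFin \o (fun z => u * drift_term z)).
  rewrite (_ : EFin \o _ = (fun z => u%:E * (EFin \o drift_term) z)%E); last by [].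
  by apply: integrableZl => //; exact: drift_integrable.
by rewrite RintegralD// RintegralZl//; exact: drift_integrable.
Qed.

End levy_half_line.

(** * The characteristic function of a Levy process in real form *)

Section levy_transform.
Context {K : realType}.
Notation D := (`]0, +oo[%classic : set K).
Notation reflected L := (fun y => - L (- y)).

Lemma levy_half_pos (L R : K -> K) : levy_measures L R -> levy_half R.
Proof.
move=> [_ _ cR R0 int]; split=> // e e0.
apply/integrableP; split.
  by apply/measurable_EFinP; apply: measurable_funTS; exact: exprn_measurable.
under eq_integral do rewrite /= ger0_norm ?sqr_ge0//.
apply: le_lt_trans (int e e0); rewrite leeDr//.
by apply: integral_ge0 => y _; rewrite lee_fin sqr_ge0.
Qed.

Lemma levy_half_neg (L R : K -> K) : levy_measures L R -> levy_half (reflected L).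
Proof.
move=> [cL L0 _ _ int]; split; first exact: cumul_neg_pos.
  rewrite -oppr0; apply: cvgN; exact/cvgNy_compNP.
move=> e e0.
apply/integrableP; split.
  by apply/measurable_EFinP; apply: measurable_funTS; exact: exprn_measurable.
under eq_integral do rewrite /= ger0_norm ?sqr_ge0//.
apply: le_lt_trans (int e e0).
rewrite [in leLHS](_ : `]0, e]%classic = -%R @^-1` `[(- e), 0[%classic); last first.
  by apply/seteqP; split=> y /=; rewrite !in_itv/= lerN2 oppr_lt0 andbC.
apply: (@le_trans _ _ (\int[stieltjes_neg L]_(y in `[(- e)%R, 0%R[) (y ^+ 2)%:E)%E).
  rewrite stieltjes_neg_ge0_integral//.
  - by under eq_integral do rewrite -sqrrN.
  - by move=> y _; exact: sqr_ge0.
rewrite leeDl//.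
by apply: integral_ge0 => y _; rewrite lee_fin sqr_ge0.
Qed.

(** After the reflection of [L] to the half-line, the even part of the integrand adds
    up in the real part of the exponent and the odd part subtracts in the imaginary
    part. *)
Definition char_re (sigma : K) (L R : K -> K) (x : K) : K :=
  - (sigma ^+ 2 * x ^+ 2 / 2) +
  (\int[stieltjes_pos (reflected L)]_(z in D) cos_part x z + \int[stieltjes_pos R]_(z in D) cos_part x z).

Definition char_im (L R : K -> K) (x : K) : K :=
  \int[stieltjes_pos R]_(z in D) sin_part x z - \int[stieltjes_pos (reflected L)]_(z in D) sin_part x z.

Lemma cexp_imag (r : K) : cexp ('i * r%:C)%C = (cos r +i* sin r)%C.
Proof. by rewrite /cexp /=; simpc; rewrite expR0 !mul1r. Qed.

Lemma levy_integrandE (x y : K) :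
  levy_integrand x y = (cos_part x y +i* sin_part x y)%C.
Proof. by rewrite /levy_integrand cexp_imag /=; simpc; rewrite /cos_part /sin_part. Qed.

Lemma preimage_opp_neg : -%R @^-1` (`]-oo, 0[%classic : set K) = D.
Proof. by apply/seteqP; split=> y /=; rewrite !in_itv/= andbT oppr_lt0. Qed.

Lemma levy_exponentE (sigma : K) (L R : K -> K) (x t : K) : levy_measures L R ->
  levy_exponent sigma L R x t = (t * char_re sigma L R x +i* (t * char_im L R x))%C.
Proof.
move=> LR; have HR := levy_half_pos _ _ LR; have HL := levy_half_neg _ _ LR.
have mN : measurable (`]-oo, 0[%classic : set K) by exact: measurable_itv.
have cosN (z : K) : cos_part x (- z) = cos_part x z by rewrite /cos_part mulrN cosN.
have sinN (z : K) : sin_part x (- z) = - sin_part x z.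
  by rewrite /sin_part !mulrN sinN sqrrN; ring.
rewrite /levy_exponent /cintegral.
have -> : \int[stieltjes_neg L]_(y in `]-oo, 0[) complex.Re (levy_integrand x y) =
    \int[stieltjes_pos (reflected L)]_(z in D) cos_part x z.
  under eq_Rintegral do rewrite levy_integrandE /=.
  rewrite stieltjes_neg_Rintegral//.
  - by rewrite preimage_opp_neg; under eq_Rintegral do rewrite cosN.
  - exact: measurable_cos_part.
  - by rewrite preimage_opp_neg; rewrite (funext cosN); exact: cos_part_integrable.
have -> : \int[stieltjes_neg L]_(y in `]-oo, 0[) complex.Im (levy_integrand x y) =
    - \int[stieltjes_pos (reflected L)]_(z in D) sin_part x z.
  under eq_Rintegral do rewrite levy_integrandE /=.
  have iN : (stieltjes_pos (reflected L)).-integrable D (EFin \o (fun z => - sin_part x z)).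
    rewrite (_ : EFin \o _ = (fun z => - (EFin \o sin_part x) z)%E); last by [].
    by apply: integrableN => //; exact: sin_part_integrable.
  rewrite stieltjes_neg_Rintegral//.
  - rewrite preimage_opp_neg; under eq_Rintegral do rewrite sinN.
    under eq_Rintegral do rewrite -mulN1r.
    by rewrite RintegralZl ?mulN1r//; exact: sin_part_integrable.
  - exact: measurable_sin_part.
  - by rewrite preimage_opp_neg (funext sinN).
have -> : \int[stieltjes_pos R]_(y in D) complex.Re (levy_integrand x y) =
    \int[stieltjes_pos R]_(z in D) cos_part x z.
  by apply: eq_Rintegral => y _; rewrite levy_integrandE.
have -> : \int[stieltjes_pos R]_(y in D) complex.Im (levy_integrand x y) =
    \int[stieltjes_pos R]_(z in D) sin_part x z.
  by apply: eq_Rintegral => y _; rewrite levy_integrandE.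
have combine (c1 c2 s1 s2 : K) :
    (- (sigma ^+ 2 * x ^+ 2 * t / 2)%:C + t%:C * ((c1 +i* - s1) + (c2 +i* s2)))%C =
    (t * (- (sigma ^+ 2 * x ^+ 2 / 2) + (c1 + c2)) +i* (t * (s2 - s1)))%C.
  by simpc; congr (_ +i* _)%C; ring.
exact: combine.
Qed.

Lemma cexp_re_im (p q : K) : cexp (p +i* q)%C = (expR p * cos q +i* (expR p * sin q))%C.
Proof. by rewrite /cexp /=; simpc. Qed.

Section levy_means.
Context {d : measure_display} {T : measurableType d}.
Variables (P : probability T K) (sigma : K) (L R : K -> K) (V : K -> T -> K).
Hypothesis HV : levy_process_with P sigma L R V.

Let transform (x t : K) : 0 <= t ->
  (\int[P]_w cos (x * V t w) +i* \int[P]_w sin (x * V t w))%C =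
  (expR (t * char_re sigma L R x) * cos (t * char_im L R x) +i*
   (expR (t * char_re sigma L R x) * sin (t * char_im L R x)))%C.
Proof.
move=> t0; have [LR _ h] := HV.
rewrite -cexp_re_im -levy_exponentE// -h// /cintegral; congr (_ +i* _)%C;
  by apply: eq_Rintegral => w _; rewrite cexp_imag.
Qed.

Lemma levy_mean_cos (x t : K) : 0 <= t -> \int[P]_w cos (x * V t w) =
  expR (t * char_re sigma L R x) * cos (t * char_im L R x).
Proof. by move=> t0; have [] := transform x t t0. Qed.

Lemma levy_mean_sin (x t : K) : 0 <= t -> \int[P]_w sin (x * V t w) =
  expR (t * char_re sigma L R x) * sin (t * char_im L R x).
Proof. by move=> t0; have [] := transform x t t0. Qed.

End levy_means.

End levy_transform.

(** * The rescaled process *)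

Section rescaled_levy.
Context {K : realType} {d : measure_display} {T : measurableType d}.
Variables (P : probability T K) (sigma : K) (L R : K -> K) (V : K -> T -> K).
Hypothesis HV : levy_process_with P sigma L R V.
Variables (s a b : K) (X : T -> skorohod K).
Hypotheses (s0 : 0 < s) (a0 : 0 < a).
Hypothesis XE : forall w t, 0 <= t <= 1 -> X w t = V (s * t) w / a - t * b.

Let levyV : levy_process P V. Proof. by have [] := HV. Qed.

Let st0 t : 0 <= t <= 1 -> 0 <= s * t.
Proof. by move=> /andP[t0 _]; rewrite mulr_ge0// ltW. Qed.

Let maff (c : K) : measurable_fun [set: K] (fun v : K => v / a - c).
Proof. by apply: measurable_funB => //; exact: mulrr_measurable. Qed.

Let mpre (c : K) (B : set K) : measurable B -> measurable ((fun v : K => v / a - c) @^-1` B).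
Proof. by move=> mB; rewrite -[X in measurable X]setTI; exact: maff. Qed.

Let increment w t t' : 0 <= t <= 1 -> 0 <= t' <= 1 ->
  X w t' - X w t = (V (s * t') w - V (s * t) w) / a - (t' - t) * b.
Proof. by move=> t01 t'01; rewrite !XE//; ring. Qed.

Lemma rescaled_levy_stationary : stationary_process P (fun t w => X w t).
Proof.
split.
- move=> t t01; rewrite (_ : (fun w => X w t) = (fun v => v / a - t * b) \o V (s * t)).
    by apply: measurableT_comp => //; exact/(levy_measurable levyV)/st0.
  by apply/funext => w /=; rewrite XE.
- by move=> w; rewrite XE ?lexx ?ler01// mulr0 (levy_start levyV) mul0r mul0r subrr.
- by move=> w t t01; have [h _] := path_cadlag (X w); exact: h.
- move=> n t t01 tnd B mB /=.
  have t01' i : (i <= n)%N -> 0 <= t i <= 1 by move=> /t01; rewrite /= in_itv.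
  have := @levy_independent _ _ _ _ _ levyV n (fun i => s * t i).
  have h1 i : (i <= n)%N -> [set t | 0 <= t] (s * t i) by move=> /t01'/st0.
  have h2 i : (i < n)%N -> s * t i <= s * t i.+1 by move=> /tnd; rewrite ler_pM2l.
  move=> /(_ h1 h2 (fun i : 'I_n => (fun v => v / a - (t i.+1 - t i) * b) @^-1` B i)).
  move=> /(_ (fun i => mpre _ _ (mB i))).
  have E (i : 'I_n) w : X w (t i.+1) - X w (t i) =
      (V (s * t i.+1) w - V (s * t i) w) / a - (t i.+1 - t i) * b.
    by apply: increment; apply: t01' => //; exact: ltnW.
  rewrite /= => h; rewrite (_ : [set w | _] = [set w | forall i : 'I_n,
    B i ((V (s * t i.+1) w - V (s * t i) w) / a - (t i.+1 - t i) * b)]).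
    rewrite h; apply: eq_bigr => i _; congr (P _).
    by apply/seteqP; split=> w /=; rewrite E.
  by apply/seteqP; split=> w /= hw i; have := hw i; rewrite E.
- move=> r h B r0 h0 rh1 mB /=.
  have r01 : 0 <= r <= 1 by rewrite r0 (le_trans _ rh1)// lerDl.
  have h01 : 0 <= h <= 1 by rewrite h0 (le_trans _ rh1)// lerDr.
  have rh01 : 0 <= r + h <= 1 by rewrite addr_ge0.
  have := levy_homogeneous levyV (st0 _ r01) (st0 _ h01) (mpre (h * b) _ mB).
  rewrite /= -mulrDr => E.
  rewrite (_ : [set w | _] = [set w | B ((V (s * (r + h)) w - V (s * r) w) / a - h * b)]).
    by rewrite E; congr (P _); apply/seteqP; split=> w /=; rewrite XE.
  by apply/seteqP; split=> w /=; rewrite increment// (addrC r h) addrK.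
Qed.

Let mV t : 0 <= t <= 1 -> measurable_fun setT (fun w => V (s * t) w / a).
Proof. by move=> t01; apply: measurable_funM => //; exact/(levy_measurable levyV)/st0. Qed.

Let mul_div u t w : u * (V (s * t) w / a) = u / a * V (s * t) w. Proof. by ring. Qed.

Lemma rescaled_levy_cos (u t : K) : 0 <= t <= 1 ->
  \int[P]_w cos (u * X w t) = expR (t * (s * char_re sigma L R (u / a))) *
    cos (t * (s * char_im L R (u / a) - u * b)).
Proof.
move=> t01; under eq_Rintegral do rewrite XE//.
rewrite mean_cosB; last exact: mV.
under eq_Rintegral do rewrite mul_div.
under [in X in _ + X]eq_Rintegral do rewrite mul_div.
rewrite (levy_mean_cos _ _ _ _ _ HV) ?st0// (levy_mean_sin _ _ _ _ _ HV) ?st0//.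
rewrite (_ : t * (_ - _) = s * t * char_im L R (u / a) - u * (t * b)); last by ring.
by rewrite cosB (_ : t * (s * _) = s * t * char_re sigma L R (u / a)); ring.
Qed.

Lemma rescaled_levy_sin (u t : K) : 0 <= t <= 1 ->
  \int[P]_w sin (u * X w t) = expR (t * (s * char_re sigma L R (u / a))) *
    sin (t * (s * char_im L R (u / a) - u * b)).
Proof.
move=> t01; under eq_Rintegral do rewrite XE//.
rewrite mean_sinB; last exact: mV.
under eq_Rintegral do rewrite mul_div.
under [in X in _ - X]eq_Rintegral do rewrite mul_div.
rewrite (levy_mean_cos _ _ _ _ _ HV) ?st0// (levy_mean_sin _ _ _ _ _ HV) ?st0//.
rewrite (_ : t * (_ - _) = s * t * char_im L R (u / a) - u * (t * b)); last by ring.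
by rewrite sinB (_ : t * (s * _) = s * t * char_re sigma L R (u / a)); ring.
Qed.

End rescaled_levy.

(** * Convergence of the rescaled exponents *)

Section limsup.
Context {K : realType}.

Lemma limn_esup_near (u : nat -> \bar K) (l : \bar K) : (limn_esup u < l)%E ->
  \forall n \near \oo, (u n < l)%E.
Proof.
move=> /ereal_inf_lt[_ [A FA <-] h]; apply: filterS FA => n An.
by apply: le_lt_trans h; apply: ereal_sup_ubound; exists n.
Qed.

Lemma limn_einf_near (u : nat -> \bar K) (l : \bar K) : (l < limn_einf u)%E ->
  \forall n \near \oo, (l < u n)%E.
Proof.
rewrite /limn_einf lteNr => /limn_esup_near; apply: filterS => n.
by rewrite lteN2.
Qed.

End limsup.

Section rescaled_measures.
Context {K : realType}.
Notation D := (`]0, +oo[%classic : set K).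
Notation reflected L := (fun y => - L (- y)).
Variables (sigma : K) (L R : K -> K) (s a b : nat -> K).
Hypothesis LR : levy_measures L R.
Hypotheses (s0 : forall n, 0 < s n) (a0 : forall n, 0 < a n).
Hypothesis bE : forall n, b n =
  \int[stieltjes_neg (fun z => s n * L (a n * z))]_(z in `]-oo, 0[) drift_term (a n) z
  + \int[stieltjes_pos (fun z => s n * R (a n * z))]_(z in D) drift_term (a n) z.

Definition right_measure n : {measure set K -> \bar K} :=
  stieltjes_pos (fun z => s n * R (a n * z)).
Definition left_measure n : {measure set K -> \bar K} :=
  stieltjes_pos (fun z => s n * reflected L (a n * z)).
Definition diffusion n : K := sigma ^+ 2 / a n ^+ 2 * s n.

Let HR := levy_half_pos L R LR.
Let HL := levy_half_neg L R LR.

Let HRn n : levy_half (fun z => s n * R (a n * z)).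
Proof. exact: levy_half_scale. Qed.

Let HLn n : levy_half (fun z => s n * reflected L (a n * z)).
Proof. exact: levy_half_scale HL _ _ _ _. Qed.

Let reflectE n : reflected (fun z => s n * L (a n * z)) = (fun z => s n * reflected L (a n * z)).
Proof. by apply/funext => z; rewrite mulrN (mulrN (s n)). Qed.

Lemma exponent_re_rescaled n u :
  exponent_re right_measure left_measure diffusion n u = s n * char_re sigma L R (u / a n).
Proof.
rewrite /exponent_re /char_re /right_measure /left_measure.
rewrite (cos_part_scale R)// (cos_part_scale (reflected L))// /diffusion.
have combine (c1 c2 : K) : - (sigma ^+ 2 / a n ^+ 2 * s n * u ^+ 2 / 2) + (s n * c1 + s n * c2) =
    s n * (- (sigma ^+ 2 * (u / a n) ^+ 2 / 2) + (c1 + c2)).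
  by field; rewrite gt_eqF.
exact: combine.
Qed.

Let measurable_drift n (E : set K) : measurable_fun E (drift_term (a n)).
Proof.
apply: measurable_funTS; apply: continuous_measurable_fun => z.
have h (x : K) : 0 < 1 + x ^+ 2 by rewrite ltr_pwDl// sqr_ge0.
have c2 : x ^+ 2 @[x --> z] --> z ^+ 2 by exact: exprn_continuous.
apply: cvgM.
  by apply: cvgM; [exact: exprn_continuous|exact: cvg_cst].
apply: cvgV; first by rewrite -exprMn mulf_neq0// gt_eqF.
apply: cvgM; apply: cvgD; [exact: cvg_cst|exact: c2|exact: cvg_cst|].
by apply: cvgM; [exact: cvg_cst|exact: c2].
Qed.

Lemma exponent_im_rescaled n u :
  exponent_im right_measure left_measure n u = s n * char_im L R (u / a n) - u * b n.
Proof.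
have i := drift_integrable (reflected L) HL _ _ (s0 n) (a0 n).
have driftN z : drift_term (a n) (- z) = - drift_term (a n) z.
  by rewrite /drift_term exprNn sqrrN; ring.
have iN : (left_measure n).-integrable D (EFin \o (fun z => - drift_term (a n) z)).
  rewrite (_ : EFin \o _ = (fun z => - (EFin \o drift_term (a n)) z)%E); last by [].
  exact: integrableN.
have neg : \int[stieltjes_neg (fun z => s n * L (a n * z))]_(z in `]-oo, 0[) drift_term (a n) z =
    - \int[left_measure n]_(z in D) drift_term (a n) z.
  rewrite stieltjes_neg_Rintegral//.
  - rewrite preimage_opp_neg reflectE; under eq_Rintegral do rewrite driftN.
    under eq_Rintegral do rewrite -mulN1r.
    by rewrite RintegralZl ?mulN1r.
  - by rewrite preimage_opp_neg (funext driftN) reflectE.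
rewrite bE neg /exponent_im /char_im.
have e1 := sin_part_scale R HR _ _ (s0 n) (a0 n) u.
have e2 := sin_part_scale (reflected L) HL _ _ (s0 n) (a0 n) u.
have combine (x1 x2 d1 d2 p q : K) : x1 + u * d1 = s n * p -> x2 + u * d2 = s n * q ->
    x1 - x2 = s n * (p - q) - u * (- d2 + d1).
  by move=> h1 h2; rewrite mulrBr -h1 -h2; ring.
exact: combine e1 e2.
Qed.

Lemma square_right n (e : K) : 0 < e ->
  (right_measure n).-integrable `]0, e]%classic (EFin \o (fun z : K => z ^+ 2)).
Proof. exact: (half_square _ (HRn n)). Qed.

Lemma square_left n (e : K) : 0 < e ->
  (left_measure n).-integrable `]0, e]%classic (EFin \o (fun z : K => z ^+ 2)).
Proof. exact: (half_square _ (HLn n)). Qed.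

Lemma tail_right n (e : K) : 0 < e -> (right_measure n `]e, +oo[%classic < +oo)%E.
Proof. exact: (half_tail_fin _ _ (HRn n)). Qed.

Lemma tail_left n (e : K) : 0 < e -> (left_measure n `]e, +oo[%classic < +oo)%E.
Proof. exact: (half_tail_fin _ _ (HLn n)). Qed.

Lemma tail_right_cvg (e : K) : 0 < e -> s n * R (a n * e) @[n --> \oo] --> (0 : K) ->
  tail_mass (right_measure n) e @[n --> \oo] --> (0 : K).
Proof.
move=> e0 h; under eq_fun do rewrite (half_tail_mass _ _ (HRn _) e0).
by rewrite -oppr0; exact: cvgN.
Qed.

Lemma tail_left_cvg (e : K) : 0 < e -> s n * L (a n * - e) @[n --> \oo] --> (0 : K) ->
  tail_mass (left_measure n) e @[n --> \oo] --> (0 : K).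
Proof.
move=> e0 h; under eq_fun do rewrite (half_tail_mass _ _ (HLn _) e0).
by apply: cvg_trans h; under eq_fun do rewrite -mulrN opprK -mulrN.
Qed.

Definition truncated_variance (e : K) (n : nat) : \bar K :=
  (\int[stieltjes_neg (fun u => s n * L (a n * u))%R]_(u in `[(- e)%R, 0%R[) (u ^+ 2)%:E
   + (diffusion n)%:E
   + \int[stieltjes_pos (fun u => s n * R (a n * u))%R]_(u in `]0%R, e]) (u ^+ 2)%:E)%E.

Lemma truncated_varianceE n (e : K) : 0 < e ->
  truncated_variance e n = (total_square right_measure left_measure diffusion e n)%:E.
Proof.
move=> e0.
have fin (nu : {measure set K -> \bar K}) :
    nu.-integrable `]0, e]%classic (EFin \o (fun z : K => z ^+ 2)) ->
    (\int[nu]_(z in `]0%R, e]) (z ^+ 2)%:E)%E = (small_square nu e)%:E.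
  by move=> i; rewrite /small_square /Rintegral fineK// integrable_fin_num.
have right := fin _ (square_right n e e0).
have mI : measurable (`[- e, 0[%classic : set K) by exact: measurable_itv.
have msq : measurable_fun `[- e, 0[%classic (fun z : K => z ^+ 2).
  by apply: measurable_funTS; exact: exprn_measurable.
have := stieltjes_neg_ge0_integral (fun u => s n * L (a n * u)) _ _ mI msq (fun y _ => sqr_ge0 y).
rewrite reflectE (_ : -%R @^-1` _ = `]0, e]%classic); last first.
  by apply/seteqP; split=> y /=; rewrite !in_itv/= lerN2 oppr_lt0 andbC.
under [X in _ = X -> _]eq_integral do rewrite sqrrN.
rewrite (fin _ (square_left n e e0)) => left.
by rewrite /truncated_variance left right.
Qed.

(** An upper limit below [v + dl] and a lower limit above [v - dl] confine the sequence
    itself from some index on. *)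
Lemma total_square_near (v dl : K) : 0 < dl ->
  limn_esup (truncated_variance e) @[e --> (0 : K)^'+] --> v%:E ->
  limn_einf (truncated_variance e) @[e --> (0 : K)^'+] --> v%:E ->
  \forall e \near (0 : K)^'+, \forall n \near \oo,
    `|total_square right_measure left_measure diffusion e n - v| <= dl.
Proof.
move=> dl0 /fine_cvgP[f1 c1] /fine_cvgP[f2 c2].
have u1 : \forall e \near (0 : K)^'+, (limn_esup (truncated_variance e) < (v + dl)%:E)%E.
  near=> e; rewrite -[X in (X < _)%E]fineK; last by near: e.
  by rewrite lte_fin; near: e; apply: (cvgr_lt _ c1); rewrite ltrDl.
have u2 : \forall e \near (0 : K)^'+, ((v - dl)%:E < limn_einf (truncated_variance e))%E.
  near=> e; rewrite -[X in (_ < X)%E]fineK; last by near: e.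
  by rewrite lte_fin; near: e; apply: (cvgr_gt _ c2); rewrite gtrBl.
near=> e.
have e0 : 0 < e by near: e; exact: nbhs_right_gt.
have h1 : (limn_esup (truncated_variance e) < (v + dl)%:E)%E by near: e.
have h2 : ((v - dl)%:E < limn_einf (truncated_variance e))%E by near: e.
apply: filterS (filterI (limn_esup_near _ _ h1) (limn_einf_near _ _ h2)) => n [].
rewrite truncated_varianceE// !lte_fin => lt gt.
by rewrite ler_norml lerBrDr lerBlDl (ltW lt) addrC (ltW gt).
Unshelve. all: end_near. Qed.

End rescaled_measures.

Theorem theorem4 (K : realType)
    (d : measure_display) (T : measurableType d) (P : probability T K)
    (d' : measure_display) (T' : measurableType d') (P' : probability T' K)
    (sigma : K) (L R : K -> K) (V : K -> T -> K)
    (sigmaW : K) (s a b : nat -> K)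
    (X : nat -> T -> skorohod K) (W : T' -> skorohod K) :
  levy_process_with P sigma L R V ->
  x ^+ 2 * (\int[stieltjes_neg L]_(y in `]-oo, - x[) 1
            + \int[stieltjes_pos R]_(y in `]x, +oo[) 1)
    / (\int[stieltjes_neg L]_(y in `[- x, 0[) y ^+ 2
       + \int[stieltjes_pos R]_(y in `]0, x]) y ^+ 2)
    @[x --> +oo] --> 0 ->
  0 <= sigmaW ->
  (forall n, 0 < s n) -> (forall n, 0 < a n) ->
  s n @[n --> \oo] --> +oo -> a n @[n --> \oo] --> +oo ->
  (forall y, y < 0 -> s n * L (a n * y) @[n --> \oo] --> 0) ->
  (forall y, 0 < y -> s n * R (a n * y) @[n --> \oo] --> 0) ->
  (let Q (e : K) (n : nat) : \bar K :=
     (\int[stieltjes_neg (fun u => s n * L (a n * u))%R]_(u in `[(- e)%R, 0%R[)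
        (u ^+ 2)%:E
      + (sigma ^+ 2 / a n ^+ 2 * s n)%:E
      + \int[stieltjes_pos (fun u => s n * R (a n * u))%R]_(u in `]0%R, e])
        (u ^+ 2)%:E)%E in
   limn_esup (Q e) @[e --> 0^'+] --> (sigmaW ^+ 2)%:E /\
   limn_einf (Q e) @[e --> 0^'+] --> (sigmaW ^+ 2)%:E) ->
  (forall n, b n =
     \int[stieltjes_neg (fun z => s n * L (a n * z))]_(z in `]-oo, 0[)
       (z ^+ 3 * (a n ^+ 2 - 1) / ((1 + z ^+ 2) * (1 + a n ^+ 2 * z ^+ 2)))
     + \int[stieltjes_pos (fun z => s n * R (a n * z))]_(z in `]0, +oo[)
       (z ^+ 3 * (a n ^+ 2 - 1) / ((1 + z ^+ 2) * (1 + a n ^+ 2 * z ^+ 2)))) ->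
  (forall n w t, 0 <= t <= 1 -> X n w t = V (s n * t) w / a n - t * b n) ->
  standard_wiener P' W ->
  cvg_in_distribution P X P' (fun w => skorohod_scale sigmaW (W w)).
Proof.
move=> HV _ c0 s0 a0 _ _ L0 R0 [Qsup Qinf] bE XE stdW.
have [LR _ _] := HV.
pose nup := right_measure R s a; pose num := left_measure L s a.
pose sg := diffusion sigma s a.
have sqp := square_right L R s a LR s0 a0 : forall n e, 0 < e -> (nup n).-integrable _ _.
have sqm := square_left L R s a LR s0 a0 : forall n e, 0 < e -> (num n).-integrable _ _.
have finp := tail_right L R s a LR s0 a0.
have finm := tail_left L R s a LR s0 a0.
have sg0 n : 0 <= sg n.
  by rewrite /sg /diffusion mulr_ge0 ?(ltW (s0 n))// divr_ge0 ?sqr_ge0.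
have tailp (e : K) : 0 < e -> tail_mass (nup n) e @[n --> \oo] --> (0 : K).
  by move=> e0; apply: (tail_right_cvg L R) => //; exact: R0.
have tailm (e : K) : 0 < e -> tail_mass (num n) e @[n --> \oo] --> (0 : K).
  by move=> e0; apply: (tail_left_cvg L R) => //; apply: L0; rewrite oppr_lt0.
have near (dl : K) : 0 < dl -> \forall e \near (0 : K)^'+, \forall n \near \oo,
    `|total_square nup num sg e n - sigmaW ^+ 2| <= dl.
  by move=> dl0; exact: (total_square_near sigma L R s a LR s0 a0 _ dl dl0 Qsup Qinf).
have [C C0 HC] := exponent_bound nup num sg _ sqp sqm finp finm sg0 tailp tailm near.
apply: (cvg_in_distribution_stationary P P' X _ (exponent_re nup num sg) (exponent_im nup num) (sigmaW ^+ 2) C).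
- move=> n; apply: (rescaled_levy_stationary P sigma L R V HV (s n) (a n) (b n) (X n)) => //.
  exact: XE.
- exact: scaled_wiener_stationary.
- move=> n u t t01; rewrite (rescaled_levy_cos P sigma L R V HV (s n) (a n) (b n))//; last exact: XE.
  by rewrite -(exponent_re_rescaled sigma L R s a)// -(exponent_im_rescaled L R s a b).
- move=> n u t t01; rewrite (rescaled_levy_sin P sigma L R V HV (s n) (a n) (b n))//; last exact: XE.
  by rewrite -(exponent_re_rescaled sigma L R s a)// -(exponent_im_rescaled L R s a b).
- by move=> u t t01; exact: scaled_wiener_cos.
- by move=> u t t01; exact: scaled_wiener_sin.
- exact: sqr_ge0.
- exact: C0.
- by move=> n u; exact: exponent_re_le0.
- by move=> u; apply: exponent_re_cvg sqp sqm finp finm sg0 tailp tailm near u.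
- by move=> u; apply: exponent_im_cvg sqp sqm finp finm sg0 tailp tailm near u.
- exact: HC.
- by move=> w; apply: (scaled_wiener_continuous P' W sigmaW stdW).
- by move=> t x t01 x0; apply: (scaled_wiener_atom P' W sigmaW stdW).
- by move=> e e0; apply: (scaled_wiener_tail P' W sigmaW stdW).
Qed.
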